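(* Let $(V,d^\lambda)$ be a $k$-perturbed harmonic bundle in $\underline{\mathbb{C}}^{n+2}$, let $\alpha\in\mathbb{C}^\times\setminus S^1$, and let $L\leq\underline{\mathbb{C}}^{n+2}$ be a $d^\alpha$-parallel null line subbundle with $L,\rho_VL$ complementary. Set $L'=p^V_{\alpha,L}(\alpha^* )\overline{L}$ and $V'=p^V_{\alpha,L}(0)V$, and assume that $L',\rho_{V'}L'$ are also complementary. Then $$r:=p^{V'}_{\alpha^*,L'}\,p^V_{\alpha,L}$$ is a dressing gauge for $(V,d^\lambda)$.
   Context: Setting. $\Sigma$ is a Riemann surface. $\mathbb{R}^{n+1,1}$ is Lorentzian space with inner product $(\,,\,)$, and $\mathbb{C}^{n+2}=\mathbb{R}^{n+1,1}\otimes\mathbb{C}$ carries the complex bilinear extension of $(\,,\,)$ and the complex conjugation with fixed set $\mathbb{R}^{n+1,1}$. Underlining denotes the trivial bundle over $\Sigma$, and $d$ is the trivial connection. Subbundles are complex; a subbundle is real if stable under conjugation. A bundle of $(3,1)$-planes is a real non-degenerate rank $4$ subbundle $V\leq\underline{\mathbb{C}}^{n+2}$ with $V\cap\underline{\mathbb{R}}^{n+1,1}$ of signature $(3,1)$. For a non-degenerate subbundle $V$, $\rho_V$ is reflection across $V$ ($+1$ on $V$, $-1$ on $V^\perp$). Gauge action: $g\cdot\nabla=g\circ\nabla\circ g^{-1}$. For $\lambda\in\mathbb{P}^1=\mathbb{C}\cup\{\infty\}$, $\lambda^*=1/\bar\lambda$. $k$-perturbed harmonic. For $k\in\mathbb{N}$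 and $V$ a bundle of $(3,1)$-planes, $(V,d^{\lambda})$ is a $k$-perturbed harmonic bundle if $d^\lambda$, $\lambda\in\mathbb{C}^\times$, is a family of flat metric connections on $\underline{\mathbb{C}}^{n+2}$ with $d^1=d$, $\rho_V\cdot d^\lambda=d^{-\lambda}$, $d^{\lambda^*}=\overline{d^\lambda}$, and such that $\lambda\mapsto(d^\lambda)^{1,0}$ is holomorphic on $\mathbb{C}$ with a pole of order $k$ at $\infty$ (whence $\lambda\mapsto(d^\lambda)^{0,1}$ is holomorphic on $\mathbb{C}^\times\cup\{\infty\}$ with a pole of order $k$ at $0$). Dressing gauge. A dressing gauge for $(V,d^\lambda)$ is a family of gauge transformations $\lambda\mapsto r(\lambda)\in\Gamma\mathrm{O}(\underline{\mathbb{C}}^{n+2})$, defined for $\lambda\in\mathrm{dom}(r)\subset\mathbb{P}^1$ (with $\mathrm{dom}(r)$ containing neighbourhoods of $0,\infty$ and stable under $\lambda\mapsto-\lambda$ and $\lambda\mapsto\pm\lambda^*$), holomorphic in $\lambda$ near $0$ and $\infty$, such that: (i) $r(-\lambda)\circ\rho_V\circ r(\lambda)^{-1}$ is independent of $\lambda\in\mathrm{dom}(r)$; (ii) $r(\lambda^* )=\overline{r(\lambda)}$ for all $\lambda\in\mathrm{dom}(r)$; (iii) the connections $r(\lambda)\cdot d^\lambda$ extend from $\mathrm{dom}(r)\setminus\{0,\infty\}$ to a holomorphic family of connections $\hat d^\lambda$ on $\mathbb{C}^\times$ with $\hat d^1=d$; (iv) $\det(r(0)^{-1}r(\infty)|_V)=1$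 (it follows from (i) that $r(0)V=r(\infty)V$). Simple factors. Null line subbundles $L^+,L^-$ of $\underline{\mathbb{C}}^{n+2}$ are complementary if $L^+_x,L^-_x$ are not orthogonal for all $x\in\Sigma$. For such, $\Gamma^{L^+}_{L^-}(\lambda)\in\Gamma\mathrm{O}(\underline{\mathbb{C}}^{n+2})$, $\lambda\in\mathbb{C}^\times$, is multiplication by $\lambda$ on $L^+$, by $1$ on $(L^+\oplus L^-)^\perp$ and by $\lambda^{-1}$ on $L^-$. For $V$ a non-degenerate subbundle, $\alpha\in\mathbb{C}^\times\setminus\{\pm1\}$ and $L$ a null line subbundle with $L,\rho_VL$ complementary, $$p^V_{\alpha,L}(\lambda)=\Gamma^L_{\rho_VL}\Bigl(\tfrac{(1+\alpha)(\lambda-\alpha)}{(1-\alpha)(\lambda+\alpha)}\Bigr),\qquad\lambda\in\mathbb{P}^1\setminus\{\pm\alpha\}.$$ *)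

(* Defs.v *)
From HB Require Import structures.
From mathcomp Require Import all_boot all_order all_algebra complex.
From mathcomp Require Import all_classical reals topology normedtype derive.
Set Implicit Arguments.
Unset Strict Implicit.
Unset Printing Implicit Defensive.
Import Order.TTheory GRing.Theory Num.Theory numFieldNormedType.Exports.
Local Open Scope classical_set_scope.
Local Open Scope ring_scope.
Local Open Scope complex_scope.

(* Conventions.
   - The complex numbers are [R[i]]; [R[i]^o] is the same type with its norm
     topology.
   - Vectors of C^N are row vectors.  Endomorphisms are matrices acting on the
     right, so that the composite g o h is the matrix product [h *m g].
   - A linear subspace of C^N is the row space of a matrix. *)

Section Calculus.
Context {R : realType}.
Local Notation C := (R[i]^o).
Implicit Types (f : C -> C) (F : C -> C -> C) (U D : set C).

(* Real differentiability of f at z in the direction v, and the derivative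
   itself (t is a real parameter). *)
Definition rderivable f (z v : C) : Prop :=
  derivable (fun t : R => complex.Re (f (z + t%:C * v))) 0 1 /\
  derivable (fun t : R => complex.Im (f (z + t%:C * v))) 0 1.

Definition rderive f (z v : C) : C :=
  derive1 (fun t : R => complex.Re (f (z + t%:C * v))) 0 +i*
  derive1 (fun t : R => complex.Im (f (z + t%:C * v))) 0.

Fixpoint Ck m U f : Prop :=
  if m is m'.+1 then
    [/\ forall z, U z -> rderivable f z 1 /\ rderivable f z 'i,
        Ck m' U (fun z => rderive f z 1) &
        Ck m' U (fun z => rderive f z 'i)]
  else forall z, U z -> {for z, continuous f}.

Definition smooth U f : Prop := forall m, Ck m U f.

(* Families F(l, z), l in D, z in U, which are C^m jointly in (l, z) and
   complex differentiable in l. *)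
Fixpoint holo_Ck m D U F : Prop :=
  if m is m'.+1 then
    [/\ forall l z, D l -> U z ->
          [/\ derivable (F ^~ z) l 1, rderivable (F l) z 1 &
              rderivable (F l) z 'i],
        holo_Ck m' D U (fun l z => 'D_1 (F ^~ z) l),
        holo_Ck m' D U (fun l z => rderive (F l) z 1) &
        holo_Ck m' D U (fun l z => rderive (F l) z 'i)]
  else forall l z, D l -> U z ->
         {for (l, z), continuous (fun p : C * C => F p.1 p.2)}.

(* A smooth family F(l, .) of smooth functions on U, holomorphic in l. *)
Definition holo_family D U F : Prop := forall m, holo_Ck m D U F.

End Calculus.

(* [chartV i] is an inverse of the coordinate [coord i] on its range; both are
   total functions, with arbitrary values outside the relevant open sets. *)
Record riemannSurface (R : realType) := RiemannSurface {
  points :> topologicalType;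
  chart : Type;
  dom : chart -> set points;
  coord : chart -> points -> R[i]^o;
  chartV : chart -> R[i]^o -> points;
  rs_hausdorff : hausdorff_space points;
  rs_connected : connected [set: points];
  dom_cover : forall x, exists i, dom i x;
  dom_open : forall i, open (dom i);
  range_open : forall i, open (coord i @` dom i);
  coordK : forall i x, dom i x -> chartV i (coord i x) = x;
  coord_continuous : forall i x, dom i x -> {for x, continuous (coord i)};
  chartV_continuous : forall i z, (coord i @` dom i) z ->
    {for z, continuous (chartV i)};
  transition_holomorphic : forall i j x, dom i x -> dom j x ->
    derivable (coord j \o chartV i : R[i]^o -> R[i]^o) (coord i x) 1 }.

Section Surface.
Context {R : realType} {S : riemannSurface R}.
Local Notation C := (R[i]).
Implicit Types (W : set S) (i j : chart S) (x : S).

Definition smooth_mx m n W (F : S -> 'M[C]_(m, n)) : Prop :=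
  forall i a b,
    smooth (coord i @` (dom i `&` W)) (fun z => F (chartV i z) a b).

(* The components of df = (dz f) dz_i + (dzb f) d(conj z_i) in the chart i. *)
Definition dz i (f : S -> C) x : C :=
  (rderive (f \o chartV i) (coord i x) 1
   - 'i * rderive (f \o chartV i) (coord i x) 'i) / 2.
Definition dzb i (f : S -> C) x : C :=
  (rderive (f \o chartV i) (coord i x) 1
   + 'i * rderive (f \o chartV i) (coord i x) 'i) / 2.

Definition dz_mx m n i (F : S -> 'M[C]_(m, n)) x : 'M[C]_(m, n) :=
  \matrix_(a, b) dz i (fun y => F y a b) x.
Definition dzb_mx m n i (F : S -> 'M[C]_(m, n)) x : 'M[C]_(m, n) :=
  \matrix_(a, b) dzb i (fun y => F y a b) x.

(* The derivative at x of the transition map z_i |-> z_j. *)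
Definition dtransition i j x : C :=
  'D_1 (coord j \o chartV i : R[i]^o -> R[i]^o) (coord i x).

(* A family, indexed by l in D, of matrix-valued functions (or of components
   of matrix-valued forms) F l i defined on dom i, for each chart i. *)
Definition holo_mx m n (D : set C) (F : C -> chart S -> S -> 'M[C]_(m, n)) :=
  forall i a b,
    holo_family D (coord i @` dom i) (fun l z => F l i (chartV i z) a b).

End Surface.

(* A connection d + A on the trivial bundle with fibre C^N; A is the
   matrix-valued 1-form given in the chart i by
   [conn10 i] dz_i + [conn01 i] d(conj z_i). *)
Record connection (R : realType) (S : riemannSurface R) (N : nat) :=
  Connection {
  conn10 : chart S -> S -> 'M[R[i]]_N;
  conn01 : chart S -> S -> 'M[R[i]]_N;
  conn10_smooth : forall i, smooth_mx (dom i) (conn10 i);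
  conn01_smooth : forall i, smooth_mx (dom i) (conn01 i);
  conn10_transition : forall i j x, dom i x -> dom j x ->
    conn10 i x = dtransition i j x *: conn10 j x;
  conn01_transition : forall i j x, dom i x -> dom j x ->
    conn01 i x = (dtransition i j x)^* *: conn01 j x }.

(* Gram matrix of the inner product of signature (n+1, 1) in dimension n+2. *)
Definition lorentz (K : pzRingType) (n : nat) : 'M[K]_n.+2 :=
  diag_mx (\row_j (if j == ord_max then -1 else 1)).

Section Bundles.
Context {R : realType} {S : riemannSurface R} {n : nat}.
Local Notation C := (R[i]).
Local Notation N := n.+2.
Local Notation eta := (lorentz C n).
Implicit Types (V L : S -> 'M[C]_N) (A B : connection S N).
Implicit Types (W : set S) (i : chart S) (x : S).

Definition inner (u v : 'rV[C]_N) : C := (u *m eta *m v^T) 0 0.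

Definition perp (V : 'M[C]_N) : 'M[C]_N := kermx (eta *m V^T).

Definition refl (V : 'M[C]_N) : 'M[C]_N :=
  proj_mx V (perp V) - proj_mx (perp V) V.

Definition conj_mx m p (M : 'M[C]_(m, p)) : 'M[C]_(m, p) :=
  map_mx (fun z => z^*) M.

Definition subbundle (r : nat) V : Prop :=
  forall x0, exists (W : set S) (F : S -> 'M[C]_(r, N)),
    [/\ open W, W x0, smooth_mx W F &
        forall x, W x -> row_free (F x) /\ (F x :=: V x)%MS].

Definition nondegenerate V : Prop :=
  forall x, (V x :&: perp (V x))%MS = 0.

Definition real_bundle V : Prop := forall x, (conj_mx (V x) :=: V x)%MS.

(* The rows of B form a basis of the real space V_x \cap R^(n+1,1), with Gram
   matrix diag(1, 1, 1, -1). *)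
Definition signature31 V : Prop :=
  forall x, exists B : 'M[R]_(4, N),
    (forall v : 'rV[R]_N,
       (v <= B)%MS = (map_mx (real_complex R) v <= V x)%MS) /\
    B *m lorentz R n *m B^T = lorentz R 2.

Definition bundle31 V : Prop :=
  [/\ subbundle 4 V, real_bundle V, nondegenerate V & signature31 V].

Definition null_line_subbundle L : Prop :=
  subbundle 1 L /\ forall x, L x *m eta *m (L x)^T = 0.

Definition complementary L1 L2 : Prop :=
  forall x, L1 x *m eta *m (L2 x)^T != 0.

Definition bundle_image V (g : S -> 'M[C]_N) : S -> 'M[C]_N := fun x => V x *m g x.

Definition rho V : S -> 'M[C]_N := fun x => refl (V x).

Definition orthogonal_gauge (g : S -> 'M[C]_N) : Prop :=
  smooth_mx setT g /\ forall x, g x *m eta *m (g x)^T = eta.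

Definition nabla10 A i (s : S -> 'rV[C]_N) x : 'rV[C]_N :=
  dz_mx i s x + s x *m conn10 A i x.
Definition nabla01 A i (s : S -> 'rV[C]_N) x : 'rV[C]_N :=
  dzb_mx i s x + s x *m conn01 A i x.

Definition is_d A : Prop :=
  forall i x, dom i x -> conn10 A i x = 0 /\ conn01 A i x = 0.

Definition flat A : Prop :=
  forall W i (s : S -> 'rV[C]_N), open W -> smooth_mx W s ->
  forall x, W x -> dom i x ->
    nabla10 A i (nabla01 A i s) x = nabla01 A i (nabla10 A i s) x.

Definition metric A : Prop :=
  forall W i (s t : S -> 'rV[C]_N), open W -> smooth_mx W s -> smooth_mx W t ->
  forall x, W x -> dom i x ->
    dz i (fun y => inner (s y) (t y)) x =
      inner (nabla10 A i s x) (t x) + inner (s x) (nabla10 A i t x) /\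
    dzb i (fun y => inner (s y) (t y)) x =
      inner (nabla01 A i s x) (t x) + inner (s x) (nabla01 A i t x).

(* B = g . A, that is B = g o A o g^-1 as operators on sections. *)
Definition is_gauge_of (g : S -> 'M[C]_N) A B : Prop :=
  forall W i (s : S -> 'rV[C]_N), open W -> smooth_mx W s ->
  forall x, W x -> dom i x ->
    nabla10 B i s x = nabla10 A i (fun y => s y *m invmx (g y)) x *m g x /\
    nabla01 B i s x = nabla01 A i (fun y => s y *m invmx (g y)) x *m g x.

(* B s = conj (A (conj s)); conjugation exchanges the dz and d(conj z)
   components of a form. *)
Definition is_conj_of A B : Prop :=
  forall W i (s : S -> 'rV[C]_N), open W -> smooth_mx W s ->
  forall x, W x -> dom i x ->
    nabla10 B i s x = conj_mx (nabla01 A i (fun y => conj_mx (s y)) x) /\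
    nabla01 B i s x = conj_mx (nabla10 A i (fun y => conj_mx (s y)) x).

Definition parallel A L : Prop :=
  forall W i (s : S -> 'rV[C]_N), open W -> smooth_mx W s ->
  (forall x, W x -> (s x <= L x)%MS) ->
  forall x, W x -> dom i x ->
    (nabla10 A i s x <= L x)%MS /\ (nabla01 A i s x <= L x)%MS.

Definition cstar (l : C) : C := (l^*)^-1.

(* F is the holomorphic extension to C of l |-> (d^l)^(1,0), and G that of
   w |-> w^k F(1/w), so that G 0 is the coefficient of l^k in F at infinity;
   for a pole it must not vanish identically. *)
Definition pole10 (k : nat) (d : C -> connection S N) : Prop :=
  exists F G : C -> chart S -> S -> 'M[C]_N,
    [/\ holo_mx setT F, holo_mx setT G,
        forall l i x, l != 0 -> dom i x -> F l i x = conn10 (d l) i x,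
        forall w i x, w != 0 -> dom i x -> G w i x = w ^+ k *: F w^-1 i x &
        (0 < k)%N -> exists i x, dom i x /\ G 0 i x != 0].

(* [d l] is only meaningful for l != 0. *)
Definition perturbed_harmonic (k : nat) V (d : C -> connection S N) : Prop :=
  [/\ bundle31 V,
      forall l, l != 0 -> flat (d l) /\ metric (d l),
      is_d (d 1),
      forall l, l != 0 -> is_gauge_of (rho V) (d l) (d (- l)) &
      (forall l, l != 0 -> is_conj_of (d l) (d (cstar l))) /\ pole10 k d].

End Bundles.

Section Dressing.
Context {R : realType} {S : riemannSurface R} {n : nat}.
Local Notation C := (R[i]).
Local Notation N := n.+2.
Local Notation eta := (lorentz C n).
(* The point at infinity of the projective line is [None]. *)
Local Notation P1 := (one_point_compactification R[i]^o).
Implicit Types (V L : S -> 'M[C]_N) (l m : P1) (x : S).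

Definition popp l : P1 := if l is Some z then Some (- z) else None.

Definition pinv (w : C) : P1 := if w == 0 then None else Some w^-1.

Definition pstar l : P1 := if l is Some z then pinv z^* else Some 0.

Definition holo_near_0 (D : set P1) (r : P1 -> S -> 'M[C]_N) : Prop :=
  exists U : set R[i]^o,
    [/\ open U, U 0, forall z, U z -> D (Some z) &
        holo_mx U (fun z (_ : chart S) => r (Some z))].

Definition holo_near_infty (D : set P1) (r : P1 -> S -> 'M[C]_N) : Prop :=
  exists U : set R[i]^o,
    [/\ open U, U 0, forall w, U w -> D (pinv w) &
        holo_mx U (fun w (_ : chart S) => r (pinv w))].

Record dressing_gauge V (d : C -> connection S N)
    (D : set P1) (r : P1 -> S -> 'M[C]_N) : Prop := DressingGauge {
  dg_dom_0 : nbhs (Some 0 : P1) D;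
  dg_dom_infty : nbhs (None : P1) D;
  dg_dom_opp : forall l, D l -> D (popp l);
  dg_dom_star : forall l, D l -> D (pstar l) /\ D (popp (pstar l));
  dg_gauge : forall l, D l -> orthogonal_gauge (r l);
  dg_holo_0 : holo_near_0 D r;
  dg_holo_infty : holo_near_infty D r;
  dg_twist : forall l m x, D l -> D m ->
    invmx (r l x) *m rho V x *m r (popp l) x =
    invmx (r m x) *m rho V x *m r (popp m) x;
  dg_real : forall l x, D l -> r (pstar l) x = conj_mx (r l x);
  dg_extends : exists dhat : C -> connection S N,
    [/\ holo_mx [set z : C | z != 0] (fun z => conn10 (dhat z)),
        holo_mx [set z : C | z != 0] (fun z => conn01 (dhat z)),
        is_d (dhat 1) &
        forall z : C, z != 0 -> D (Some z) ->
          is_gauge_of (r (Some z)) (d z) (dhat z)];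
  dg_det : forall x,
    \det (restrictmx (V x) (r None x *m invmx (r (Some 0) x))) = 1 }.

(* c on Lp, 1 on (Lp + Lm)^perp and c^-1 on Lm. *)
Definition Gamma (Lp Lm : 'M[C]_N) (c : C) : 'M[C]_N :=
  let T := perp (Lp + Lm)%MS in
  c *: proj_mx Lp (Lm + T)%MS + proj_mx T (Lp + Lm)%MS
  + c^-1 *: proj_mx Lm (Lp + T)%MS.

(* The value at infinity is the limit (1 + a) / (1 - a). *)
Definition simple_scalar (a : C) l : C :=
  if l is Some z then ((1 + a) * (z - a)) / ((1 - a) * (z + a))
  else (1 + a) / (1 - a).

Definition simple_dom (a : C) : set P1 :=
  [set l | l <> Some a /\ l <> Some (- a)].

Definition simple_factor V (a : C) L l x : 'M[C]_N :=
  Gamma (L x) (bundle_image L (rho V) x) (simple_scalar a l).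

End Dressing.

(* Main.v *)
Require Import Defs.
From HB Require Import structures.
From mathcomp Require Import all_boot all_order all_algebra complex.
From mathcomp Require Import all_classical reals topology normedtype derive.
From mathcomp Require Import constructive_ereal measure lebesgue_measure.
From mathcomp Require Import lebesgue_integral ftc.
From mathcomp Require Import ring lra.
Set Implicit Arguments.
Unset Strict Implicit.
Unset Printing Implicit Defensive.
Import Order.TTheory GRing.Theory Num.Theory numFieldNormedType.Exports.
Local Open Scope classical_set_scope.
Local Open Scope ring_scope.

(* Near a point choose null sections l of L and m of rho L with (l, m) = 1.
   Gauging by the simple factor changes the connection form A by a multiple
   (c - 1) of one skew form plus a multiple (1/c - 1) of another, where c is
   the scalar of the factor; as L is parallel at alpha and rho L at - alpha,
   these forms vanish exactly at the poles of c and of 1/c, so the gauged form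
   is again polynomial in lambda (for the (1,0) part) or in 1/lambda (for the
   (0,1) part).  Doing this twice and interpolating at finitely many values of
   lambda gives the family of dressed connections.  Reality of r is Bianchi
   permutability: the product of the two simple factors does not depend on
   their order.  The determinant of r(0)^-1 r(infinity) on V is a product of
   two reflection determinants.  That (d^lambda)^(1,0) is polynomial, and that
   derivatives of transition maps are smooth, follows from Cauchy's integral
   formula for squares, by way of Goursat's lemma and Liouville's theorem. *)

(** * Complex differentiation *)

(** The obstacle is regularity in the base point. The forms gauged by [r] have apparent
    singularities at plus or minus [alpha] and plus or minus [cstar alpha]; removing them gives, at
    each point of the surface separately, a matrix polynomial in lambda, with no control on how it
    varies with the point. Its degree is at most [k], though, so its values at [k + 1] fixed regular
    nodes determine it, and there it is the form of a gauged connection, hence smooth. This is why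
    the (1,0) part has to be polynomial, and why complex analysis enters: the pole of order [k] is
    given only through two entire families. Two facts keep the degree at [k]: conjugation by a
    simple factor acts on skew endomorphisms with the eigenvalues [c], 1 and [1/c] only, and each
    division by [lambda - alpha] is compensated by a factor [lambda + alpha]. The choice of [L'] is
    dictated by reality: the conjugate of [L] is parallel at [cstar alpha], so the factors at
    [alpha] and [cstar alpha] can be applied in either order, and conjugating [r] exchanges the two
    orders. *)

Section ComplexNorm.
Context {R : realType}.
Implicit Types x y z : R[i].

Fact nrm_key : unit. Proof. exact: tt. Qed.
(** The norm of [R[i]] takes its values in [R[i]]; this real-valued form lets order arguments run in
    [R]. The lock keeps simplification from exposing the square root. *)
Definition nrm : R[i] -> R := locked_with nrm_key (fun z => complex.Re `|z|).
Lemma nrm_def z : nrm z = complex.Re `|z|. Proof. by rewrite [nrm]unlock. Qed.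

Lemma nrmE z : `|z| = (nrm z)%:C%C.
Proof. by rewrite !nrm_def normc_def. Qed.

Lemma nrm_ge0 z : 0 <= nrm z.
Proof. by rewrite -lecR -nrmE normr_ge0. Qed.

Lemma nrm0 : nrm 0 = 0.
Proof. by rewrite !nrm_def normr0. Qed.

Lemma nrm1 : nrm 1 = 1.
Proof. by rewrite !nrm_def normr1. Qed.

Lemma nrm_eq0 z : (nrm z == 0) = (z == 0).
Proof. by rewrite -(inj_eq (@complexI R)) -nrmE normr_eq0. Qed.

Lemma nrm_gt0 z : (0 < nrm z) = (z != 0).
Proof. by rewrite lt_neqAle nrm_ge0 andbT eq_sym nrm_eq0. Qed.

Lemma nrmD x y : nrm (x + y) <= nrm x + nrm y.
Proof. by rewrite -lecR rmorphD /= -!nrmE ler_normD. Qed.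

Lemma nrmN x : nrm (- x) = nrm x.
Proof. by rewrite !nrm_def normrN. Qed.

Lemma nrmB x y : nrm (x - y) <= nrm x + nrm y.
Proof. by rewrite -(nrmN y) nrmD. Qed.

Lemma nrm_distC x y : nrm (x - y) = nrm (y - x).
Proof. by rewrite -nrmN opprB. Qed.

Lemma nrmM x y : nrm (x * y) = nrm x * nrm y.
Proof. by apply: (@complexI R); rewrite rmorphM /= -!nrmE normrM. Qed.

Lemma nrmX x k : nrm (x ^+ k) = nrm x ^+ k.
Proof.
by elim: k => [|k ih]; rewrite ?expr0 ?nrm1// !exprS nrmM ih.
Qed.

Lemma nrmV x : nrm x^-1 = (nrm x)^-1.
Proof. by apply: (@complexI R); rewrite fmorphV /= -!nrmE normfV. Qed.

Lemma nrm_real (t : R) : nrm t%:C%C = `|t|.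
Proof. by rewrite !nrm_def normc_def /= expr0n addr0 sqrtr_sqr. Qed.

Lemma nrm_conj x : nrm (x^*)%C = nrm x.
Proof. by rewrite !nrm_def normcJ. Qed.

Lemma Re_le_nrm x : `|complex.Re x| <= nrm x.
Proof. by rewrite -lecR -nrmE; exact: normc_ge_Re. Qed.

Lemma nrm_i : nrm ('i)%C = 1.
Proof. by rewrite !nrm_def normc_def /= expr0n add0r expr1n sqrtr1. Qed.

Lemma Im_le_nrm x : `|complex.Im x| <= nrm x.
Proof.
have := Re_le_nrm (x * 'i%C); rewrite nrmM nrm_i mulr1; apply: le_trans.
by case: x => a b /=; rewrite mulr0 mulr1 sub0r normrN.
Qed.

Lemma nrm_le_ReIm x : nrm x <= `|complex.Re x| + `|complex.Im x|.
Proof.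
rewrite {1}[x]complexE (le_trans (nrmD _ _))// nrmM nrm_i mul1r.
by rewrite !nrm_real.
Qed.

Lemma nrm_lt_itv (z : R[i]) (d : R[i]) : (`|z| < d) = (nrm z < complex.Re d) && (complex.Im d == 0).
Proof. by rewrite nrmE ltcE /= andbC. Qed.

Lemma nbhs_nrmP (z : R[i]^o) (P : set R[i]^o) :
  nbhs z P <-> exists2 d : R, 0 < d & forall y, nrm (y - z) < d -> P y.
Proof.
split.
  move=> /nbhs_ballP [e e0 eP]; exists (complex.Re e).
    by move: e0; rewrite /= ltcE /= => /andP[].
  move=> y yd; apply: eP; rewrite /ball /= nrm_lt_itv.
  move: e0; rewrite /= ltcE /= => /andP[-> _]; rewrite andbT.
  by rewrite nrm_distC.
move=> [d d0 dP]; apply/nbhs_ballP; exists (d%:C%C); first by rewrite /= ltcR.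
move=> y; rewrite /ball /= nrm_lt_itv /= eqxx andbT nrm_distC; exact: dP.
Qed.

Lemma open_nrmP (U : set R[i]^o) :
  open U <-> forall z, U z -> exists2 d : R, 0 < d & forall y, nrm (y - z) < d -> U y.
Proof.
rewrite openE; split=> UU z /UU; first by move/nbhs_nrmP.
by move=> h; apply/nbhs_nrmP.
Qed.

Lemma cont_nrmP (T : topologicalType) (f : T -> R[i]^o) (z : T) :
  {for z, continuous f} <->
  forall e : R, 0 < e -> \forall y \near z, nrm (f y - f z) < e.
Proof.
split=> [cf e e0|cf].
  by apply: (cf [set y | nrm (y - f z) < e]); apply/nbhs_nrmP; exists e.
move=> P /nbhs_nrmP [d d0 dP]; have := cf d d0.
by apply: filterS => y /dP.
Qed.

Lemma ccont_nrmP (f : R[i]^o -> R[i]^o) z :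
  {for z, continuous f} <->
  forall e : R, 0 < e -> exists2 d, 0 < d & forall y, nrm (y - z) < d ->
   nrm (f y - f z) < e.
Proof.
split=> [/cont_nrmP cf e e0|cf]; first by have /nbhs_nrmP := cf e e0.
by apply/cont_nrmP => e e0; apply/nbhs_nrmP; exact: cf.
Qed.

Lemma rcont_nrmP (f : R -> R[i]^o) (t : R) :
  {for t, continuous f} <->
  forall e : R, 0 < e -> exists2 d, 0 < d & forall s, `|s - t| < d ->
   nrm (f s - f t) < e.
Proof.
split=> [/cont_nrmP cf e e0|cf].
  have /nbhs_ballP[d d0 dP] := cf e e0; exists d => // s st.
  by apply: dP; rewrite /ball /= distrC.
apply/cont_nrmP => e /cf [d d0 dP]; apply/nbhs_ballP; exists d => // s.
by rewrite /ball /= distrC; exact: dP.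
Qed.

End ComplexNorm.

(* [expn nu g g0 L]: [g h = g0 + L h + o(nu h)] with [L h = O(nu h)].  This
   covers complex derivatives ([nu = nrm]), directional derivatives (real
   increments) and total differentials. *)
Section Expansion.
Context {R : realType} {I : Type} (nu : I -> R) (nu_ge0 : forall h, 0 <= nu h).
Implicit Types (g : I -> R[i]) (a b : R[i]) (L : I -> R[i]).

Definition expn g a L :=
  (exists2 K, 0 <= K & forall h, nrm (L h) <= K * nu h) /\
  forall e, 0 < e -> exists2 d, 0 < d & forall h, nu h < d ->
     nrm (g h - a - L h) <= e * nu h.

Lemma expn_ext g g' a L (d : R) : 0 < d -> (forall h, nu h < d -> g h = g' h) ->
  expn g a L -> expn g' a L.
Proof.
move=> d0 gg' [LK gP]; split=> // e /gP [d' d'0 d'P].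
exists (Num.min d d'); first by rewrite lt_min d0.
by move=> h; rewrite lt_min => /andP[hd hd']; rewrite -gg'// d'P.
Qed.

Lemma expn_cst a : expn (fun=> a) a (fun=> 0).
Proof.
split; first by exists 0 => // h; rewrite nrm0 mul0r.
by move=> e e0; exists 1 => // h _; rewrite subrr subr0 nrm0 mulr_ge0// ltW.
Qed.

Lemma expn_lip g a L : expn g a L -> exists2 K, 0 < K & exists2 d, 0 < d &
  forall h, nu h < d -> nrm (g h - a) <= K * nu h.
Proof.
move=> [[K K0 LK]] /(_ 1 ltr01) [d d0 dP]; exists (K + 1); first by rewrite ltr_wpDl.
exists d => // h /dP; rewrite mul1r mulrDl mul1r => hd.
rewrite -[g h - a](subrK (L h)) addrC (le_trans (nrmD _ _))// lerD//.
Qed.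

Lemma expn_add g1 g2 a b L M : expn g1 a L -> expn g2 b M ->
  expn (fun h => g1 h + g2 h) (a + b) (fun h => L h + M h).
Proof.
move=> [[K K0 LK] g1P] [[K' K'0 MK] g2P]; split.
  exists (K + K'); first exact: addr_ge0.
  by move=> h; rewrite mulrDl (le_trans (nrmD _ _))// lerD.
move=> e e0; have e20 : 0 < e / 2 by rewrite divr_gt0.
have [d d0 dP] := g1P _ e20; have [d' d'0 d'P] := g2P _ e20.
exists (Num.min d d'); first by rewrite lt_min d0.
move=> h; rewrite lt_min => /andP[/dP hd /d'P hd'].
have -> : g1 h + g2 h - (a + b) - (L h + M h) =
  (g1 h - a - L h) + (g2 h - b - M h) by ring.
by rewrite (le_trans (nrmD _ _))// (splitr e) mulrDl lerD.
Qed.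

Lemma expn_scale c g a L : expn g a L ->
  expn (fun h => c * g h) (c * a) (fun h => c * L h).
Proof.
move=> [[K K0 LK] gP]; split.
  exists (nrm c * K); first by rewrite mulr_ge0// nrm_ge0.
  by move=> h; rewrite nrmM -mulrA ler_wpM2l// nrm_ge0.
move=> e e0; have c0 : 0 < nrm c + 1 by rewrite ltr_wpDl// nrm_ge0.
have [d d0 dP] := gP (e / (nrm c + 1)) (divr_gt0 e0 c0).
exists d => // h /dP hd; rewrite -!mulrBr nrmM.
rewrite (le_trans (ler_wpM2l (nrm_ge0 _) hd))// mulrA ler_wpM2r//.
by rewrite mulrCA -ler_pdivlMl// mulVf ?gt_eqF// ler_pdivrMr// mul1r lerDl.
Qed.

Lemma expn_opp g a L : expn g a L -> expn (fun h => - g h) (- a) (fun h => - L h).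
Proof.
move=> /(expn_scale (-1)) [[K K0 LK] gP]; split.
  by exists K => // h; rewrite -mulN1r.
by move=> e /gP [d d0 dP]; exists d => // h /dP; rewrite !mulN1r.
Qed.

Lemma expn_mul g1 g2 a b L M : expn g1 a L -> expn g2 b M ->
  expn (fun h => g1 h * g2 h) (a * b) (fun h => L h * b + a * M h).
Proof.
move=> h1 h2.
have h12 := expn_add (expn_scale b h1) (expn_scale a h2).
have [[K12 K120 LM] h12P] := h12.
split.
  exists K12 => // h; rewrite [L h * b]mulrC; exact: LM.
move=> e e0; have e20 : 0 < e / 2 by rewrite divr_gt0.
have [d d0 dP] := h12P _ e20.
have [K K0 [d1 d10 d1P]] := expn_lip h1.
have [K' K'0 [d2 d20 d2P]] := expn_lip h2.
(* The product of the two increments is at most [K * K' * nu h ^+ 2]; this radius makes it at most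
   [e / 2 * nu h]. *)
have d30 : 0 < e / 2 / (K * K') by rewrite divr_gt0// mulr_gt0.
exists (Num.min d (Num.min (e / 2 / (K * K')) (Num.min d1 d2))).
  by rewrite !lt_min d0 d30 d10 d20.
move=> h; rewrite !lt_min => /and4P[/dP hd hd3 /d1P hd1 /d2P hd2].
have -> : g1 h * g2 h - a * b - (L h * b + a * M h) =
  (b * g1 h + a * g2 h - (b * a + a * b) - (b * L h + a * M h)) +
  (g1 h - a) * (g2 h - b) by ring.
rewrite (le_trans (nrmD _ _))// [in leRHS](splitr e) [leRHS]mulrDl lerD// nrmM.
rewrite (le_trans (ler_pM _ _ hd1 hd2)) ?nrm_ge0//.
rewrite mulrACA mulrCA mulrC ler_wpM2r// mulrC.
by rewrite ltW// -ltr_pdivlMr// mulr_gt0.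
Qed.

Lemma expn_conj g a L : expn g a L ->
  expn (fun h => (g h)^*%C) a^*%C (fun h => (L h)^*%C).
Proof.
move=> [[K K0 LK] gP]; split; first by exists K => // h; rewrite nrm_conj.
move=> e /gP [d d0 dP]; exists d => // h /dP.
by rewrite -!rmorphB nrm_conj.
Qed.

End Expansion.

Section ExpansionComp.
Context {R : realType} {I : Type} (nu : I -> R) (nu_ge0 : forall h, 0 <= nu h).

(** The remainder is that of [F] at the increment [g h - a] plus [M] applied to the remainder of
    [g]. Additivity of [M] and the bound contained in [expn] suffice, so differentials that are only
    real-linear are covered. *)
Lemma expn_comp (g : I -> R[i]) a L (F : R[i] -> R[i]) (M : R[i] -> R[i]) :
  expn nu g a L -> expn nrm (fun k => F (a + k)) (F a) M ->
  (forall x y, M (x + y) = M x + M y) ->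
  expn nu (fun h => F (g h)) (F a) (fun h => M (L h)).
Proof.
move=> h1 [[K K0 MK] FP] Madd; have [[K' K'0 LK] gP] := h1.
split.
  exists (K * K'); first exact: mulr_ge0.
  by move=> h; rewrite (le_trans (MK _))// -mulrA ler_wpM2l.
move=> e e0; have e20 : 0 < e / 2 by rewrite divr_gt0.
have [K1 K10 [d1 d10 d1P]] := expn_lip h1.
have [d2 d20 d2P] := FP _ (divr_gt0 e20 K10).
have K1p : 0 < K + 1 by rewrite ltr_wpDl.
have [d3 d30 d3P] := gP _ (divr_gt0 e20 K1p).
exists (Num.min d1 (Num.min (d2 / K1) d3)).
  by rewrite !lt_min d10 d30 divr_gt0.
move=> h; rewrite !lt_min => /and3P[/d1P hd1 hd2 /d3P hd3].
have gd2 : nrm (g h - a) < d2.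
  by rewrite (le_lt_trans hd1)// mulrC -ltr_pdivlMr.
have MB x y : M (x - y) = M x - M y.
  by apply/eqP; rewrite eq_sym subr_eq -Madd subrK.
have := d2P _ gd2; rewrite [a + _]addrC subrK => F1.
have -> : F (g h) - F a - M (L h) =
  (F (g h) - F a - M (g h - a)) + M (g h - a - L h).
  by rewrite !MB; ring.
rewrite (le_trans (nrmD _ _))// [in leRHS](splitr e) [leRHS]mulrDl lerD//.
  rewrite (le_trans F1)// mulrAC ler_pdivrMr// -[leRHS]mulrA ler_wpM2l ?(ltW e20)//.
  by rewrite [nu h * _]mulrC.
rewrite (le_trans (MK _))// (le_trans (ler_wpM2l K0 hd3))// mulrA ler_wpM2r//.
by rewrite mulrCA -ler_pdivlMl// mulVf ?gt_eqF// ler_pdivrMr// mul1r lerDl.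
Qed.

(* The differential of the inverse comes from
   [1/(a+k) - 1/a + k/a^2 = k^2/(a^2 (a+k))]. *)
Lemma expn_invc (a : R[i]) : a != 0 ->
  expn nrm (fun k => (a + k)^-1) a^-1 (fun k => - k / a ^+ 2).
Proof.
move=> a0; have na : 0 < nrm a by rewrite nrm_gt0.
split.
  exists (nrm (a ^+ 2)^-1); first exact: nrm_ge0.
  by move=> k; rewrite mulNr nrmN nrmM mulrC.
move=> e e0; exists (Num.min (nrm a / 2) (e * nrm a ^+ 3 / 2)).
  by rewrite lt_min !divr_gt0// mulr_gt0// exprn_gt0.
move=> k; rewrite lt_min => /andP[k1 k2].
have ak : nrm a / 2 <= nrm (a + k).
  have : nrm a <= nrm (a + k) + nrm k.
    by rewrite -{1}[a](addrK k) (le_trans (nrmD _ _))// nrmN.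
  by lra.
have ak0 : a + k != 0 by rewrite -nrm_gt0; apply: lt_le_trans ak; rewrite divr_gt0.
have -> : (a + k)^-1 - a^-1 - - k / a ^+ 2 = k * (k / (a ^+ 2 * (a + k))).
  by field; rewrite a0 ak0.
rewrite nrmM mulrC ler_wpM2r ?nrm_ge0// nrmM nrmV nrmM nrmX.
rewrite ler_pdivrMr ?mulr_gt0 ?exprn_gt0 ?nrm_gt0//.
have h : e * (nrm a ^+ 2 * (nrm a / 2)) <= e * (nrm a ^+ 2 * nrm (a + k)).
  by rewrite (ler_wpM2l (ltW e0))// ler_wpM2l// exprn_ge0// ltW.
apply: le_trans h; rewrite (le_trans (ltW k2))//.
by rewrite le_eqVlt; apply/orP; left; apply/eqP; field.
Qed.

Lemma expn_inv (g : I -> R[i]) a L : a != 0 -> expn nu g a L ->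
  expn nu (fun h => (g h)^-1) a^-1 (fun h => - L h / a ^+ 2).
Proof.
move=> a0 h1; apply: (expn_comp h1 (expn_invc a0)) => x y.
by rewrite opprD mulrDl.
Qed.

End ExpansionComp.

Section Derivatives.
Context {R : realType}.
Local Notation C := (R[i]^o).
Implicit Types (f g : C -> C) (z l v : C).

Definition cder f z l := expn nrm (fun h : C => f (z + h)) (f z) (fun h => h * l).

Definition rder f z v l :=
  expn Num.norm (fun t : R => f (z + t%:C%C * v)) (f z) (fun t => t%:C%C * l).

Lemma cderP f z l : cder f z l <-> is_derive z (1 : C) f l.
Proof.
split.
  move=> [_ fP].
  have cv : h^-1 *: ((f \o shift z) (h *: (1 : C)) - f z) @[h --> (0 : C)^'] --> l.
    apply/cvg_ballP => e; rewrite /= ltcE /= => /andP[/eqP ime e0].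
    have [d d0 dP] := fP _ (divr_gt0 e0 (ltr0n _ 2)).
    apply/nbhs_nrmP; exists d => // h; rewrite subr0 => hd.
    move=> hne; rewrite /ball /= nrm_lt_itv ime eqxx andbT.
    have h0 : 0 < nrm h by rewrite nrm_gt0.
    rewrite nrm_distC -(ltr_pM2l h0) -nrmM.
    have -> : h * (h^-1 *: (f (h *: (1 : C) + z) - f z) - l) = f (z + h) - f z - h * l.
      rewrite /GRing.scale /= mulrBr mulrA mulfV// mul1r mulr1 [h + z]addrC.
      by [].
    apply: le_lt_trans (dP _ hd) _; rewrite mulrC ltr_pM2l//.
    by rewrite ltr_pdivrMr// ltr_pMr// ltr1n.
  split; first by apply/cvg_ex; exists l.
  exact/cvg_lim.
move=> [+ ll]; move/cvg_ex => [l' /= cv].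
have El : l' = l by rewrite -ll; apply/esym/cvg_lim.
rewrite El in cv; split.
  by exists (nrm l) => [|h]; rewrite ?nrm_ge0// nrmM mulrC.
move=> e e0; have /cvg_ballP/(_ (e%:C%C)) := cv.
rewrite ltcR => /(_ e0) /nbhs_nrmP [d d0 dP].
exists d => // h hd; have [->|h0] := eqVneq h 0.
  by rewrite addr0 subrr sub0r mul0r nrmN nrm0 mulr0.
have := dP h; rewrite subr0 => /(_ hd h0).
rewrite /ball /= nrm_lt_itv /= eqxx andbT.
rewrite -(ltr_pM2l (_ : 0 < nrm h)) ?nrm_gt0// -nrmM.
rewrite [X in nrm X < _](_ : _ = - (f (z + h) - f z - h * l)).
  by rewrite nrmN => /ltW; rewrite [nrm h * e]mulrC.
rewrite /GRing.scale /= mulrBr mulrA mulfV// mul1r mulr1 [h + z]addrC.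
by rewrite [RHS]opprB.
Qed.

Lemma is_deriveR_epsP (u : R -> R) (t l : R) : is_derive t (1 : R) u l <->
  forall e, 0 < e -> exists2 d, 0 < d & forall h, `|h| < d ->
     `|u (t + h) - u t - h * l| <= e * `|h|.
Proof.
split.
  move=> [+ ll]; move/cvg_ex => [l' /= cv].
  have El : l' = l by rewrite -ll; apply/esym/cvg_lim.
  rewrite El in cv => e e0; have /cvg_ballP/(_ e e0) := cv.
  move=> /nbhs_ballP [d d0 dP].
  exists d => // h hd; have [->|h0] := eqVneq h 0.
    by rewrite addr0 subrr sub0r mul0r normrN normr0 mulr0.
  have := dP h; rewrite /ball /= sub0r normrN => /(_ hd h0).
  rewrite distrC -(ltr_pM2l (_ : 0 < `|h|)) ?normr_gt0// -normrM.
  have -> : h * (h^-1 *: (u (h *: (1 : R) + t) - u t) - l) = u (t + h) - u t - h * l.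
    rewrite /GRing.scale /= mulrBr mulrA mulfV// mul1r mulr1 [h + t]addrC.
    by [].
  by move=> /ltW; rewrite [`|h| * e]mulrC.
move=> fP.
have cv : h^-1 *: ((u \o shift t) (h *: (1 : R)) - u t) @[h --> (0 : R)^'] --> l.
  apply/cvg_ballP => e e0.
  have [d d0 dP] := fP _ (divr_gt0 e0 (ltr0n _ 2)).
  apply/nbhs_ballP; exists d => // h.
  rewrite /ball /= sub0r normrN => hd h0.
  have h0' : 0 < `|h| by rewrite normr_gt0.
  rewrite distrC -(ltr_pM2l h0') -normrM.
  have -> : h * (h^-1 *: (u (h *: (1 : R) + t) - u t) - l) = u (t + h) - u t - h * l.
    rewrite /GRing.scale /= mulrBr mulrA mulfV// mul1r mulr1 [h + t]addrC.
    by [].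
  apply: le_lt_trans (dP _ hd) _; rewrite mulrC ltr_pM2l//.
  by rewrite ltr_pdivrMr// ltr_pMr// ltr1n.
split; first by apply/cvg_ex; exists l.
exact/cvg_lim.
Qed.

Lemma rderP f z v l : rder f z v l <->
  is_derive (0 : R) (1 : R) (fun t : R => complex.Re (f (z + t%:C%C * v))) (complex.Re l) /\
  is_derive (0 : R) (1 : R) (fun t : R => complex.Im (f (z + t%:C%C * v))) (complex.Im l).
Proof.
have ReB (x y : R[i]) (t : R) : complex.Re (x - y - t%:C%C * l) =
    complex.Re x - complex.Re y - t * complex.Re l.
  by case: x y (l) => [a b] [c e] [l1 l2] /=; ring.
have ImB (x y : R[i]) (t : R) : complex.Im (x - y - t%:C%C * l) =
    complex.Im x - complex.Im y - t * complex.Im l.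
  by case: x y (l) => [a b] [c e] [l1 l2] /=; ring.
split.
  move=> [_ fP]; split; apply/is_deriveR_epsP => e /fP [d d0 dP]; exists d => // h hd.
    have := dP _ hd; apply: le_trans.
    by rewrite add0r mul0r addr0 -ReB Re_le_nrm.
  have := dP _ hd; apply: le_trans.
  by rewrite add0r mul0r addr0 -ImB Im_le_nrm.
move=> [/is_deriveR_epsP f1 /is_deriveR_epsP f2]; split.
  by exists (nrm l) => [|h]; rewrite ?nrm_ge0// nrmM nrm_real mulrC.
move=> e e0; have e20 : 0 < e / 2 by rewrite divr_gt0.
have [d1 d10 d1P] := f1 _ e20; have [d2 d20 d2P] := f2 _ e20.
exists (Num.min d1 d2); first by rewrite lt_min d10.
move=> h; rewrite lt_min => /andP[/d1P + /d2P].
rewrite !add0r !mul0r !addr0 -ReB -ImB => h1 h2.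
by rewrite (le_trans (nrm_le_ReIm _))// (splitr e) mulrDl lerD.
Qed.

Lemma rder_rderivable f z v l : rder f z v l -> rderivable f z v.
Proof. by move=> /rderP [h1 h2]; split; [case: h1|case: h2]. Qed.

Lemma rder_rderive f z v l : rder f z v l -> rderive f z v = l.
Proof.
move=> /rderP [[_ h1] [_ h2]]; rewrite /rderive !derive1E.
by move: h1 h2; case: l => a b /= -> ->.
Qed.

Lemma rderivableP f z v : rderivable f z v -> rder f z v (rderive f z v).
Proof.
move=> [h1 h2]; apply/rderP; rewrite /rderive !derive1E.
by split; [exact: (DeriveDef h1 erefl)|exact: (DeriveDef h2 erefl)].
Qed.

Lemma cder_derivable f z l : cder f z l -> derivable f z 1.
Proof. by move=> /cderP []. Qed.

Lemma cder_derive f z l : cder f z l -> 'D_1 f z = l.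
Proof. by move=> /cderP []. Qed.

Lemma derivable_cder f z : derivable f z 1 -> cder f z ('D_1 f z).
Proof. by move=> h; apply/cderP. Qed.

Lemma cder_rder f z v l : cder f z l -> rder f z v (v * l).
Proof.
move=> fP.
have h : expn Num.norm (fun t : R => z + t%:C%C * v) z (fun t => t%:C%C * v).
  split; first by exists (nrm v) => [|t]; rewrite ?nrm_ge0// nrmM nrm_real mulrC.
  move=> e e0; exists 1 => // t _.
  by rewrite [z + _]addrC addrK subrr nrm0 mulr_ge0 ?normr_ge0// ltW.
have := expn_comp (@normr_ge0 _ _) h fP (fun x y => mulrDl x y l).
have -> : (fun t : R => t%:C%C * v * l) = (fun t : R => t%:C%C * (v * l)).
  by apply/funext => t; rewrite mulrA.
by [].
Qed.

Lemma cder_cont f z l : cder f z l -> {for z, continuous f}.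
Proof.
move=> /expn_lip [K K0 [d d0 dP]]; apply/ccont_nrmP => e e0.
exists (Num.min d (e / K)); first by rewrite lt_min d0 divr_gt0.
move=> y; rewrite lt_min => /andP[yd ye].
have := dP _ yd; rewrite [z + _]addrC subrK => /le_lt_trans; apply.
by rewrite mulrC -ltr_pdivlMr.
Qed.

End Derivatives.

Section ComplexDerivatives.
Context {R : realType}.
Local Notation C := (R[i]^o).
Implicit Types (f g : C -> C) (z l m : C).

Lemma cder_eq f z l m : cder f z l -> l = m -> cder f z m.
Proof. by move=> h <-. Qed.

Lemma cder_near f g z l : (\forall y \near z, f y = g y) -> cder f z l -> cder g z l.
Proof. by move=> fg /cderP h; apply/cderP; exact: near_eq_is_derive fg h. Qed.

Lemma cder_cst (k : C) z : cder (fun=> k) z 0.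
Proof.
have := expn_cst (@nrm_ge0 R) k; rewrite /cder; congr (expn _ _ _ _).
by apply/funext => h; rewrite mulr0.
Qed.

Lemma cder_id z : cder id z 1.
Proof.
split; first by exists 1 => // h; rewrite mulr1 mul1r.
by move=> e e0; exists 1 => // h _; rewrite mulr1 [z + h]addrC addrK subrr nrm0 mulr_ge0 ?nrm_ge0// ltW.
Qed.

Lemma cderD f g z l m : cder f z l -> cder g z m -> cder (fun y => f y + g y) z (l + m).
Proof.
move=> h1 h2; have := expn_add h1 h2; rewrite /cder; congr (expn _ _ _ _).
by apply/funext => h; rewrite mulrDr.
Qed.

Lemma cderN f z l : cder f z l -> cder (fun y => - f y) z (- l).
Proof.
move=> h1; have := expn_opp (@nrm_ge0 R) h1; rewrite /cder; congr (expn _ _ _ _).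
by apply/funext => h; rewrite mulrN.
Qed.

Lemma cderB f g z l m : cder f z l -> cder g z m -> cder (fun y => f y - g y) z (l - m).
Proof. by move=> h1 /cderN; exact: cderD. Qed.

Lemma cderM f g z l m : cder f z l -> cder g z m ->
  cder (fun y => f y * g y) z (l * g z + f z * m).
Proof.
move=> h1 h2; have := expn_mul (@nrm_ge0 R) h1 h2; rewrite /cder; congr (expn _ _ _ _).
by apply/funext => h; ring.
Qed.

Lemma cderZ (k : C) f z l : cder f z l -> cder (fun y => k * f y) z (k * l).
Proof. by move=> /(cderM (cder_cst k z)); rewrite mul0r add0r. Qed.

Lemma cderV f z l : f z != 0 -> cder f z l -> cder (fun y => (f y)^-1) z (- l / f z ^+ 2).
Proof.
move=> f0 h1; have := expn_inv (@nrm_ge0 R) f0 h1; rewrite /cder; congr (expn _ _ _ _).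
by apply/funext => h; rewrite mulrA mulrN.
Qed.

Lemma cderX f z l n : cder f z l -> cder (fun y => f y ^+ n.+1) z (n.+1%:R * f z ^+ n * l).
Proof.
move=> fl; elim: n => [|n ih].
  by apply: cder_eq fl _; rewrite expr0 !mul1r.
have := cderM fl ih.
by move/cder_eq; apply; rewrite !exprS -[n.+2%:R]natr1; ring.
Qed.

Lemma cder_comp f g z l m : cder f z l -> cder g (f z) m ->
  cder (fun y => g (f y)) z (m * l).
Proof.
move=> h1 h2; have := expn_comp (@nrm_ge0 R) h1 h2 (fun x y => mulrDl x y m).
rewrite /cder; congr (expn _ _ _ _).
by apply/funext => h; rewrite -mulrA [l * m]mulrC.
Qed.

Lemma cder_open_eq (U : set C) f g z l : open U -> U z ->
  (forall y, U y -> f y = g y) -> cder f z l -> cder g z l.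
Proof.
move=> oU Uz fg; apply: cder_near.
by apply: filterS fg _; exact: open_nbhs_nbhs.
Qed.

End ComplexDerivatives.

(** * Cauchy's theorem and its consequences *)

Section PathIntegral.
Context {R : realType}.
Local Notation C := (R[i]^o).
Local Notation mu := (@lebesgue_measure R).
Implicit Types (u F : R -> R) (g G : R -> C) (t l a b c : R).

(** The base point [a - 1] makes every [t >= a], the endpoint [a] included, interior to the domain
    of the antiderivative, so that two-sided derivatives exist on all of [[a, b]]. *)
Definition intR u a b : R :=
  (\int[mu]_(t in `[a - 1, b]) u t - \int[mu]_(t in `[a - 1, a]) u t)%R.

Lemma antiderivative_exists u m : continuous u ->
  forall t, m < t ->
   is_derive t (1 : R) (fun x => \int[mu]_(t in `[m, x]) u t)%R (u t).
Proof.
move=> cu t mt.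
have t1 : t < t + 1 by rewrite ltrDl.
have iu : mu.-integrable `[m, t + 1] (EFin \o u).
  apply: continuous_compact_integrable; first exact: segment_compact.
  exact: continuous_subspaceT.
have [h1 h2] := continuous_FTC1_closed t1 iu mt (cu t).
exact: (DeriveDef h1 (etrans (esym (derive1E _ _)) h2)).
Qed.

Definition tder G t (l : C) :=
  expn Num.norm (fun h : R => G (t + h)) (G t) (fun h => h%:C%C * l).

Lemma tderP G t (l : C) : tder G t l <->
  is_derive t (1 : R) (fun s => complex.Re (G s)) (complex.Re l) /\
  is_derive t (1 : R) (fun s => complex.Im (G s)) (complex.Im l).
Proof.
have ReB (x y : R[i]) (h : R) : complex.Re (x - y - h%:C%C * l) =
    complex.Re x - complex.Re y - h * complex.Re l.
  by case: x y (l) => [a b] [c e] [l1 l2] /=; ring.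
have ImB (x y : R[i]) (h : R) : complex.Im (x - y - h%:C%C * l) =
    complex.Im x - complex.Im y - h * complex.Im l.
  by case: x y (l) => [a b] [c e] [l1 l2] /=; ring.
split.
  move=> [_ fP]; split; apply/is_deriveR_epsP => e /fP [d d0 dP]; exists d => // h hd.
    by have := dP _ hd; apply: le_trans; rewrite -ReB Re_le_nrm.
  by have := dP _ hd; apply: le_trans; rewrite -ImB Im_le_nrm.
move=> [/is_deriveR_epsP f1 /is_deriveR_epsP f2]; split.
  by exists (nrm l) => [|h]; rewrite ?nrm_ge0// nrmM nrm_real mulrC.
move=> e e0; have e20 : 0 < e / 2 by rewrite divr_gt0.
have [d1 d10 d1P] := f1 _ e20; have [d2 d20 d2P] := f2 _ e20.
exists (Num.min d1 d2); first by rewrite lt_min d10.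
move=> h; rewrite lt_min => /andP[/d1P + /d2P].
rewrite -ReB -ImB => h1 h2.
by rewrite (le_trans (nrm_le_ReIm _))// (splitr e) [leRHS]mulrDl lerD.
Qed.

Lemma tder_scale k G t (l : C) : tder G t l -> tder (fun s => k * G s) t (k * l).
Proof.
move=> /(expn_scale (@normr_ge0 _ _) k).
by rewrite /tder; congr (expn _ _ _ _); apply/funext => s; rewrite mulrCA.
Qed.

Lemma tder_add G H t (l m : C) : tder G t l -> tder H t m ->
  tder (fun s => G s + H s) t (l + m).
Proof.
move=> h1 h2; have := expn_add h1 h2.
by rewrite /tder; congr (expn _ _ _ _); apply/funext => s; rewrite mulrDr.
Qed.

Lemma mvt_bound F u a b M : a <= b ->
  (forall t, a <= t <= b -> is_derive t (1 : R) F (u t)) ->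
  (forall t, a <= t <= b -> `|u t| <= M) -> `|F b - F a| <= M * (b - a).
Proof.
move=> ab dF uM.
have [||t] := @MVT_segment R F u a b ab.
- by move=> x; rewrite in_itv /= => /andP[/ltW ax /ltW xb]; apply: dF; rewrite ax.
- apply: derivable_within_continuous => x; rewrite in_itv /= => axb.
  by have [] := dF x axb.
rewrite in_itv /= => atb ->; rewrite normrM (ger0_norm (_ : 0 <= b - a)) ?subr_ge0//.
by rewrite ler_wpM2r ?subr_ge0// uM.
Qed.

(** The mean value theorem holds for the real and imaginary parts separately, at different points;
    hence the factor 2. *)
Lemma tder_bound G g a b M : a <= b ->
  (forall t, a <= t <= b -> tder G t (g t)) ->
  (forall t, a <= t <= b -> nrm (g t) <= M) ->
  nrm (G b - G a) <= 2 * M * (b - a).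
Proof.
move=> ab dG gM.
rewrite (le_trans (nrm_le_ReIm _))// (_ : 2 * M * (b - a) = M * (b - a) + M * (b - a)); last by ring.
have ReE (x y : C) : complex.Re (x - y) = complex.Re x - complex.Re y by case: x y => [? ?] [? ?].
have ImE (x y : C) : complex.Im (x - y) = complex.Im x - complex.Im y by case: x y => [? ?] [? ?].
rewrite ReE ImE lerD//.
  apply: (@mvt_bound (fun s => complex.Re (G s)) (fun s => complex.Re (g s))) => // t /[dup] /dG /tderP [h1 h2] // /gM.
  by apply: le_trans; exact: Re_le_nrm.
apply: (@mvt_bound (fun s => complex.Im (G s)) (fun s => complex.Im (g s))) => // t /[dup] /dG /tderP [h1 h2] // /gM.
by apply: le_trans; exact: Im_le_nrm.
Qed.

Lemma tder_unique G H g a b : a <= b ->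
  (forall t, a <= t <= b -> tder G t (g t)) ->
  (forall t, a <= t <= b -> tder H t (g t)) -> G b - G a = H b - H a.
Proof.
move=> ab dG dH; apply/eqP; rewrite -subr_eq0 -nrm_eq0 eq_le nrm_ge0 andbT.
have := @tder_bound (fun t => G t + (-1) * H t) (fun t => g t + (-1) * g t) a b 0 ab.
rewrite mulr0 mul0r => h.
have -> : G b - G a - (H b - H a) = G b + (-1) * H b - (G a + (-1) * H a) by ring.
apply: h => [t tab|t _]; last by rewrite mulN1r subrr nrm0.
by apply: tder_add (tder_scale _ _); [exact: dG|exact: dH].
Qed.

Fact intC_key : unit. Proof. exact: tt. Qed.
Definition intC : (R -> C) -> R -> R -> C := locked_with intC_key (fun g a b =>
  Complex (intR (fun t => complex.Re (g t)) a b) (intR (fun t => complex.Im (g t)) a b)).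
Lemma intCE g a b : intC g a b =
  Complex (intR (fun t => complex.Re (g t)) a b) (intR (fun t => complex.Im (g t)) a b).
Proof. by rewrite [intC]unlock. Qed.

Lemma Re_continuous : continuous (fun z : C => complex.Re z : R).
Proof.
move=> z P /nbhs_ballP [e e0 eP]; apply/nbhs_nrmP; exists e => // y yz.
apply: eP; rewrite /ball /=; apply: le_lt_trans yz; rewrite nrm_distC.
by apply: le_trans (Re_le_nrm _); case: z y => [? ?] [? ?].
Qed.

Lemma Im_continuous : continuous (fun z : C => complex.Im z : R).
Proof.
move=> z P /nbhs_ballP [e e0 eP]; apply/nbhs_nrmP; exists e => // y yz.
apply: eP; rewrite /ball /=; apply: le_lt_trans yz; rewrite nrm_distC.
by apply: le_trans (Im_le_nrm _); case: z y => [? ?] [? ?].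
Qed.

Lemma tder_exists g m : continuous g -> exists G,
  (forall t, m < t -> tder G t (g t)) /\
  forall a b, m = a - 1 -> intC g a b = G b - G a.
Proof.
move=> cg.
exists (fun t => Complex (\int[mu]_(s in `[m, t]) (complex.Re (g s)))%R
                         (\int[mu]_(s in `[m, t]) (complex.Im (g s)))%R).
split=> [t mt|a b ->]; last by rewrite intCE.
apply/tderP; split=> /=; apply: antiderivative_exists => // s.
  by apply: (@continuous_comp _ _ _ g (fun z : C => complex.Re z)); [exact: cg|exact: Re_continuous].
by apply: (@continuous_comp _ _ _ g (fun z : C => complex.Im z)); [exact: cg|exact: Im_continuous].
Qed.

Lemma intC_FTC g G a b : continuous g -> a <= b ->
  (forall t, a <= t <= b -> tder G t (g t)) -> intC g a b = G b - G a.
Proof.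
move=> cg ab dG; have [H [dH ->//]] := tder_exists (a - 1) cg.
apply: (tder_unique ab _ dG) => t /andP[at_ tb]; apply: dH.
by rewrite (lt_le_trans _ at_)// ltrBlDr ltrDl.
Qed.

Lemma intC_antider g a b : continuous g -> a <= b ->
  exists2 G, (forall t, a <= t -> tder G t (g t)) & forall t, a <= t -> intC g a t = G t - G a.
Proof.
move=> cg ab; have [H [dH HE]] := tder_exists (a - 1) cg; exists H.
  by move=> t at_; apply: dH; rewrite (lt_le_trans _ at_)// ltrBlDr ltrDl.
by move=> t at_; apply: HE.
Qed.

Lemma intC_chasles g a b c : continuous g -> a <= b -> b <= c ->
  intC g a b + intC g b c = intC g a c.
Proof.
move=> cg ab bc; have [H dH HE] := intC_antider cg ab.
rewrite !HE//; last exact: le_trans bc.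
rewrite (@intC_FTC g H b c)//; first by ring.
by move=> t /andP[bt _]; apply: dH; exact: le_trans bt.
Qed.

Lemma intC_lin (k : C) g h a b : continuous g -> continuous h -> a <= b ->
  continuous (fun t => k * g t + h t) ->
  intC (fun t => k * g t + h t) a b = k * intC g a b + intC h a b.
Proof.
move=> cg ch ab cgh; have [G dG ->//] := intC_antider cg ab.
have [H dH ->//] := intC_antider ch ab.
rewrite (@intC_FTC _ (fun t => k * G t + H t))//; first by ring.
move=> t /andP[at_ _].
by apply: tder_add; [apply: tder_scale; exact: dG|exact: dH].
Qed.

Lemma intC_bound g a b M : continuous g -> a <= b ->
  (forall t, a <= t <= b -> nrm (g t) <= M) -> nrm (intC g a b) <= 2 * M * (b - a).
Proof.
move=> cg ab gM; have [G dG ->//] := intC_antider cg ab.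
by apply: (tder_bound ab _ gM) => t /andP[at_ _]; exact: dG.
Qed.

Lemma intC_eq g h a b : continuous g -> continuous h -> a <= b ->
  (forall t, a <= t <= b -> g t = h t) -> intC g a b = intC h a b.
Proof.
move=> cg ch ab gh; have [G dG ->//] := intC_antider cg ab.
rewrite (@intC_FTC h G)// => t tab; rewrite -gh//; apply: dG.
by case/andP: tab.
Qed.

End PathIntegral.

Section Rectangle.
Context {R : realType}.
Local Notation C := (R[i]^o).
Implicit Types (f : C -> C) (a b c d : R) (z w p v : C).

Definition line p v (t : R) : C := p + t%:C%C * v.

Lemma line_continuous p v : continuous (line p v).
Proof.
move=> t; apply/rcont_nrmP => e e0.
have nv : 0 < nrm v + 1 by rewrite ltr_wpDl// nrm_ge0.
exists (e / (nrm v + 1)); first by rewrite divr_gt0.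
move=> s st; have -> : line p v s - line p v t = (s - t)%:C%C * v.
  by rewrite /line rmorphB /=; ring.
rewrite nrmM nrm_real; rewrite ltr_pdivlMr// in st; apply: le_lt_trans st.
by rewrite ler_wpM2l// lerDl.
Qed.

Lemma comp_line_continuous f p v : continuous f -> continuous (fun t => f (line p v t)).
Proof.
move=> cf t; apply: (@continuous_comp _ _ _ (line p v) f); last exact: cf.
exact: line_continuous.
Qed.

Fact lint_key : unit. Proof. exact: tt. Qed.
Definition lint : (C -> C) -> C -> C -> R -> R -> C := locked_with lint_key
  (fun f p v a b => v * intC (fun t => f (line p v t)) a b).
Lemma lintE f p v a b : lint f p v a b = v * intC (fun t => f (line p v t)) a b.
Proof. by rewrite [lint]unlock. Qed.

Lemma tder_line (Phi : C -> C) p v (t : R) (l : C) :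
  cder Phi (line p v t) l -> tder (fun s => Phi (line p v s)) t (v * l).
Proof.
move=> /(cder_rder v); rewrite /rder /tder.
by congr (expn _ _ _ _); apply/funext => s; rewrite /line rmorphD /=; congr (Phi _); ring.
Qed.

Lemma lint_FTC f Phi p v a b : continuous f -> a <= b ->
  (forall t, a <= t <= b -> cder Phi (line p v t) (f (line p v t))) ->
  lint f p v a b = Phi (line p v b) - Phi (line p v a).
Proof.
move=> cf ab dP; rewrite !lintE.
have [G dG ->//] := intC_antider (comp_line_continuous (p := p) (v := v) cf) ab.
rewrite mulrBr.
apply: (@tder_unique _ (fun t => v * G t) (fun t => Phi (line p v t)) (fun t => v * f (line p v t)) a b) => // t tab.
  by apply/tder_scale/dG; case/andP: tab.
exact/tder_line/dP.
Qed.

Fact rectI_key : unit. Proof. exact: tt. Qed.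
(** The counterclockwise boundary integral. Horizontal sides lie on lines through [Complex 0 c] with
    direction 1, vertical ones on lines through [Complex a 0] with direction ['i], so the parameter
    is the coordinate itself and adjacent rectangles share the parametrisation of a common side. *)
Definition rectI : (C -> C) -> R -> R -> R -> R -> C := locked_with rectI_key
  (fun f a b c d =>
    lint f (Complex 0 c) 1 a b - lint f (Complex 0 d) 1 a b
    + (lint f (Complex b 0) 'i%C c d - lint f (Complex a 0) 'i%C c d)).
Lemma rectIE f a b c d : rectI f a b c d =
  lint f (Complex 0 c) 1 a b - lint f (Complex 0 d) 1 a b
  + (lint f (Complex b 0) 'i%C c d - lint f (Complex a 0) 'i%C c d).
Proof. by rewrite [rectI]unlock. Qed.

Lemma line1 c (t : R) : line (Complex 0 c) 1 t = Complex t c.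
Proof. by rewrite /line mulr1; apply/eqP; rewrite eq_complex /= add0r addr0 !eqxx. Qed.

Lemma linei a (t : R) : line (Complex a 0) 'i%C t = Complex a t.
Proof. by rewrite /line; apply/eqP; rewrite eq_complex /= mulr0 !mul0r subr0 addr0 mulr1 addr0 add0r !eqxx. Qed.

Lemma lint_chasles f p v a b c : continuous f -> a <= b -> b <= c ->
  lint f p v a b + lint f p v b c = lint f p v a c.
Proof.
move=> cf ab bc; rewrite !lintE -mulrDr intC_chasles//.
exact: (comp_line_continuous cf).
Qed.

Lemma rectI_splitx f a m b c d : continuous f -> a <= m -> m <= b ->
  rectI f a b c d = rectI f a m c d + rectI f m b c d.
Proof.
by move=> cf am mb; rewrite !rectIE -!(@lint_chasles f _ _ a m b)//; ring.
Qed.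

Lemma rectI_splity f a b c m d : continuous f -> c <= m -> m <= d ->
  rectI f a b c d = rectI f a b c m + rectI f a b m d.
Proof.
by move=> cf am mb; rewrite !rectIE -!(@lint_chasles f _ _ c m d)//; ring.
Qed.

Lemma lint_lin f g p v a b (k : C) : continuous f -> continuous g -> a <= b ->
  continuous (fun z => k * f z + g z) ->
  lint (fun z => k * f z + g z) p v a b = k * lint f p v a b + lint g p v a b.
Proof.
move=> cf cg ab cfg.
have c1 := comp_line_continuous (p := p) (v := v) cf.
have c2 := comp_line_continuous (p := p) (v := v) cg.
have c3 := comp_line_continuous (p := p) (v := v) cfg.
by rewrite !lintE (intC_lin c1 c2 ab c3) mulrDr mulrCA.
Qed.

Lemma rectI_lin f g a b c d (k : C) : continuous f -> continuous g -> a <= b -> c <= d ->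
  continuous (fun z => k * f z + g z) ->
  rectI (fun z => k * f z + g z) a b c d = k * rectI f a b c d + rectI g a b c d.
Proof. by move=> cf cg ab cd cfg; rewrite !rectIE !lint_lin//; ring. Qed.

Lemma lint_bound f p v a b M : continuous f -> a <= b ->
  (forall t, a <= t <= b -> nrm (f (line p v t)) <= M) ->
  nrm (lint f p v a b) <= nrm v * (2 * M * (b - a)).
Proof.
move=> cf ab fM; rewrite !lintE nrmM ler_wpM2l ?nrm_ge0//.
by apply: intC_bound => //; exact: (comp_line_continuous cf).
Qed.

Lemma rectI_bound f a b c d M : continuous f -> a <= b -> c <= d ->
  (forall x y, a <= x <= b -> c <= y <= d -> nrm (f (Complex x y)) <= M) ->
  nrm (rectI f a b c d) <= 4 * M * ((b - a) + (d - c)).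
Proof.
move=> cf ab cd fM.
have aab : a <= a <= b by rewrite lexx.
have bab : a <= b <= b by rewrite lexx andbT.
have ccd : c <= c <= d by rewrite lexx.
have dcd : c <= d <= d by rewrite lexx andbT.
have h1 y : c <= y <= d -> nrm (lint f (Complex 0 y) 1 a b) <= 2 * M * (b - a).
  move=> ycd; have := @lint_bound f (Complex 0 y) 1 a b M cf ab.
  by rewrite nrm1 mul1r; apply=> t tab; rewrite line1 fM.
have h2 x : a <= x <= b -> nrm (lint f (Complex x 0) 'i%C c d) <= 2 * M * (d - c).
  move=> xab; have := @lint_bound f (Complex x 0) 'i%C c d M cf cd.
  by rewrite nrm_i mul1r; apply=> t tcd; rewrite linei fM.
rewrite !rectIE (le_trans (nrmD _ _))//.
have -> : 4 * M * ((b - a) + (d - c)) = (2 * M * (b - a) + 2 * M * (b - a)) +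
  (2 * M * (d - c) + 2 * M * (d - c)) by ring.
by rewrite lerD// (le_trans (nrmB _ _))// lerD// ?h1 ?h2.
Qed.

Lemma rectI_exact f Phi a b c d : continuous f -> a <= b -> c <= d ->
  (forall z, cder Phi z (f z)) -> rectI f a b c d = 0.
Proof.
move=> cf ab cd dP; rewrite !rectIE !(lint_FTC (Phi := Phi))//.
by rewrite !line1 !linei; ring.
Qed.

End Rectangle.

(** * Goursat's lemma *)

Section Goursat.
Context {R : realType}.
Local Notation C := (R[i]^o).
Implicit Types (f g q : C -> C) (a b c d : R) (z w p v : C).

Lemma continuous_comp_C (T : topologicalType) (f : T -> C) (g : C -> C) t :
  {for t, continuous f} -> {for f t, continuous g} ->
  {for t, continuous (fun s => g (f s) : C)}.
Proof.
move=> /cont_nrmP cf /ccont_nrmP cg; apply/cont_nrmP => e /cg [d d0 dP].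
by apply: filterS (cf _ d0) => s /dP.
Qed.

Lemma continuousD_C (T : topologicalType) (f g : T -> C) t :
  {for t, continuous f} -> {for t, continuous g} ->
  {for t, continuous (fun s => f s + g s : C)}.
Proof.
move=> /cont_nrmP cf /cont_nrmP cg; apply/cont_nrmP => e e0.
have e20 : 0 < e / 2 by rewrite divr_gt0.
apply: filterS2 (cf _ e20) (cg _ e20) => s fs gs.
rewrite (_ : _ - _ = (f s - f t) + (g s - g t)); last by ring.
by rewrite (le_lt_trans (nrmD _ _))// (splitr e) ltrD.
Qed.

Lemma continuousM_C (T : topologicalType) (f g : T -> C) t :
  {for t, continuous f} -> {for t, continuous g} ->
  {for t, continuous (fun s => f s * g s : C)}.
Proof.
move=> /cont_nrmP cf /cont_nrmP cg; apply/cont_nrmP => e e0.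
have f0 : 0 < 2 * (nrm (f t) + 1) by rewrite mulr_gt0// ltr_wpDl// nrm_ge0.
have g0 : 0 < 2 * (nrm (g t) + 1) by rewrite mulr_gt0// ltr_wpDl// nrm_ge0.
apply: filterS3 (cf _ (divr_gt0 e0 g0)) (cg _ (divr_gt0 e0 f0)) (cg _ ltr01) => s fs gs g1.
rewrite (_ : _ - _ = (f s - f t) * g s + f t * (g s - g t)); last by ring.
rewrite (le_lt_trans (nrmD _ _))// !nrmM.
have gg : nrm (g s) <= nrm (g t) + 1.
  have := nrmD (g s - g t) (g t); rewrite subrK => h.
  by rewrite (le_trans h)// addrC lerD2l ltW.
rewrite ltr_pdivlMr// in fs; rewrite ltr_pdivlMr// in gs.
have h1 := ler_wpM2l (nrm_ge0 (f s - f t)) gg.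
have h2 : nrm (f t) * nrm (g s - g t) <= nrm (g s - g t) * (nrm (f t) + 1).
  by rewrite mulrC ler_wpM2l ?nrm_ge0// lerDl.
move: fs gs h1 h2; rewrite !(mulrCA _ 2).
move: (nrm (f s - f t) * (nrm (g t) + 1)) (nrm (g s - g t) * (nrm (f t) + 1)).
move: (nrm (f s - f t) * nrm (g s)) (nrm (f t) * nrm (g s - g t)) => a b c d.
by clear; lra.
Qed.

Lemma continuousV_C (T : topologicalType) (f : T -> C) t :
  f t != 0 -> {for t, continuous f} ->
  {for t, continuous (fun s => (f s)^-1 : C)}.
Proof.
move=> f0 cf; apply: (continuous_comp_C (g := fun z : C => z^-1) cf).
exact: cder_cont (cderV f0 (cder_id (f t))).
Qed.

Lemma continuous_cst_C (T : topologicalType) (k : C) (t : T) :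
  {for t, continuous (fun=> k)}.
Proof. by apply/cont_nrmP => e e0; near=> s; rewrite subrr nrm0.
Unshelve. all: by end_near. Qed.

Definition half_pow (s : R) n : R := s / 2 ^+ n.

Lemma half_powS s n : half_pow s n = half_pow s n.+1 + half_pow s n.+1.
Proof.
rewrite /half_pow exprS; have : (2 : R) ^+ n != 0 by rewrite expf_neq0 ?pnatr_eq0.
by move=> h; field.
Qed.

Lemma half_pow_ge0 s n : 0 <= s -> 0 <= half_pow s n.
Proof. by move=> s0; rewrite /half_pow divr_ge0// exprn_ge0. Qed.

Lemma nat_le_exp2 n : (n%:R : R) <= 2 ^+ n.
Proof.
elim: n => [|n ih]; first by rewrite expr0.
rewrite exprS -natr1 mulr_natl mulr2n lerD//.
by rewrite exprn_ege1// ler1n.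
Qed.

Lemma half_pow_small s e : 0 <= s -> 0 < e -> exists n, half_pow s n < e.
Proof.
move=> s0 e0; have [n hn] : exists n : nat, s / e < n%:R.
  by exists (Num.bound (s / e)); apply: archi_boundP; rewrite divr_ge0// ltW.
exists n; rewrite /half_pow ltr_pdivrMr ?exprn_gt0//.
rewrite ltr_pdivrMr// in hn; apply: (lt_le_trans hn).
by rewrite mulrC ler_wpM2l ?(ltW e0)// nat_le_exp2.
Qed.

(** The common point is the supremum of the left endpoints, which are bounded by every right
    endpoint. *)
Lemma nested_intervals (x_ : nat -> R) s : 0 <= s ->
  (forall n, x_ n.+1 = x_ n \/ x_ n.+1 = x_ n + half_pow s n.+1) ->
  exists X, forall n, x_ n <= X <= x_ n + half_pow s n.
Proof.
move=> s0 xS.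
have xle n m : x_ n <= x_ (n + m)%N.
  elim: m => [|m ih]; first by rewrite addn0.
  rewrite addnS (le_trans ih)//; case: (xS (n + m)%N) => -> //.
  by rewrite lerDl half_pow_ge0.
have xge n m : x_ (n + m)%N + half_pow s (n + m) <= x_ n + half_pow s n.
  elim: m => [|m ih]; first by rewrite addn0.
  rewrite addnS (le_trans _ ih)//.
  have := half_powS s (n + m); have := half_pow_ge0 (n + m).+1 s0.
  by case: (xS (n + m)%N) => ->; lra.
have xx n m : x_ m <= x_ n + half_pow s n.
  have h := half_pow_ge0 m s0.
  have [nm|mn] := leqP n m.
    by rewrite -(subnKC nm) (le_trans _ (xge n (m - n)%N))// subnKC// lerDl.
  rewrite (le_trans (xle m (n - m)%N))// subnKC ?(ltnW mn)//.
  by rewrite lerDl half_pow_ge0.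
have ne : range x_ !=set0 by exists (x_ 0%N), 0%N.
exists (sup (range x_)) => n; apply/andP; split.
  apply: ub_le_sup; last by exists n.
  by exists (x_ 0%N + half_pow s 0) => _ [m _ <-].
by apply: ge_sup => // _ [m _ <-].
Qed.

Lemma cder_affine (k l z0 : C) z : cder (fun z => k + (z - z0) * l) z l.
Proof.
split; first by exists (nrm l) => [|h]; rewrite ?nrm_ge0// nrmM mulrC.
move=> e e0; exists 1 => // h _.
have -> : k + (z + h - z0) * l - (k + (z - z0) * l) - h * l = 0 by ring.
by rewrite nrm0 mulr_ge0 ?nrm_ge0// ltW.
Qed.

Lemma rectI_affine (k l z0 : C) a b c d : a <= b -> c <= d ->
  rectI (fun z => k + (z - z0) * l) a b c d = 0.
Proof.
move=> ab cd.
apply: (@rectI_exact _ _ (fun z => k * z + (z - z0) ^+ 2 / 2 * l)) => //.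
  by move=> z; exact: cder_cont (cder_affine k l z0 z).
move=> z; split.
  exists (nrm (k + (z - z0) * l)) => [|h]; first exact: nrm_ge0.
  by rewrite nrmM mulrC.
move=> e e0; have l0 : 0 < nrm l + 1 by rewrite ltr_wpDl// nrm_ge0.
exists (e / (nrm l + 1)); first by rewrite divr_gt0.
move=> h hd.
have -> : k * (z + h) + (z + h - z0) ^+ 2 / 2 * l -
  (k * z + (z - z0) ^+ 2 / 2 * l) - h * (k + (z - z0) * l) = (h * l / 2) * h.
  by field.
rewrite nrmM ler_wpM2r ?nrm_ge0// !nrmM.
have -> : nrm (2^-1 : R[i]) = 2^-1.
  by rewrite nrmV (_ : (2 : R[i]) = (2 : R)%:C%C) ?nrm_real ?normr_nat ?rmorph_nat.
rewrite ler_pdivrMr//.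
rewrite ltr_pdivlMr// in hd.
have := nrm_ge0 h; have := nrm_ge0 l; nra.
Qed.

(** The integrals over the four quarters add up to the whole, so one of them has at least a quarter
    of its modulus. The sides are written [s + s] and [t + t] to match [half_powS]. *)
Lemma rectI_quarter f a c s t : continuous f -> 0 <= s -> 0 <= t ->
  exists a' c', [/\ a' = a \/ a' = a + s, c' = c \/ c' = c + t &
   nrm (rectI f a (a + (s + s)) c (c + (t + t))) <=
   4 * nrm (rectI f a' (a' + s) c' (c' + t))].
Proof.
move=> cf s0 t0.
have := @rectI_splitx _ f a (a + s) (a + (s + s)) c (c + (t + t)) cf.
rewrite lerDl addrA lerDl => /(_ s0 s0) ->.
rewrite [c + (t + t)]addrA !(@rectI_splity _ f _ _ c (c + t) (c + t + t) cf) ?lerDl//.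
have key (A B D E : C) : nrm (A + B + (D + E)) <= 4 * nrm A \/
    nrm (A + B + (D + E)) <= 4 * nrm B \/
    nrm (A + B + (D + E)) <= 4 * nrm D \/ nrm (A + B + (D + E)) <= 4 * nrm E.
  have : nrm (A + B + (D + E)) <= nrm A + nrm B + (nrm D + nrm E).
    by rewrite (le_trans (nrmD _ _))// lerD// nrmD.
  move: (nrm (A + B + (D + E))) (nrm A) (nrm B) (nrm D) (nrm E) => x y1 y2 y3 y4 h.
  have [|h1] := leP x (4 * y1); first by left.
  have [|h2] := leP x (4 * y2); first by right; left.
  have [|h3] := leP x (4 * y3); first by right; right; left.
  right; right; right; move: h h1 h2 h3; clear; lra.
case: (key (rectI f a (a + s) c (c + t)) (rectI f a (a + s) (c + t) (c + t + t))
   (rectI f (a + s) (a + s + s) c (c + t)) (rectI f (a + s) (a + s + s) (c + t) (c + t + t))) => [h|[h|[h|h]]].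
- by exists a, c; split; [left|left|].
- by exists a, (c + t); split; [left|right|].
- by exists (a + s), c; split; [right|left|].
- by exists (a + s), (c + t); split; [right|right|].
Qed.

Theorem goursat f a b c d : continuous f -> a <= b -> c <= d ->
  (forall x y, a <= x <= b -> c <= y <= d -> exists l, cder f (Complex x y) l) ->
  rectI f a b c d = 0.
Proof.
move=> cf ab cd df.
pose s := b - a; pose t := d - c.
have s0 : 0 <= s by rewrite subr_ge0.
have t0 : 0 <= t by rewrite subr_ge0.
(* Going through an existential keeps [J] opaque in the recursive choice below. *)
have [J JE0] : exists J, forall n (p : R * R), J n p = rectI f p.1 (p.1 + half_pow s n) p.2 (p.2 + half_pow t n).
  by exists (fun n (p : R * R) => rectI f p.1 (p.1 + half_pow s n) p.2 (p.2 + half_pow t n)).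
have /choice [F FP] : forall np : nat * (R * R), exists p' : R * R,
    [/\ p'.1 = np.2.1 \/ p'.1 = np.2.1 + half_pow s np.1.+1,
        p'.2 = np.2.2 \/ p'.2 = np.2.2 + half_pow t np.1.+1 &
        nrm (J np.1 np.2) <= 4 * nrm (J np.1.+1 p')].
  move=> [n [p1 p2]] /=; rewrite JE0 /= (half_powS s n) (half_powS t n).
  have [a' [c' [h1 h2 h3]]] := rectI_quarter p1 p2 cf (half_pow_ge0 n.+1 s0) (half_pow_ge0 n.+1 t0).
  by exists (a', c'); rewrite JE0.
have [p [p0 pS]] : exists p : nat -> R * R, p 0%N = (a, c) /\ forall n,
      [/\ (p n.+1).1 = (p n).1 \/ (p n.+1).1 = (p n).1 + half_pow s n.+1,
        (p n.+1).2 = (p n).2 \/ (p n.+1).2 = (p n).2 + half_pow t n.+1 &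
        nrm (J n (p n)) <= 4 * nrm (J n.+1 (p n.+1))].
  exists (fix p n := if n is m.+1 then F (m, p m) else (a, c)).
  by split=> // m; exact: FP.
have [X XP] := @nested_intervals (fun n => (p n).1) s s0 (fun n => let: And3 h _ _ := pS n in h).
have [Y YP] := @nested_intervals (fun n => (p n).2) t t0 (fun n => let: And3 _ h _ := pS n in h).
have J0 : J 0%N (p 0%N) = rectI f a b c d.
  by rewrite JE0 p0 /half_pow /= expr0 !divr1 /s /t !(addrC _ (_ - _)) !subrK.
have Jn n : nrm (rectI f a b c d) <= 4 ^+ n * nrm (J n (p n)).
  elim: n => [|n ih]; first by rewrite expr0 mul1r J0.
  rewrite (le_trans ih)// exprSr -mulrA ler_wpM2l ?exprn_ge0//.
  by have [] := pS n.
have [l fl] : exists l, cder f (Complex X Y) l.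
  have := XP 0%N; have := YP 0%N; rewrite p0 /half_pow /= expr0 !divr1 /s /t.
  rewrite !(addrC _ (_ - _)) !subrK => h1 h2.
  exact: df.
have key e : 0 < e -> nrm (rectI f a b c d) <= 4 * e * (s + t) ^+ 2.
  move=> e0; have [_ /(_ e e0) [r r0 rP]] := fl.
  have [n] := half_pow_small (addr_ge0 s0 t0) r0.
  rewrite {1}/half_pow mulrDl -!/(half_pow _ _) => nr.
  have /andP[X1 X2] := XP n; have /andP[Y1 Y2] := YP n.
  set sn := half_pow s n in X2 nr *; set tn := half_pow t n in Y2 nr *.
  have sn0 : 0 <= sn by exact: half_pow_ge0.
  have tn0 : 0 <= tn by exact: half_pow_ge0.
  set Z := Complex X Y.
  have caff : continuous (fun z : C => f Z + (z - Z) * l).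
    by move=> z; exact: cder_cont (cder_affine _ l Z z).
  have crem : continuous (fun z : C => (-1) * (f Z + (z - Z) * l) + f z).
    move=> z; apply: (@continuousD_C _ (fun z => (-1) * (f Z + (z - Z) * l)) f); last exact: cf.
    by apply: (@continuousM_C _ (fun=> -1) (fun z => f Z + (z - Z) * l)); [exact: continuous_cst_C|exact: caff].
  (* The affine part of [f] at the limit point integrates to zero. It leaves a remainder of size
     [e * (sn + tn)] on a contour whose length is of order [sn + tn]; the product scales as [4^-n],
     which cancels the loss in [Jn]. *)
  have JE : J n (p n) = rectI (fun z => (-1) * (f Z + (z - Z) * l) + f z)
     (p n).1 ((p n).1 + sn) (p n).2 ((p n).2 + tn).
    have x12 : (p n).1 <= (p n).1 + sn by rewrite lerDl.
    have y12 : (p n).2 <= (p n).2 + tn by rewrite lerDl.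
    have h1 := @rectI_lin _ (fun z => f Z + (z - Z) * l) f _ _ _ _ (-1) caff cf x12 y12 crem.
    by rewrite h1 (rectI_affine (f Z) l Z x12 y12) mulr0 add0r; exact: JE0.
  have JB : nrm (J n (p n)) <= 4 * (e * (sn + tn)) * (sn + tn).
    rewrite JE; apply: (le_trans (rectI_bound (M := e * (sn + tn)) crem _ _ _)).
    - by rewrite lerDl.
    - by rewrite lerDl.
    - move=> x y /andP[x1 x2] /andP[y1 y2].
      have dist : nrm (Complex x y - Z) <= sn + tn.
        rewrite (le_trans (nrm_le_ReIm _))// /Z /= lerD// ler_norml.
          by rewrite !lerBlDr; apply/andP; split; lra.
        by rewrite !lerBlDr; apply/andP; split; lra.
      have := rP _ (le_lt_trans dist nr).
      rewrite [Z + _]addrC subrK => h.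
      have -> : -1 * (f Z + (Complex x y - Z) * l) + f (Complex x y) =
         f (Complex x y) - f Z - (Complex x y - Z) * l by ring.
      by rewrite (le_trans h)// ler_wpM2l// ltW.
    - by rewrite le_eqVlt; apply/orP; left; apply/eqP; ring.
  rewrite (le_trans (Jn n))// (le_trans (ler_wpM2l _ JB)) ?exprn_ge0//.
  rewrite le_eqVlt; apply/orP; left; apply/eqP.
  rewrite /sn /tn /half_pow (_ : (4 : R) = 2 ^+ 2); last by ring.
  rewrite -exprM mulnC exprM.
  have n0 : (2 : R) ^+ n != 0 by rewrite expf_neq0 ?pnatr_eq0.
  by field.
apply/eqP; rewrite -nrm_eq0 eq_le nrm_ge0 andbT leNgt; apply/negP => I0.
have st1 : 0 < 4 * (s + t) ^+ 2 + 1 by rewrite ltr_wpDl// mulr_ge0// sqr_ge0.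
(* With [A = (s + t) ^+ 2], this [e] makes the bound [4 * e * A] at most half of the modulus of the
   integral. *)
have := key (nrm (rectI f a b c d) / (2 * (4 * (s + t) ^+ 2 + 1))).
rewrite divr_gt0 ?mulr_gt0// => /(_ isT).
set I := nrm _ in I0 *; set A := (s + t) ^+ 2 in st1 *.
have A0 : 0 <= A by rewrite sqr_ge0.
rewrite (_ : 4 * (I / (2 * (4 * A + 1))) * A = (4 * A / (4 * A + 1)) * (I / 2)).
  have : 4 * A / (4 * A + 1) <= 1 by rewrite ler_pdivrMr// mul1r lerDl.
  nra.
by field; rewrite gt_eqF.
Qed.

(** Cutting along the sides of a square of half-side [e] around the exceptional point leaves only
    that square; its integral is of order [e], since continuity bounds the integrand there. *)
Lemma goursat_punctured q a b c d wx wy : continuous q ->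
  a < wx < b -> c < wy < d ->
  (forall z, z != Complex wx wy -> a <= complex.Re z <= b -> c <= complex.Im z <= d ->
     exists l, cder q z l) ->
  rectI q a b c d = 0.
Proof.
move=> cq /andP[aw wb] /andP[cw wd] dq.
have /ccont_nrmP/(_ 1 ltr01) [r r0 rP] := cq (Complex wx wy).
set w := Complex wx wy in rP.
have key e : 0 < e -> e <= wx - a -> e <= b - wx -> e <= wy - c -> e <= d - wy -> 2 * e < r ->
    nrm (rectI q a b c d) <= 16 * (nrm (q w) + 1) * e.
  move=> e0 ea eb ec ed er.
  have G x1 x2 y1 y2 : a <= x1 -> x1 <= x2 -> x2 <= b -> c <= y1 -> y1 <= y2 -> y2 <= d ->
      ~~ (x1 <= wx <= x2) || ~~ (y1 <= wy <= y2) -> rectI q x1 x2 y1 y2 = 0.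
    move=> ax x12 xb cy y12 yd out; apply: goursat => // x y /andP[xx1 xx2] /andP[yy1 yy2].
    apply: dq => /=.
    - apply/eqP => -[Ex Ey]; move: out; rewrite -Ex -Ey xx1 xx2 yy1 yy2.
      by [].
    - by rewrite (le_trans ax xx1) (le_trans xx2 xb).
    - by rewrite (le_trans cy yy1) (le_trans yy2 yd).
  have -> : rectI q a b c d = rectI q (wx - e) (wx + e) (wy - e) (wy + e).
    rewrite (@rectI_splitx _ q a (wx - e) b)//; [|lra|lra].
    rewrite (@rectI_splitx _ q (wx - e) (wx + e) b)//; [|lra|lra].
    rewrite (@rectI_splity _ q (wx - e) (wx + e) c (wy - e) d)//; [|lra|lra].
    rewrite (@rectI_splity _ q (wx - e) (wx + e) (wy - e) (wy + e) d)//; [|lra|lra].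
    rewrite (G a (wx - e)) ?lexx//; [|lra|lra|lra|by apply/orP; left; rewrite negb_and -!ltNge; apply/orP; right; lra].
    rewrite (G (wx + e) b) ?lexx//; [|lra|lra|lra|by apply/orP; left; rewrite negb_and -!ltNge; apply/orP; left; lra].
    rewrite (G (wx - e) (wx + e) c) ?lexx//; [|lra|lra|lra|lra|lra|by apply/orP; right; rewrite negb_and -!ltNge; apply/orP; right; lra].
    rewrite (G (wx - e) (wx + e) (wy + e) d) ?lexx//; [|lra|lra|lra|lra|lra|by apply/orP; right; rewrite negb_and -!ltNge; apply/orP; left; lra].
    by ring.
  apply: le_trans (rectI_bound (M := nrm (q w) + 1) cq _ _ _) _; [lra|lra| |].
    move=> x y /andP[x1 x2] /andP[y1 y2].
    have h : nrm (Complex x y - w) < r.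
      rewrite (le_lt_trans (nrm_le_ReIm _))//= (le_lt_trans _ er)// mulr_natl mulr2n.
      by rewrite lerD// ler_norml; apply/andP; split; lra.
    have := rP _ h; have := nrmD (q (Complex x y) - q w) (q w).
    by rewrite subrK; lra.
  by rewrite le_eqVlt; apply/orP; left; apply/eqP; ring.
apply/eqP; rewrite -nrm_eq0 eq_le nrm_ge0 andbT leNgt; apply/negP => I0.
set I := nrm _ in I0 key.
set B := nrm (q w) + 1 in key.
have B0 : 0 < B by rewrite ltr_wpDl// nrm_ge0.
(* The four distances keep the small square inside the rectangle, [r / 3] keeps it where [nrm (q z)]
   is at most [B], and [I / (32 * B)] brings the estimate [16 * B * e] down to half of [I]. *)
pose e := Num.min (Num.min (Num.min (wx - a) (b - wx)) (Num.min (wy - c) (d - wy)))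
   (Num.min (r / 3) (I / (32 * B))).
have e0 : 0 < e.
  rewrite !lt_min !subr_gt0 aw wb cw wd divr_gt0//= divr_gt0//.
  by rewrite mulr_gt0.
have h1 : e <= Num.min (Num.min (wx - a) (b - wx)) (Num.min (wy - c) (d - wy)).
  by rewrite ge_min lexx.
have h2 : e <= Num.min (r / 3) (I / (32 * B)) by rewrite ge_min lexx orbT.
move: h1 h2; rewrite !le_min => /andP[/andP[k1 k2] /andP[k3 k4]] /andP[k5 k6].
have er : 2 * e < r by lra.
have := key e e0 k1 k2 k3 k4 er.
have : e * (32 * B) <= I by rewrite -ler_pdivlMr// mulr_gt0.
lra.
Qed.

End Goursat.

(** * Cauchy's formula on a rectangle *)

Section CauchyFormula.
Context {R : realType}.
Local Notation C := (R[i]^o).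
Implicit Types (f g : C -> C) (a b c d r : R) (z w p v : C).

Definition cauchyI f a b c d w : C := rectI (fun z => f z / (z - w)) a b c d.

Lemma nbhs_neq z w : z != w -> \forall y \near z, y != w.
Proof.
move=> zw; apply/nbhs_nrmP; exists (nrm (z - w)); first by rewrite nrm_gt0 subr_eq0.
by move=> y; apply: contraTneq => ->; rewrite nrm_distC ltxx.
Qed.

Lemma div_line_continuous (phi : R -> C) p v w : continuous phi ->
  (forall t, line p v t != w) ->
  continuous (fun t => phi t / (line p v t - w) : C).
Proof.
move=> cphi pw t; apply: (@continuousM_C _ _ phi (fun t => (line p v t - w)^-1)); first exact: cphi.
apply: (@continuousV_C _ _ (fun t => line p v t - w)); first by rewrite subr_eq0.
apply: (@continuousD_C _ _ (line p v) (fun=> - w)); first exact: line_continuous.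
exact: continuous_cst_C.
Qed.

Lemma continuousZD_C (T : topologicalType) (k : C) (g h : T -> C) :
  continuous g -> continuous h -> continuous (fun t => k * g t + h t : C).
Proof.
move=> cg ch t; apply: (@continuousD_C _ _ (fun t => k * g t) h); last exact: ch.
apply: (@continuousM_C _ _ (fun=> k) g); last exact: cg.
exact: continuous_cst_C.
Qed.

(** The Cauchy kernel is discontinuous at its pole, so linearity is stated under continuity along
    the line of integration. *)
Lemma lint_linear_on_line f g h (k : C) p v a b : a <= b ->
  continuous (fun t => f (line p v t)) -> continuous (fun t => g (line p v t)) ->
  continuous (fun t => h (line p v t)) ->
  (forall t, h (line p v t) = k * f (line p v t) + g (line p v t)) ->
  lint h p v a b = k * lint f p v a b + lint g p v a b.
Proof.
move=> ab cf cg ch hE; rewrite !lintE mulrCA -mulrDr.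
rewrite -(intC_lin cf cg ab (continuousZD_C (k := k) cf cg)).
congr (_ * _).
exact: (intC_eq ch (continuousZD_C (k := k) cf cg) ab (fun t _ => hE t)).
Qed.

Lemma divided_difference_continuous f w l : continuous f -> cder f w l ->
  continuous (fun z => if z == w then l else (f z - f w) / (z - w) : C).
Proof.
move=> cf fl; set q : C -> C := fun z => _; move=> z.
have [->|zw] := eqVneq z w.
  apply/ccont_nrmP => e e0; have [_ /(_ _ (divr_gt0 e0 (ltr0n _ 2))) [r r0 rP]] := fl.
  exists r => // y yr; rewrite {2}/q eqxx /q; case: eqVneq => [_|yw].
    by rewrite subrr nrm0.
  have y0 : 0 < nrm (y - w) by rewrite nrm_gt0 subr_eq0.
  have := rP _ yr; rewrite [w + _]addrC subrK => h.
  have -> : (f y - f w) / (y - w) - l = (f y - f w - (y - w) * l) / (y - w).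
    by field; rewrite subr_eq0.
  rewrite nrmM nrmV ltr_pdivrMr//; apply: le_lt_trans h _.
  by rewrite ltr_pM2r// ltr_pdivrMr// ltr_pMr// ltr1n.
have h : {for z, continuous (fun y => (f y - f w) / (y - w) : C)}.
  apply: (@continuousM_C _ _ (fun y => f y - f w) (fun y => (y - w)^-1)).
    by apply: (@continuousD_C _ _ f (fun=> - f w)); [exact: cf|exact: continuous_cst_C].
  apply: (@continuousV_C _ _ (fun y => y - w)); first by rewrite subr_eq0.
  by apply: (@continuousD_C _ _ id (fun=> - w)); [exact: cvg_id|exact: continuous_cst_C].
apply/cont_nrmP => e e0; move/cont_nrmP : h => /(_ e e0).
apply: filterS2 (nbhs_neq zw) => y yw.
by rewrite /q (negbTE zw) (negbTE yw).
Qed.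

(** The divided difference of [f] at [w], completed by the derivative, is continuous, and
    differentiable in the rectangle off [w], so its contour integral vanishes; on the sides, which
    avoid [w], it splits into the two kernels. *)
Lemma cauchy_rect f a b c d wx wy : continuous f -> a < wx < b -> c < wy < d ->
  (forall x y, a <= x <= b -> c <= y <= d -> exists l, cder f (Complex x y) l) ->
  cauchyI f a b c d (Complex wx wy) =
  f (Complex wx wy) * cauchyI (fun=> 1) a b c d (Complex wx wy).
Proof.
move=> cf awb cwd df; have [aw wb] := andP awb; have [cw wd] := andP cwd.
have awb' : a <= wx <= b by rewrite !ltW.
have cwd' : c <= wy <= d by rewrite !ltW.
have [w wE] : exists w, w = Complex wx wy by exists (Complex wx wy).
have [l fl] := df _ _ awb' cwd'; rewrite -wE in fl *.
pose q z := if z == w then l else (f z - f w) / (z - w).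
have cq : continuous q by exact: divided_difference_continuous.
have q0 : rectI q a b c d = 0.
  apply: (@goursat_punctured R q a b c d wx wy) => // z; rewrite -wE => zw za zc.
  have [m fm] : exists m, cder f z m by case: z {zw} za zc => x y /=; exact: df.
  exists ((m - 0) * (z - w)^-1 + (f z - f w) * (- (1 - 0) / (z - w) ^+ 2)).
  apply: (@cder_near _ (fun y => (f y - f w) / (y - w))).
    by apply: filterS (nbhs_neq zw) => y yw; rewrite /q (negbTE yw).
  apply: (@cderM _ (fun y => f y - f w) (fun y => (y - w)^-1)).
    by apply: cderB => //; exact: cder_cst.
  apply: (@cderV _ (fun y => y - w)); first by rewrite subr_eq0.
  by apply: (@cderB _ id (fun=> w)); [exact: cder_id|exact: cder_cst].
have lq p v x y : x <= y -> (forall t, line p v t != w) ->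
    lint q p v x y = (- f w) * lint (fun z => 1 / (z - w)) p v x y + lint (fun z => f z / (z - w)) p v x y.
  move=> xy pw; apply: lint_linear_on_line => //.
  - by apply: (@div_line_continuous (fun=> 1)) => // t; exact: continuous_cst_C.
  - by apply: (@div_line_continuous (fun t => f (line p v t))) => //; exact: comp_line_continuous.
  - exact: comp_line_continuous.
  - by move=> t; rewrite /q (negbTE (pw t)) mulrBl addrC div1r mulNr.
have nh y : y != wy -> forall t, line (Complex 0 y) 1 t != w.
  by move=> yw t; rewrite line1 wE; apply: contra_neq yw => -[].
have nv x : x != wx -> forall t, line (Complex x 0) 'i%C t != w.
  by move=> yw t; rewrite linei wE; apply: contra_neq yw => -[].
have ab : a <= b by exact: ltW (lt_trans aw wb).
have cd : c <= d by exact: ltW (lt_trans cw wd).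
have cwn : c != wy by rewrite lt_eqF.
have dwn : d != wy by rewrite gt_eqF.
have awn : a != wx by rewrite lt_eqF.
have bwn : b != wx by rewrite gt_eqF.
move: q0; rewrite /cauchyI rectIE (lq _ _ _ _ ab (nh _ cwn)) (lq _ _ _ _ ab (nh _ dwn)).
rewrite (lq _ _ _ _ cd (nv _ awn)) (lq _ _ _ _ cd (nv _ bwn)) !rectIE.
move: (lint _ (Complex 0 c) _ _ _) (lint _ (Complex 0 d) _ _ _) (lint _ (Complex a 0) _ _ _)
  (lint _ (Complex b 0) _ _ _) => A1 A2 A3 A4.
move: (lint _ (Complex 0 c) _ _ _) (lint _ (Complex 0 d) _ _ _) (lint _ (Complex a 0) _ _ _)
  (lint _ (Complex b 0) _ _ _) => B1 B2 B3 B4 h.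
by apply/eqP; rewrite -subr_eq0 -h; apply/eqP; ring.
Qed.

(** Serves for lower bounds: the real mean value theorem, applied to the imaginary part alone, turns
    an integral into a value of the integrand. *)
Lemma intC_Im_mvt (g : R -> C) a b : continuous g -> a <= b ->
  exists2 t, a <= t <= b & complex.Im (intC g a b) = complex.Im (g t) * (b - a).
Proof.
move=> cg ab; have [G dG ->//] := intC_antider cg ab.
have := @MVT_segment R (fun s => complex.Im (G s)) (fun s => complex.Im (g s)) a b ab.
case.
- move=> x; rewrite in_itv /= => /andP[/ltW ax _].
  by have [_ ] := (tderP G x (g x)).1 (dG x ax).
- apply: derivable_within_continuous => x; rewrite in_itv /= => /andP[ax _].
  by have [_ []] := (tderP G x (g x)).1 (dG x ax).
move=> t; rewrite in_itv /= => tab E; exists t => //; rewrite -E.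
by case: (G b) (G a) => [? ?] [? ?].
Qed.

Lemma intCZ (k : C) (g : R -> C) a b : continuous g -> a <= b ->
  continuous (fun t => k * g t : C) -> intC (fun t => k * g t) a b = k * intC g a b.
Proof.
move=> cg ab ckg; have [G dG ->//] := intC_antider cg ab.
rewrite (@intC_FTC _ _ (fun t => k * G t))//; first by rewrite mulrBr.
by move=> t /andP[at_ _]; apply: tder_scale; exact: dG.
Qed.

Lemma lint_Im_mvt f p v a b : continuous (fun t => f (line p v t)) -> a <= b ->
  exists2 t, a <= t <= b &
    complex.Im (lint f p v a b) = complex.Im (v * f (line p v t)) * (b - a).
Proof.
move=> cf ab.
have cvf : continuous (fun t => v * f (line p v t) : C).
  move=> t; apply: (@continuousM_C _ _ (fun=> v)); last exact: cf.
  exact: continuous_cst_C.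
by rewrite lintE -(intCZ cf ab cvf); exact: intC_Im_mvt.
Qed.

(* Each side of the square contributes at least 1 to the imaginary part, so
   the value [2 * pi * i] is not needed. *)
Lemma cauchyI1_Im x y r : 0 < r ->
  4 <= complex.Im (cauchyI (fun=> 1) (x - r) (x + r) (y - r) (y + r) (Complex x y)).
Proof.
move=> r0.
have ImD (u v : C) : complex.Im (u + v) = complex.Im u + complex.Im v by case: u v => [? ?] [? ?].
have ImN (u : C) : complex.Im (- u) = - complex.Im u by case: u => [? ?].
(* On a side at distance [r] the relevant part of the kernel is, up to sign, [r / (s^2 + r^2)] with
   [|s| <= r]. It is thus at least [1 / (2 r)], over a length [2 r]. *)
have side s : - r <= s <= r -> 1 <= r / (s ^+ 2 + r ^+ 2) * (2 * r).
  move=> /andP[s1 s2].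
  have s2r : s ^+ 2 <= r ^+ 2 by nra.
  have sr : 0 < s ^+ 2 + r ^+ 2 by rewrite ltr_wpDl ?sqr_ge0// exprn_gt0.
  rewrite mulrAC ler_pdivlMr// mul1r.
  by rewrite (_ : r * (2 * r) = r ^+ 2 + r ^+ 2); [rewrite lerD2r|ring].
have uu u : u - r <= u + r by lra.
have ur u : u + r - (u - r) = 2 * r by ring.
have tu t u : u - r <= t <= u + r -> - r <= t - u <= r.
  by move=> /andP[t1 t2]; apply/andP; split; lra.
have cl p v : (forall t, line p v t != Complex x y) ->
    continuous (fun t => 1 / (line p v t - Complex x y) : C).
  by apply: (@div_line_continuous (fun=> 1)) => t; exact: continuous_cst_C.
have nr0 : y - r <> y by lra.
have nr1 : y + r <> y by lra.
have nr2 : x - r <> x by lra.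
have nr3 : x + r <> x by lra.
have nh yy : yy <> y -> forall t, line (Complex 0 yy) 1 t != Complex x y.
  by move=> yw t; rewrite line1; apply/eqP => -[_].
have nv xx : xx <> x -> forall t, line (Complex xx 0) 'i%C t != Complex x y.
  by move=> yw t; rewrite linei; apply/eqP => -[].
pose F (z : C) : C := 1 / (z - Complex x y).
have sh yy (h : yy <> y) := @lint_Im_mvt F (Complex 0 yy) 1 _ _ (cl _ _ (nh yy h)) (uu x).
have sv xx (h : xx <> x) := @lint_Im_mvt F (Complex xx 0) 'i%C _ _ (cl _ _ (nv xx h)) (uu y).
have ImV (a b : R) : complex.Im (Complex a b)^-1 = - b / (a ^+ 2 + b ^+ 2) by rewrite mulNr.
have ReV (a b : R) : complex.Re (Complex a b)^-1 = a / (a ^+ 2 + b ^+ 2) by [].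
have BC (a b a' b' : R) : Complex a b - Complex a' b' = Complex (a - a') (b - b') by [].
have yr0 : y - r - y = - r by ring.
have yr1 : y + r - y = r by ring.
have xr0 : x - r - x = - r by ring.
have xr1 : x + r - x = r by ring.
have h1 : 1 <= complex.Im (lint F (Complex 0 (y - r)) 1 (x - r) (x + r)).
  have [t /tu/side tr ->] := sh _ nr0.
  by rewrite (le_trans tr)// /F line1 mul1r div1r ur BC ImV yr0 opprK sqrrN.
have h2 : 1 <= - complex.Im (lint F (Complex 0 (y + r)) 1 (x - r) (x + r)).
  have [t /tu/side tr ->] := sh _ nr1.
  by rewrite (le_trans tr)// /F line1 mul1r div1r ur BC ImV yr1 !mulNr opprK.
have iIm (k : R[i]) : complex.Im ('i%C * k) = complex.Re k.
  by case: k => a b /=; rewrite mul0r add0r mul1r.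
have h3 : 1 <= complex.Im (lint F (Complex (x + r) 0) 'i%C (y - r) (y + r)).
  have [t /tu/side tr ->] := sv _ nr3.
  by rewrite (le_trans tr)// /F linei iIm div1r ur BC ReV xr1 [r ^+ 2 + _]addrC.
have h4 : 1 <= - complex.Im (lint F (Complex (x - r) 0) 'i%C (y - r) (y + r)).
  have [t /tu/side tr ->] := sv _ nr2.
  by rewrite (le_trans tr)// /F linei iIm div1r ur BC ReV xr0 sqrrN [r ^+ 2 + _]addrC !mulNr opprK.
rewrite /cauchyI rectIE !ImD !ImN; move: h1 h2 h3 h4.
move: (complex.Im _) (complex.Im _) (complex.Im _) (complex.Im _) => i1 i2 i3 i4.
by clear; lra.
Qed.

End CauchyFormula.

(** * Differentiation of Cauchy integrals *)

Section CauchyTypeIntegrals.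
Context {R : realType}.
Local Notation C := (R[i]^o).
Implicit Types (f g : C -> C) (phi : R -> C) (a b c d r : R) (z w p v u h : C).

Lemma lineB_continuous p v w : continuous (fun t => line p v t - w : C).
Proof.
move=> t; apply: (@continuousD_C _ _ (line p v) (fun=> - w)); first exact: line_continuous.
exact: continuous_cst_C.
Qed.

Lemma continuousX_C (T : topologicalType) (f : T -> C) n :
  continuous f -> continuous (fun t => f t ^+ n : C).
Proof.
move=> cf; elim: n => [|n ih] t.
  have -> : (fun t => f t ^+ 0 : C) = (fun=> 1) by apply/funext => s; rewrite expr0.
  exact: continuous_cst_C.
have -> : (fun t => f t ^+ n.+1 : C) = (fun t => f t * f t ^+ n) by apply/funext => s; rewrite exprS.
by apply: (@continuousM_C _ _ f (fun t => f t ^+ n)); [exact: cf|exact: ih].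
Qed.

Lemma cauchy_kernel_continuous phi p v w n : continuous phi ->
  (forall t, line p v t != w) ->
  continuous (fun t => phi t * (line p v t - w)^-1 ^+ n : C).
Proof.
move=> cphi pw t.
apply: (@continuousM_C _ _ phi (fun t => (line p v t - w)^-1 ^+ n)); first exact: cphi.
apply: (@continuousX_C _ (fun t => (line p v t - w)^-1)) => s.
apply: (@continuousV_C _ _ (fun t => line p v t - w)); first by rewrite subr_eq0.
exact: lineB_continuous.
Qed.

Lemma continuous_bounded phi a b : a <= b -> continuous phi ->
  exists2 M, 0 <= M & forall t, a <= t <= b -> nrm (phi t) <= M.
Proof.
move=> ab cphi.
have cn : continuous (fun t => nrm (phi t)).
  move=> t; apply/cvgrPdist_lt => e e0.
  have /rcont_nrmP/(_ e e0) [d d0 dP] := cphi t.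
  apply/nbhs_ballP; exists d => // s; rewrite /ball /= distrC => /dP.
  apply: le_lt_trans; rewrite ler_norml.
  have := nrmD (phi t - phi s) (phi s); have := nrmD (phi s - phi t) (phi t).
  rewrite !subrK (nrm_distC (phi t)).
  move: (nrm (phi t)) (nrm (phi s)) (nrm _) => x y q h1 h2.
  by apply/andP; split; move: h1 h2; clear; lra.
have [t tab tP] := EVT_max ab (continuous_subspaceT cn).
exists (nrm (phi t)); first exact: nrm_ge0.
by move=> s sab; apply: tP; rewrite in_itv.
Qed.

Lemma inv_far u h (dl : R) : 0 < dl -> dl <= nrm u -> nrm h <= dl / 2 ->
  [/\ u != 0, u - h != 0, nrm u^-1 <= dl^-1 & nrm (u - h)^-1 <= 2 / dl].
Proof.
move=> d0 du hd.
have uh : dl / 2 <= nrm (u - h).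
  have := nrmD (u - h) h; rewrite subrK; move: du hd.
  by move: (nrm u) (nrm h) (nrm _) => x y q; clear; lra.
have u0 : u != 0 by rewrite -nrm_gt0 (lt_le_trans d0).
have uh0 : u - h != 0 by rewrite -nrm_gt0 (lt_le_trans _ uh)// divr_gt0.
split=> //; rewrite nrmV; first by rewrite lef_pV2 ?posrE ?nrm_gt0.
by rewrite -[2 / dl]invf_div lef_pV2 ?posrE ?nrm_gt0// divr_gt0.
Qed.

(* [1/(u-h) - 1/u - h/u^2 = h^2 / (u^2 (u-h))], and similarly for squares. *)
Lemma cauchy_kernel_est n (dl : R) : (n == 1)%N || (n == 2)%N -> 0 < dl ->
  exists2 B, 0 <= B & forall u h, dl <= nrm u -> nrm h <= dl / 2 ->
    nrm ((u - h)^-1 ^+ n - u^-1 ^+ n - h * (n%:R * u^-1 ^+ n.+1)) <= B * nrm h ^+ 2.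
Proof.
move=> /orP[/eqP->|/eqP->] d0.
  exists (dl^-1 ^+ 2 * (2 / dl)).
    by rewrite mulr_ge0// ?divr_ge0 ?exprn_ge0 ?invr_ge0// ltW.
  move=> u h du hd; have [u0 uh0 un uhn] := inv_far d0 du hd.
  rewrite (_ : _ - _ - _ = u^-1 ^+ 2 * (u - h)^-1 * h ^+ 2); last first.
    by field; rewrite u0 uh0.
  rewrite nrmM nrmX ler_wpM2r ?sqr_ge0// nrmM nrmX.
  apply: ler_pM => //; rewrite ?exprn_ge0 ?nrm_ge0//.
  by rewrite lerXn2r ?nnegrE ?nrm_ge0// invr_ge0 ltW.
exists (3 * (dl^-1 ^+ 2 * (2 / dl) ^+ 2) + 2 * (dl^-1 ^+ 3 * (2 / dl))).
  by rewrite addr_ge0// !mulr_ge0// ?divr_ge0 ?exprn_ge0 ?divr_ge0 ?invr_ge0// ltW.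
move=> u h du hd; have [u0 uh0 un uhn] := inv_far d0 du hd.
rewrite (_ : _ - _ - _ = ((u^-1 ^+ 2 * (u - h)^-1 ^+ 2) + (u^-1 ^+ 3 * (u - h)^-1) *+ 2) * h ^+ 2); last first.
  by field; rewrite u0 uh0.
rewrite nrmM nrmX ler_wpM2r ?sqr_ge0// (le_trans (nrmD _ _))//.
have k n1 n2 : nrm (u^-1 ^+ n1 * (u - h)^-1 ^+ n2) <= dl^-1 ^+ n1 * (2 / dl) ^+ n2.
  rewrite nrmM !nrmX; apply: ler_pM; rewrite ?exprn_ge0 ?nrm_ge0//.
    by rewrite lerXn2r ?nnegrE ?nrm_ge0// invr_ge0 ltW.
  by rewrite lerXn2r ?nnegrE ?nrm_ge0// divr_ge0// ltW.
apply: lerD.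
  have := k 2%N 2%N => /le_trans; apply; rewrite ler_peMl ?ler1n//.
  by rewrite mulr_ge0// exprn_ge0// ?invr_ge0 ?divr_ge0// ltW.
rewrite mulr2n mulr_natl mulr2n (le_trans (nrmD _ _))//.
by have := k 3%N 1%N; rewrite !expr1 => h1; apply: lerD.
Qed.

(** Differentiation under the integral sign: the quadratic kernel estimate times a bound of [phi] is
    integrated. The distance [dl] is kept along the whole line so that the kernels are continuous on
    all of [R]. The exponents 1 and 2 give the derivatives of the first two orders. *)
Lemma cder_cauchy_type phi p v a b w (dl : R) n : (n == 1)%N || (n == 2)%N ->
  a <= b -> continuous phi -> 0 < dl -> (forall t, dl <= nrm (line p v t - w)) ->
  cder (fun w => intC (fun t => phi t * (line p v t - w)^-1 ^+ n) a b) w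
    (n%:R * intC (fun t => phi t * (line p v t - w)^-1 ^+ n.+1) a b).
Proof.
move=> n12 ab cphi d0 far.
have [B B0 BP] := cauchy_kernel_est n12 d0.
have [M M0 MP] := continuous_bounded ab cphi.
have far' h : nrm h <= dl / 2 -> forall t, line p v t != w + h.
  move=> hd t; have [_ H _ _] := inv_far d0 (far t) hd.
  by rewrite -subr_eq0 opprD addrA.
have farw : forall t, line p v t != w.
  by move=> t; rewrite -subr_eq0 -nrm_gt0 (lt_le_trans d0).
split.
  exists (nrm (n%:R * intC (fun t => phi t * (line p v t - w)^-1 ^+ n.+1) a b)).
    exact: nrm_ge0.
  by move=> h; rewrite nrmM mulrC.
move=> e e0.
have Q0 : 0 < 2 * (M * B) * (b - a) + 1.
  by rewrite ltr_wpDl// !mulr_ge0// subr_ge0.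
exists (Num.min (dl / 2) (e / (2 * (M * B) * (b - a) + 1))).
  by rewrite lt_min !divr_gt0.
move=> h; rewrite lt_min => /andP[/ltW h1 h2].
have c0 := cauchy_kernel_continuous (n := n) cphi farw.
have c1 := cauchy_kernel_continuous (n := n) cphi (far' _ h1).
have c2 := cauchy_kernel_continuous (n := n.+1) cphi farw.
have c3 := continuousZD_C (k := -1) c0 c1.
have c4 := continuousZD_C (k := - (h * n%:R)) c2 c3.
rewrite (_ : _ - _ - _ = intC (fun t => - (h * n%:R) * (phi t * (line p v t - w)^-1 ^+ n.+1) +
    (-1 * (phi t * (line p v t - w)^-1 ^+ n) + phi t * (line p v t - (w + h))^-1 ^+ n)) a b); last first.
  rewrite (intC_lin c2 c3 ab c4) (intC_lin c0 c1 ab c3).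
  by move: (intC _ _ _) (intC _ _ _) (intC _ _ _) => i1 i2 i3; ring.
apply: (@le_trans _ _ (2 * (M * (B * nrm h ^+ 2)) * (b - a))).
  apply: intC_bound => // t tab.
  rewrite (_ : line p v t - (w + h) = line p v t - w - h); last by rewrite opprD addrA.
  rewrite (_ : _ + _ = phi t * ((line p v t - w - h)^-1 ^+ n - (line p v t - w)^-1 ^+ n
     - h * (n%:R * (line p v t - w)^-1 ^+ n.+1))); last by ring.
  rewrite nrmM; apply: ler_pM; rewrite ?nrm_ge0//; first exact: MP.
  exact: BP.
rewrite (_ : 2 * (M * (B * nrm h ^+ 2)) * (b - a) = 2 * (M * B) * (b - a) * nrm h * nrm h); last by ring.
rewrite ler_wpM2r ?nrm_ge0//; rewrite ltr_pdivlMr// in h2.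
apply: le_trans (ltW h2); rewrite mulrC ler_wpM2l ?nrm_ge0//.
by rewrite lerDl.
Qed.

Definition cauchyIn n f a b c d w : C :=
  rectI (fun z => f z * (z - w)^-1 ^+ n) a b c d.

Lemma cauchyI_1 f a b c d w : cauchyI f a b c d w = cauchyIn 1 f a b c d w.
Proof. by rewrite /cauchyIn; congr rectI; apply/funext => z; rewrite expr1. Qed.

Lemma cder_cauchyIn n f a b c d wx wy : (n == 1)%N || (n == 2)%N -> continuous f ->
  a < wx < b -> c < wy < d ->
  cder (cauchyIn n f a b c d) (Complex wx wy)
    (n%:R * cauchyIn n.+1 f a b c d (Complex wx wy)).
Proof.
move=> n12 cf /andP[aw wb] /andP[cw wd].
have ab : a <= b by exact: ltW (lt_trans aw wb).
have cd : c <= d by exact: ltW (lt_trans cw wd).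
have key p v x y (dl : R) : x <= y -> 0 < dl ->
    (forall t, dl <= nrm (line p v t - Complex wx wy)) ->
  cder (fun w => lint (fun z => f z * (z - w)^-1 ^+ n) p v x y) (Complex wx wy)
    (n%:R * lint (fun z => f z * (z - Complex wx wy)^-1 ^+ n.+1) p v x y).
  move=> xy d0 far.
  have := cder_cauchy_type n12 xy (comp_line_continuous (p := p) (v := v) cf) d0 far.
  move/(cderZ v)/cder_eq => h.
  have -> : (fun w => lint (fun z => f z * (z - w)^-1 ^+ n) p v x y) =
     (fun w => v * intC (fun t => f (line p v t) * (line p v t - w)^-1 ^+ n) x y).
    by apply/funext => w; rewrite lintE.
  by apply: h; rewrite lintE mulrCA.
have nh y : y - wy != 0 -> forall t, `|y - wy| <= nrm (line (Complex 0 y) 1 t - Complex wx wy).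
  by move=> _ t; rewrite line1; exact: (Im_le_nrm (Complex t y - Complex wx wy)).
have nv x : x - wx != 0 -> forall t, `|x - wx| <= nrm (line (Complex x 0) 'i%C t - Complex wx wy).
  by move=> _ t; rewrite linei; exact: (Re_le_nrm (Complex x t - Complex wx wy)).
have c0 : c - wy != 0 by rewrite subr_eq0 lt_eqF.
have d0 : d - wy != 0 by rewrite subr_eq0 gt_eqF.
have a0 : a - wx != 0 by rewrite subr_eq0 lt_eqF.
have b0 : b - wx != 0 by rewrite subr_eq0 gt_eqF.
have np (x : R) : x != 0 -> 0 < `|x| by rewrite normr_gt0.
have k1 := key _ _ _ _ _ ab (np _ c0) (nh _ c0).
have k2 := key _ _ _ _ _ ab (np _ d0) (nh _ d0).
have k3 := key _ _ _ _ _ cd (np _ b0) (nv _ b0).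
have k4 := key _ _ _ _ _ cd (np _ a0) (nv _ a0).
have := cderD (cderB k1 k2) (cderB k3 k4).
have -> : cauchyIn n f a b c d = fun w =>
  lint (fun z => f z * (z - w)^-1 ^+ n) (Complex 0 c) 1 a b
  - lint (fun z => f z * (z - w)^-1 ^+ n) (Complex 0 d) 1 a b
  + (lint (fun z => f z * (z - w)^-1 ^+ n) (Complex b 0) 'i%C c d
  - lint (fun z => f z * (z - w)^-1 ^+ n) (Complex a 0) 'i%C c d).
  by apply/funext => w; rewrite /cauchyIn rectIE.
move/cder_eq; apply; rewrite /cauchyIn rectIE.
by rewrite -!mulrBr -mulrDr.
Qed.

End CauchyTypeIntegrals.

(** * Regularity of holomorphic functions and Liouville's theorem *)

Section Regularity.
Context {R : realType}.
Local Notation C := (R[i]^o).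
Implicit Types (f g : C -> C) (a b c d r : R) (z w p v u h : C).

Definition clamp (lo hi x : R) : R := Num.max lo (Num.min hi x).

Lemma clamp_lip lo hi s t : `|clamp lo hi s - clamp lo hi t| <= `|s - t|.
Proof.
rewrite /clamp; wlog st : s t / s <= t.
  move=> h; have [/h//|/ltW/h] := leP s t.
  by rewrite distrC [leRHS]distrC.
rewrite (distrC s) (distrC (Num.max _ _)) (ger0_norm (_ : 0 <= t - s)) ?subr_ge0//.
rewrite ler_norml; case: (leP hi s); case: (leP hi t) => h1 h2;
  repeat match goal with |- context[Num.max ?a ?b] => case: (leP a b) => ? end;
  by apply/andP; split; lra.
Qed.

Lemma clamp_id lo hi s : lo <= s <= hi -> clamp lo hi s = s.
Proof. by move=> /andP[h1 h2]; rewrite /clamp min_r// max_r. Qed.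

Lemma clamp_in lo hi s : lo <= hi -> lo <= clamp lo hi s <= hi.
Proof. by move=> h; rewrite /clamp le_max lexx /= ge_max h ge_min lexx. Qed.

(** A retraction onto the square of half-side [r]: composed with it, a function known near the
    square becomes continuous on the whole plane, as the integrals require. *)
Definition clampC x0 y0 r z : C :=
  Complex (clamp (x0 - r) (x0 + r) (complex.Re z)) (clamp (y0 - r) (y0 + r) (complex.Im z)).

Lemma clampC_continuous x0 y0 r : continuous (clampC x0 y0 r : C -> C).
Proof.
move=> z; apply/ccont_nrmP => e e0; exists (e / 2); first by rewrite divr_gt0.
move=> y yz; rewrite (le_lt_trans (nrm_le_ReIm _))// (splitr e) /clampC /= ltrD//.
  apply: le_lt_trans (clamp_lip _ _ _ _) _; apply: le_lt_trans yz.
  by apply: le_trans (Re_le_nrm _); case: y z => [? ?] [? ?].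
apply: le_lt_trans (clamp_lip _ _ _ _) _; apply: le_lt_trans yz.
by apply: le_trans (Im_le_nrm _); case: y z => [? ?] [? ?].
Qed.

Lemma square_dist x0 y0 x y r : x0 - r <= x <= x0 + r -> y0 - r <= y <= y0 + r ->
  nrm (Complex x y - Complex x0 y0) <= 2 * r.
Proof.
move=> /andP[x1 x2] /andP[y1 y2]; rewrite (le_trans (nrm_le_ReIm _))//= mulr_natl mulr2n.
by rewrite lerD// ler_norml; apply/andP; split; lra.
Qed.

(* Localisation: a function which is differentiable near a point agrees near
   this point with one to which the Cauchy formula on a square applies. *)
Lemma cauchy_local f x0 y0 (rho : R) : 0 < rho ->
  (forall z, nrm (z - Complex x0 y0) < rho -> exists l, cder f z l) ->
  exists2 r, 0 < r & exists2 g : C -> C, continuous g &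
   (forall x y, x0 - r < x < x0 + r -> y0 - r < y < y0 + r ->
      f (Complex x y) = g (Complex x y) /\
      cauchyI g (x0 - r) (x0 + r) (y0 - r) (y0 + r) (Complex x y) =
      g (Complex x y) * cauchyI (fun=> 1) (x0 - r) (x0 + r) (y0 - r) (y0 + r) (Complex x y)).
Proof.
(* Clamping is to the square of half-side [s = 2 * r], whose points are within [2 * s = rho / 2] of
   the centre; the formula is applied on the square of half-side [r], around which clamping changes
   nothing. *)
move=> rho0 df; exists (rho / 8); first by rewrite divr_gt0.
set r := rho / 8.
have r0 : 0 < r by rewrite divr_gt0.
have r4 : 2 * (2 * r) < rho.
  by rewrite /r; move: rho0; clear; lra.
pose s := 2 * r.
have lo x : x - s <= x + s by rewrite /s; move: r0; clear; lra.
exists (fun z => f (clampC x0 y0 s z)).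
  move=> z; apply: (continuous_comp_C (f := clampC x0 y0 s)).
    exact: clampC_continuous.
  have [l] := df (clampC x0 y0 s z) (le_lt_trans (square_dist (clamp_in _ (lo x0)) (clamp_in _ (lo y0))) r4).
  exact: cder_cont.
have fE x y : x0 - s <= x <= x0 + s -> y0 - s <= y <= y0 + s ->
    f (clampC x0 y0 s (Complex x y)) = f (Complex x y).
  by move=> hx hy; rewrite /clampC /= !clamp_id.
have rs (m x : R) : m - r <= x <= m + r -> m - s <= x <= m + s.
  by rewrite /s => /andP[h1 h2]; apply/andP; split; move: h1 h2 r0; clear; lra.
move=> x y hx hy.
have hx' : x0 - s <= x <= x0 + s by apply: rs; move/andP: hx => [h1 h2]; rewrite !ltW.
have hy' : y0 - s <= y <= y0 + s by apply: rs; move/andP: hy => [h1 h2]; rewrite !ltW.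
split; first by rewrite fE.
apply: cauchy_rect => //.
  move=> z; apply: (continuous_comp_C (f := clampC x0 y0 s)).
    exact: clampC_continuous.
  have [l] := df (clampC x0 y0 s z) (le_lt_trans (square_dist (clamp_in _ (lo x0)) (clamp_in _ (lo y0))) r4).
  exact: cder_cont.
move=> x' y' hx1 hy1.
have [l fl] := df (Complex x' y') (le_lt_trans (square_dist (rs _ _ hx1) (rs _ _ hy1)) r4).
exists l; apply: cder_near fl.
apply/nbhs_nrmP; exists r => // -[x2 y2] h.
rewrite fE//.
  have := le_lt_trans (Re_le_nrm _) h => /=; rewrite ltr_norml => /andP[k1 k2].
  by move/andP: hx1 => [k3 k4]; rewrite /s; apply/andP; split; move: k1 k2 k3 k4; clear; lra.
have := le_lt_trans (Im_le_nrm _) h => /=; rewrite ltr_norml => /andP[k1 k2].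
by move/andP: hy1 => [k3 k4]; rewrite /s; apply/andP; split; move: k1 k2 k3 k4; clear; lra.
Qed.

(** Near [z0] the function is a quotient [N 1 / K 1] of Cauchy integrals over a fixed square, with
    [K 1] nonzero by [cauchyI1_Im]. Both integrals have derivatives of the first two orders, and the
    quotient rule passes them on to [f]. *)
Theorem derivable_derive (U : set C) f : open U ->
  (forall z, U z -> derivable f z 1) -> forall z, U z -> derivable ('D_1 f) z 1.
Proof.
move=> oU df z0 Uz0; case: z0 Uz0 => x0 y0 Uz0.
have /open_nrmP/(_ _ Uz0) [rho rho0 rhoP] := oU.
have [|r r0 [g cg gP]] := @cauchy_local f x0 y0 rho rho0.
  by move=> z /rhoP /df /derivable_cder fz; exists ('D_1 f z).
pose a := x0 - r; pose b := x0 + r; pose c := y0 - r; pose d := y0 + r.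
pose N n := cauchyIn n g a b c d.
pose K n := cauchyIn n (fun=> 1) a b c d.
have dK n z : (n == 1)%N || (n == 2)%N -> a < complex.Re z < b -> c < complex.Im z < d ->
    cder (K n) z (n%:R * K n.+1 z).
  have c1 : continuous ((fun=> 1) : C -> C) by move=> t; exact: continuous_cst_C.
  by case: z => x y n12 /= hx hy; exact: (cder_cauchyIn n12 c1 hx hy).
have dN n z : (n == 1)%N || (n == 2)%N -> a < complex.Re z < b -> c < complex.Im z < d ->
    cder (N n) z (n%:R * N n.+1 z).
  by case: z => x y n12 /= hx hy; exact: (cder_cauchyIn n12 cg hx hy).
have x0ab : a < x0 < b by rewrite /a /b; apply/andP; split; move: r0; clear; lra.
have y0cd : c < y0 < d by rewrite /c /d; apply/andP; split; move: r0; clear; lra.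
have K0 : K 1%N (Complex x0 y0) != 0.
  apply/eqP => K0; have := cauchyI1_Im x0 y0 r0.
  by rewrite cauchyI_1 -/a -/b -/c -/d -/(K 1%N) K0 /=; clear; lra.
have sq : \forall z \near (Complex x0 y0 : C), a < complex.Re z < b /\ c < complex.Im z < d.
  apply/nbhs_nrmP; exists r => // -[x y] h.
  have := le_lt_trans (Re_le_nrm _) h; have := le_lt_trans (Im_le_nrm _) h => /=.
  rewrite !ltr_norml => /andP[k1 k2] /andP[k3 k4]; rewrite /a /b /c /d.
  by split; apply/andP; split; move: k1 k2 k3 k4; clear; lra.
have Knear : \forall z \near (Complex x0 y0 : C), K 1%N z != 0.
  have /cder_cont/ccont_nrmP/(_ (nrm (K 1%N (Complex x0 y0)))) := dK 1%N (Complex x0 y0) isT x0ab y0cd.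
  rewrite nrm_gt0 => /(_ K0) [e e0 eP]; apply/nbhs_nrmP; exists e => // y /eP.
  by apply: contraTneq => ->; rewrite sub0r nrmN ltxx.
have fE : \forall z \near (Complex x0 y0 : C), f z = N 1%N z / K 1%N z.
  apply: filterS2 sq Knear => -[x y] [hx hy] k0.
  have [-> h] := gP _ _ hx hy; apply: (canRL (mulfK k0)).
  by rewrite /N /K -!cauchyI_1.
pose G z := (1%:R * N 2%N z * (K 1%N z)^-1 + N 1%N z * (- (1%:R * K 2%N z) / K 1%N z ^+ 2)).
have dfE : \forall z \near (Complex x0 y0 : C), G z = 'D_1 f z.
  apply: filterS3 sq Knear (nbhs_interior fE) => z [hx hy] k0 fz.
  apply/esym/cder_derive; apply: (@cder_near _ (fun z => N 1%N z / K 1%N z)).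
    by apply: filterS fz => y ->.
  apply: (@cderM _ (N 1%N) (fun z => (K 1%N z)^-1)); first exact: dN.
  by apply: cderV => //; exact: dK.
suff [l Gl] : exists l, cder G (Complex x0 y0) l.
  exact: cder_derivable (cder_near dfE Gl).
have d1 := dN 1%N (Complex x0 y0) isT x0ab y0cd.
have d2 := dN 2%N (Complex x0 y0) isT x0ab y0cd.
have e1 := dK 1%N (Complex x0 y0) isT x0ab y0cd.
have e2 := dK 2%N (Complex x0 y0) isT x0ab y0cd.
have Ksq : K 1%N (Complex x0 y0) ^+ 2 != 0 by rewrite expf_neq0.
have t1 := cderM (cderZ 1%:R d2) (cderV K0 e1).
have t2 := cderM d1 (cderM (cderN (cderZ 1%:R e2)) (cderV (f := fun z => K 1%N z ^+ 2) Ksq (cderX 1 e1))).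
by eexists; exact: cderD t1 t2.
Qed.

Lemma small_nrm0 z (K : R) : 0 <= K -> (forall e, 0 < e -> nrm z <= K * e) -> z = 0.
Proof.
move=> K0 h; apply/eqP; rewrite -nrm_eq0 eq_le nrm_ge0 andbT leNgt; apply/negP => z0.
have K1 : 0 < 2 * (K + 1) by rewrite mulr_gt0// ltr_wpDl.
have := h _ (divr_gt0 z0 K1); apply/negP; rewrite -ltNge mulrA ltr_pdivrMr//.
rewrite mulrC ltr_pM2l//; move: K0; clear; lra.
Qed.

(* Cauchy's formula on large squares. *)
Theorem entire_vanishing f : (forall z, derivable f z 1) ->
  (forall e, 0 < e -> exists M : R, forall z, M < nrm z -> nrm (f z) <= e) ->
  forall z, f z = 0.
Proof.
move=> df f0 [x y]; apply: (@small_nrm0 _ 16) => // e /f0 [M MP].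
have cf : continuous f by move=> z; apply: cder_cont (derivable_cder (df z)).
(* Large enough that every point of the contour has modulus above [M]: it is at least
   [r - nrm (Complex x y) = |M| + 1]. *)
have [r rE] : exists r : R, r = `|M| + nrm (Complex x y) + 1 by eexists.
have r0 : 0 < r by rewrite rE ltr_wpDl// addr_ge0// nrm_ge0.
have xr : x - r < x < x + r by apply/andP; split; move: r0; clear; lra.
have yr : y - r < y < y + r by apply/andP; split; move: r0; clear; lra.
have h := cauchy_rect cf xr yr (fun x y _ _ => ex_intro _ _ (derivable_cder (df (Complex x y)))).
have I4 : 4 <= nrm (cauchyI (fun=> 1) (x - r) (x + r) (y - r) (y + r) (Complex x y)).
  apply: le_trans (cauchyI1_Im x y r0) _; apply: le_trans (Im_le_nrm _).
  exact: ler_norm.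
have side p v (u : R) : nrm v = 1 -> (forall t, r <= nrm (line p v t - Complex x y)) ->
    nrm (lint (fun z => f z / (z - Complex x y)) p v (u - r) (u + r)) <= 4 * e.
  move=> v1 far; rewrite lintE nrmM v1 mul1r.
  have pw t : line p v t != Complex x y.
    by rewrite -subr_eq0 -nrm_gt0 (lt_le_trans r0).
  have uu : u - r <= u + r by move: r0; clear; lra.
  have cg := div_line_continuous (comp_line_continuous (p := p) (v := v) cf) pw.
  (* The side has length [2 * r] and the integrand is at most [e / r]; the other factor 2 is that of
     [intC_bound]. *)
  have e4 : 4 * e = 2 * (e / r) * (u + r - (u - r)) by field; rewrite gt_eqF.
  rewrite e4; apply: intC_bound => // t _; rewrite nrmM nrmV.
  apply: ler_pM; rewrite ?nrm_ge0 ?invr_ge0 ?nrm_ge0//.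
    apply: MP; have := far t.
    have := nrmB (line p v t) (Complex x y).
    have := ler_norm M; rewrite [in r <= _]rE.
    move: (nrm (line p v t - _)) (nrm (line p v t)) (nrm (Complex x y)) `|M| => q1 q2 q3 q4.
    by clear; lra.
  by rewrite lef_pV2 ?posrE ?(lt_le_trans r0).
have far_h s : `|s - y| = r -> forall t, r <= nrm (line (Complex 0 s) 1 t - Complex x y).
  by move=> <- t; rewrite line1; exact: (Im_le_nrm (Complex t s - Complex x y)).
have far_v s : `|s - x| = r -> forall t, r <= nrm (line (Complex s 0) 'i%C t - Complex x y).
  by move=> <- t; rewrite linei; exact: (Re_le_nrm (Complex s t - Complex x y)).
have e1 (u : R) : `|u - r - u| = r by rewrite addrAC subrr add0r normrN ger0_norm ?ltW.
have e2 (u : R) : `|u + r - u| = r by rewrite [u + r]addrC addrK ger0_norm ?ltW.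
have I16 : nrm (cauchyI f (x - r) (x + r) (y - r) (y + r) (Complex x y)) <= 16 * e.
  rewrite /cauchyI rectIE.
  have s1 := side _ _ x (@nrm1 R) (far_h _ (e1 y)).
  have s2 := side _ _ x (@nrm1 R) (far_h _ (e2 y)).
  have s3 := side _ _ y (@nrm_i R) (far_v _ (e1 x)).
  have s4 := side _ _ y (@nrm_i R) (far_v _ (e2 x)).
  have -> : 16 * e = (4 * e + 4 * e) + (4 * e + 4 * e) by ring.
  by rewrite (le_trans (nrmD _ _))// lerD// (le_trans (nrmB _ _))// lerD.
apply: le_trans I16; rewrite h nrmM ler_peMr ?nrm_ge0//.
by apply: le_trans I4; rewrite ler1n.
Qed.

Lemma derivative_zero_cst f : (forall z, cder f z 0) -> forall z, f z = f 0.
Proof.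
move=> df z; apply/eqP; rewrite -subr_eq0 -nrm_eq0 eq_le nrm_ge0 andbT.
have -> : f z - f 0 = f (line 0 z 1) - f (line 0 z 0).
  by rewrite /line !add0r mul1r mul0r.
have := @tder_bound _ (fun s => f (line 0 z s)) (fun=> z * 0) 0 1 0 ler01.
rewrite [2 * 0]mulr0 mul0r; apply=> t _; first exact: tder_line.
by rewrite mulr0 nrm0.
Qed.

Lemma cder_power_sum n (a : nat -> C) z :
  cder (fun y => \sum_(j < n.+1) y ^+ j * a j) z
       (\sum_(j < n) z ^+ j * (j.+1%:R * a j.+1)).
Proof.
elim: n => [|n ih].
  rewrite big_ord0 (_ : (fun _ => _) = fun=> a 0%N); first exact: cder_cst.
  by apply/funext => y; rewrite big_ord1 expr0 mul1r.
rewrite big_ord_recr /= (_ : (fun _ => _) =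
    fun y => \sum_(j < n.+1) y ^+ j * a j + y ^+ n.+1 * a n.+1); last first.
  by apply/funext => y; rewrite big_ord_recr.
have := cderD ih (cderM (cderX n (cder_id z)) (cder_cst (a n.+1) z)).
by move/cder_eq; apply; congr (_ + _); ring.
Qed.

(* If [F] and [G w = w^(k+1) F(1/w)] are entire, then [F'] and
   [(k+1) G - w G'] are so related with [k] in place of [k+1]. *)
Theorem entire_polynomial k (F G : C -> C) :
  (forall z, derivable F z 1) -> (forall z, derivable G z 1) ->
  (forall w, w != 0 -> G w = w ^+ k * F w^-1) ->
  forall z, F z = \sum_(j < k.+1) z ^+ j * (j`!%:R^-1 * iter j (fun g => 'D_1 g) F 0).
Proof.
elim: k F G => [|k ih] F G dF dG FG z.
  (* Here [G w = F w^-1] off 0, so continuity of [G] at 0 says that [F - G 0] tends to 0 at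
     infinity, and the Liouville argument applies. *)
  have h : forall z, F z - G 0 = 0.
    apply: entire_vanishing => [y|e e0].
      exact: cder_derivable (cderB (derivable_cder (dF y)) (cder_cst (G 0) y)).
    have /ccont_nrmP/(_ e e0) [d d0 dP] := cder_cont (derivable_cder (dG 0)).
    exists d^-1 => y yd; have y0 : y != 0.
      by rewrite -nrm_gt0 (lt_trans _ yd)// invr_gt0.
    have := dP y^-1; rewrite subr0 nrmV FG ?invr_eq0// expr0 mul1r invrK => k; apply/ltW/k.
    by rewrite -[d]invrK ltf_pV2// posrE ?invr_gt0// nrm_gt0.
  have hh y : F y = G 0 by apply/eqP; rewrite -subr_eq0 h.
  by rewrite big_ord1 expr0 fact0 invr1 !mul1r /= !hh.
pose F' := 'D_1 F : C -> C.
have dF' y : derivable F' y 1 by apply: (@derivable_derive setT) => //; exact: openT.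
pose G1 w := k.+1%:R * G w - w * 'D_1 G w.
have dG1 y : derivable G1 y 1.
  have d2 := derivable_cder (@derivable_derive setT G openT (fun z _ => dG z) y I).
  exact: cder_derivable (cderB (cderZ k.+1%:R (derivable_cder (dG y))) (cderM (cder_id y) d2)).
have FG1 w : w != 0 -> G1 w = w ^+ k * F' w^-1.
  move=> w0; rewrite /G1 FG//.
  have -> : 'D_1 G w = k.+1%:R * w ^+ k * 1 * F w^-1 + w ^+ k.+1 * (F' w^-1 * (- 1 / w ^+ 2)).
    apply: cder_derive; apply: (@cder_near _ (fun y => y ^+ k.+1 * F y^-1)).
      by apply: filterS (nbhs_neq w0) => y y0; rewrite FG.
    apply: cderM; first exact: cderX (cder_id w).
    apply: (cder_comp (f := fun y => y^-1)); first exact: cderV (cder_id w).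
    exact: derivable_cder.
  by rewrite exprS; field.
pose a j : C := j`!%:R^-1 * iter j (fun g => 'D_1 g) F 0.
have F'E y : F' y = \sum_(j < k.+1) y ^+ j * (j.+1%:R * a j.+1).
  rewrite (ih F' G1 dF' dG1 FG1); apply: eq_bigr => j _; congr (_ * _).
  rewrite /a iterSr factS natrM invfM !mulrA mulfV ?mul1r//.
  by rewrite pnatr_eq0.
have key := @derivative_zero_cst (fun y => F y - \sum_(j < k.+2) y ^+ j * a j).
have /key/(_ z) : forall y, cder (fun y => F y - \sum_(j < k.+2) y ^+ j * a j) y 0.
  move=> y; apply: cder_eq (cderB (derivable_cder (dF y)) (cder_power_sum k.+1 a y)) _.
  by apply/eqP; rewrite subr_eq0; apply/eqP; exact: F'E.
have -> : F 0 - \sum_(j < k.+2) 0 ^+ j * a j = 0.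
  rewrite big_ord_recl big1 => [|j _]; last by rewrite lift0 exprS !mul0r.
  by rewrite expr0 mul1r addr0 /a fact0 invr1 mul1r subrr.
by move/eqP; rewrite subr_eq0 => /eqP.
Qed.

End Regularity.

(** * Smooth functions and holomorphic families *)

Section SmoothFunctions.
Context {R : realType}.
Local Notation C := (R[i]^o).
Implicit Types (f g : C -> C) (U D : set C) (z v l m : C).

Lemma rder_eq f z v l m : rder f z v l -> l = m -> rder f z v m.
Proof. by move=> h <-. Qed.

Lemma rder_open_eq U f g z v l : open U -> U z ->
  (forall y, U y -> f y = g y) -> rder f z v l -> rder g z v l.
Proof.
move=> /open_nrmP oU Uz fg; have [d d0 dP] := oU _ Uz.
have v0 : 0 < nrm v + 1 by rewrite ltr_wpDl// nrm_ge0.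
rewrite /rder (fg _ Uz); apply: (@expn_ext _ _ _ _ _ _ _ (d / (nrm v + 1))).
  by rewrite divr_gt0.
move=> t td; apply: fg; apply: dP; rewrite [z + _]addrC addrK nrmM nrm_real.
rewrite ltr_pdivlMr// in td; apply: le_lt_trans td.
by rewrite ler_wpM2l// lerDl.
Qed.

Lemma rder_cst (k : C) z v : rder (fun=> k) z v 0.
Proof.
have := expn_cst (@normr_ge0 R R) k; rewrite /rder; congr (expn _ _ _ _).
by apply/funext => t; rewrite mulr0.
Qed.

Lemma rderD f g z v l m : rder f z v l -> rder g z v m ->
  rder (fun y => f y + g y) z v (l + m).
Proof.
move=> h1 h2; have := expn_add h1 h2; rewrite /rder; congr (expn _ _ _ _).
by apply/funext => h; rewrite mulrDr.
Qed.

Lemma rderM f g z v l m : rder f z v l -> rder g z v m ->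
  rder (fun y => f y * g y) z v (l * g z + f z * m).
Proof.
move=> h1 h2; have := expn_mul (@normr_ge0 _ _) h1 h2; rewrite /rder; congr (expn _ _ _ _).
by apply/funext => h; ring.
Qed.

Lemma rderZ (k : C) f z v l : rder f z v l -> rder (fun y => k * f y) z v (k * l).
Proof. by move=> /(rderM (rder_cst k z v))/rder_eq; apply; rewrite mul0r add0r. Qed.

Lemma rderV f z v l : f z != 0 -> rder f z v l ->
  rder (fun y => (f y)^-1) z v (- l / f z ^+ 2).
Proof.
move=> f0 h1; have := expn_inv (@normr_ge0 _ _) f0 h1; rewrite /rder; congr (expn _ _ _ _).
by apply/funext => h; ring.
Qed.

Lemma rder_conj f z v l : rder f z v l -> rder (fun y => (f y)^*%C) z v l^*%C.
Proof.
move=> /expn_conj; rewrite /rder; congr (expn _ _ _ _).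
by apply/funext => h; rewrite rmorphM; congr (_ * _); exact: conjc_real.
Qed.

Lemma Ck_ext U n f g : open U -> (forall z, U z -> f z = g z) -> Ck n U f -> Ck n U g.
Proof.
move=> oU; elim: n f g => [|n ih] f g fg /=.
  move=> cf z Uz; move/open_nrmP : (oU) => /(_ _ Uz) [d d0 dP].
  apply/ccont_nrmP => e e0; have /ccont_nrmP/(_ e e0) [d' d'0 d'P] := cf z Uz.
  exists (Num.min d d'); first by rewrite lt_min d0.
  by move=> y; rewrite lt_min => /andP[/dP Uy /d'P]; rewrite -!fg.
have fgd v z : U z -> rderivable f z v -> rder g z v (rderive f z v).
  by move=> Uz /rderivableP h; exact: (rder_open_eq oU Uz fg h).
have fge v z : U z -> rderivable f z v -> rderive f z v = rderive g z v.
  by move=> Uz fz; rewrite (rder_rderive (fgd v z Uz fz)).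
move=> [df h1 h2]; split.
- by move=> z Uz; have [d1 d2] := df z Uz; split; apply: rder_rderivable; exact: fgd.
- by apply: ih h1 => z Uz; apply: fge => //; exact: (df z Uz).1.
- by apply: ih h2 => z Uz; apply: fge => //; exact: (df z Uz).2.
Qed.

Lemma Ck_step U n f f1 f2 : open U -> (forall z, U z -> rder f z 1 (f1 z)) ->
  (forall z, U z -> rder f z 'i%C (f2 z)) -> Ck n U f1 -> Ck n U f2 -> Ck n.+1 U f.
Proof.
move=> oU d1 d2 c1 c2; split.
- by move=> z Uz; split; [exact: rder_rderivable (d1 z Uz)|exact: rder_rderivable (d2 z Uz)].
- by apply: (Ck_ext oU _ c1) => z Uz; rewrite (rder_rderive (d1 z Uz)).
- by apply: (Ck_ext oU _ c2) => z Uz; rewrite (rder_rderive (d2 z Uz)).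
Qed.

Lemma smooth_continuous U f z : smooth U f -> U z -> {for z, continuous f}.
Proof. by move=> /(_ 0%N) h; exact: h. Qed.

Lemma smooth_rder U f z v : smooth U f -> U z -> v = 1 \/ v = 'i%C ->
  rder f z v (rderive f z v).
Proof.
by move=> /(_ 1%N) [h _ _] Uz [->|->]; apply: rderivableP; have [] := h z Uz.
Qed.

Lemma smooth_rderive U f v : smooth U f -> v = 1 \/ v = 'i%C ->
  smooth U (fun z => rderive f z v).
Proof. by move=> h [->|->] n; have [] := h n.+1. Qed.

Lemma smooth_ext U f g : open U -> (forall z, U z -> f z = g z) -> smooth U f -> smooth U g.
Proof. by move=> oU fg h n; exact: Ck_ext (h n). Qed.

Lemma Ck_sub U D n f : D `<=` U -> Ck n U f -> Ck n D f.
Proof.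
move=> DU; elim: n f => [|n ih] f /=; first by move=> h z /DU; exact: h.
by move=> [h1 h2 h3]; split; [move=> z /DU; exact: h1|exact: ih|exact: ih].
Qed.

Lemma smooth_sub U D f : D `<=` U -> smooth U f -> smooth D f.
Proof. by move=> DU h n; exact: Ck_sub (h n). Qed.

(** [Ck] is tested point by point on a total function, so local witnesses glue directly. *)
Lemma Ck_local U n f :
  (forall z, U z -> exists2 D : set C, D z & Ck n D f) -> Ck n U f.
Proof.
elim: n f => [|n ih] f /= h; first by move=> z /h [D Dz]; exact.
split.
- by move=> z /h [D Dz [h1 _ _]]; exact: h1.
- by apply: ih => z /h [D Dz [_ h1 _]]; exists D.
- by apply: ih => z /h [D Dz [_ _ h1]]; exists D.
Qed.

Lemma smooth_local U f :
  (forall z, U z -> exists2 D : set C, D z & smooth D f) -> smooth U f.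
Proof.
by move=> h n; apply: Ck_local => z /h [D Dz sD]; exists D => //; exact: sD.
Qed.

Lemma smooth_cst U (k : C) : open U -> smooth U (fun=> k).
Proof.
move=> oU n; elim: n k => [|n ih] k; first by move=> z _; exact: continuous_cst_C.
apply: (Ck_step (f1 := fun=> 0) (f2 := fun=> 0)) => // z _; exact: rder_cst.
Qed.

Let v1 : (1 : C) = 1 \/ (1 : C) = 'i%C := or_introl erefl.
Let vi : ('i%C : C) = 1 \/ ('i%C : C) = 'i%C := or_intror erefl.

Lemma smoothD U f g : open U -> smooth U f -> smooth U g -> smooth U (fun z => f z + g z).
Proof.
move=> oU sf sg n; elim: n f g sf sg => [|n ih] f g sf sg.
  move=> z Uz; apply: (@continuousD_C _ _ f g); exact: smooth_continuous Uz.
apply: (Ck_step oU (f1 := fun z => rderive f z 1 + rderive g z 1)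
   (f2 := fun z => rderive f z 'i%C + rderive g z 'i%C)).
- by move=> z Uz; apply: rderD; exact: (smooth_rder _ Uz v1).
- by move=> z Uz; apply: rderD; exact: (smooth_rder _ Uz vi).
- by apply: (ih (fun z => rderive f z 1) (fun z => rderive g z 1)); exact: smooth_rderive.
- by apply: (ih (fun z => rderive f z 'i%C) (fun z => rderive g z 'i%C)); exact: smooth_rderive.
Qed.

(** Sums at a finite order of regularity: in the induction for [smoothM], the two terms of the
    product rule are known to be [Ck n] and no more. *)
Lemma Ck_add U n f g : open U -> Ck n U f -> Ck n U g -> Ck n U (fun z => f z + g z).
Proof.
move=> oU; elim: n f g => [|n ih] f g.
  move=> cf cg z Uz; apply: (@continuousD_C _ _ f g); [exact: cf|exact: cg].
move=> [df f1 f2] [dg g1 g2].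
apply: (Ck_step oU (f1 := fun z => rderive f z 1 + rderive g z 1)
   (f2 := fun z => rderive f z 'i%C + rderive g z 'i%C)).
- by move=> z Uz; apply: rderD; apply: rderivableP; [exact: (df z Uz).1|exact: (dg z Uz).1].
- by move=> z Uz; apply: rderD; apply: rderivableP; [exact: (df z Uz).2|exact: (dg z Uz).2].
- exact: ih.
- exact: ih.
Qed.

Lemma smoothM U f g : open U -> smooth U f -> smooth U g -> smooth U (fun z => f z * g z).
Proof.
move=> oU sf sg n; elim: n f g sf sg => [|n ih] f g sf sg.
  move=> z Uz; apply: (@continuousM_C _ _ f g); exact: smooth_continuous Uz.
have h v : v = 1 \/ v = 'i%C -> Ck n U (fun z => rderive f z v * g z + f z * rderive g z v).
  move=> hv; apply: Ck_add => //; apply: ih => //; exact: smooth_rderive.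
have d v z : v = 1 \/ v = 'i%C -> U z ->
    rder (fun z => f z * g z) z v (rderive f z v * g z + f z * rderive g z v).
  by move=> hv Uz; apply: rderM; exact: (smooth_rder _ Uz hv).
by apply: (Ck_step oU (fun z => d 1 z v1) (fun z => d 'i%C z vi)); exact: h.
Qed.

Lemma smoothZ U (k : C) f : open U -> smooth U f -> smooth U (fun z => k * f z).
Proof. by move=> oU sf; apply: (smoothM (f := fun=> k)) => //; exact: smooth_cst. Qed.

Lemma smooth_conj U f : open U -> smooth U f -> smooth U (fun z => (f z)^*%C).
Proof.
move=> oU sf n; elim: n f sf => [|n ih] f sf.
  move=> z Uz; apply/ccont_nrmP => e e0.
  have /ccont_nrmP/(_ e e0) [d d0 dP] := smooth_continuous sf Uz.
  by exists d => // y /dP; rewrite -rmorphB nrm_conj.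
apply: (Ck_step oU (f1 := fun z => (rderive f z 1)^*%C) (f2 := fun z => (rderive f z 'i%C)^*%C)).
- by move=> z Uz; apply: rder_conj; exact: (smooth_rder _ Uz v1).
- by move=> z Uz; apply: rder_conj; exact: (smooth_rder _ Uz vi).
- by apply: ih; exact: smooth_rderive.
- by apply: ih; exact: smooth_rderive.
Qed.

Lemma continuous_atX f k z : {for z, continuous f} -> {for z, continuous (fun y => f y ^+ k : C)}.
Proof.
move=> cf; elim: k => [|k ih].
  rewrite (_ : (fun y => _) = fun=> 1); first exact: continuous_cst_C.
  by apply/funext => y; rewrite expr0.
rewrite (_ : (fun y => _) = fun y => f y * f y ^+ k); first exact: (continuousM_C cf ih).
by apply/funext => y; rewrite exprS.
Qed.

(* The statement about all powers is what makes the induction go through: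
   [(g/f^k)' = (g' f - k g f')/f^(k+1)]. *)
Lemma smooth_div U f g k : open U -> (forall z, U z -> f z != 0) ->
  smooth U f -> smooth U g -> smooth U (fun z => g z * (f z)^-1 ^+ k).
Proof.
move=> oU f0 sf sg n; elim: n g k sg => [|n ih] g k sg.
  move=> z Uz; apply: (@continuousM_C _ _ g (fun z => (f z)^-1 ^+ k)).
    exact: smooth_continuous Uz.
  have cfV : {for z, continuous (fun z => (f z)^-1 : C)}.
    by apply: (@continuousV_C _ _ f); [exact: f0|exact: smooth_continuous Uz].
  exact: (continuous_atX (k := k) cfV).
pose N v z := rderive g z v * f z + (- k%:R * g z) * rderive f z v.
have sN v : v = 1 \/ v = 'i%C -> smooth U (N v).
  move=> hv; apply: smoothD => //; apply: smoothM => //; try exact: smooth_rderive.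
  exact: smoothZ.
have rX v z : v = 1 \/ v = 'i%C -> U z ->
    rder (fun z => (f z)^-1 ^+ k) z v (- k%:R * rderive f z v * (f z)^-1 ^+ k.+1).
  move=> hv Uz; have hV := rderV (f0 z Uz) (smooth_rder sf Uz hv).
  elim: k {N sN} => [|k ihk].
    rewrite oppr0 !mul0r; have := rder_cst 1 z v; congr (rder _ _ _ _).
  have := rderM hV ihk; have -> : (fun y => (f y)^-1 * (f y)^-1 ^+ k) = fun z => (f z)^-1 ^+ k.+1.
    by apply/funext => y; rewrite exprS.
  move/rder_eq; apply; rewrite -exprVn !exprS expr0 -[k.+1%:R]natr1; ring.
have d v z : v = 1 \/ v = 'i%C -> U z ->
    rder (fun z => g z * (f z)^-1 ^+ k) z v (N v z * (f z)^-1 ^+ k.+1).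
  move=> hv Uz; have := rderM (smooth_rder sg Uz hv) (rX v z hv Uz).
  move/rder_eq; apply; rewrite /N exprS; field; exact: f0.
by apply: (Ck_step oU (fun z => d 1 z v1) (fun z => d 'i%C z vi)); apply: ih; exact: sN.
Qed.

Lemma smoothV U f : open U -> (forall z, U z -> f z != 0) ->
  smooth U f -> smooth U (fun z => (f z)^-1).
Proof.
move=> oU f0 sf; apply: (smooth_ext oU _ (smooth_div 1 oU f0 sf (smooth_cst 1 oU))).
by move=> z _; rewrite expr1 mul1r.
Qed.

(** The derivative in the direction [v] is [v * f'], and [f'] is again complex differentiable by
    [derivable_derive]. *)
Lemma derivable_smooth U f : open U -> (forall z, U z -> derivable f z 1) -> smooth U f.
Proof.
move=> oU df n; elim: n f df => [|n ih] f df.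
  by move=> z /df /derivable_cder; exact: cder_cont.
have h v : Ck n U (fun z => v * 'D_1 f z).
  apply: ih => z Uz; have /derivable_cder := derivable_derive oU df Uz.
  by move/(cderZ v); exact: cder_derivable.
have d v z : U z -> rder f z v (v * 'D_1 f z).
  by move=> /df/derivable_cder; exact: cder_rder.
exact: (Ck_step oU (d 1) (d 'i%C) (h _) (h _)).
Qed.

Lemma tder_bound_sym (G g : R -> C) (t M : R) :
  (forall s, `|s| <= `|t| -> tder G s (g s)) ->
  (forall s, `|s| <= `|t| -> nrm (g s) <= M) ->
  nrm (G t - G 0) <= 2 * M * `|t|.
Proof.
move=> dG gM; have [t0|t0] := leP 0 t.
  rewrite (ger0_norm t0) -[X in _ <= _ * X]subr0; apply: tder_bound => // s /andP[s0 st].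
    by apply: dG; rewrite !ger0_norm.
  by apply: gM; rewrite !ger0_norm.
rewrite (ltr0_norm t0) nrm_distC -[X in _ <= _ * X]add0r; apply: tder_bound => [|s /andP[s0 st]|s /andP[s0 st]].
- exact: ltW.
- by apply: dG; rewrite (ltr0_norm t0) ler0_norm// lerN2.
- by apply: gM; rewrite (ltr0_norm t0) ler0_norm// lerN2.
Qed.

Lemma rder_tder f z v (t : R) l : rder f (z + t%:C%C * v) v l ->
  tder (fun s : R => f (z + s%:C%C * v)) t l.
Proof.
rewrite /rder /tder; congr (expn _ _ _ _); apply/funext => s.
by rewrite rmorphD /=; congr (f _); ring.
Qed.

(** [smooth] speaks of derivatives along 1 and ['i] only. Going from [z] to [z + h] along the two
    axes and subtracting the linear part on each leg, the mean value bound and the continuity of the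
    partial derivatives give the joint expansion, on which the chain rule for holomorphic changes of
    variable rests. *)
Lemma total_differential U f z : open U -> smooth U f -> U z ->
  expn nrm (fun h => f (z + h)) (f z)
    (fun h => (complex.Re h)%:C%C * rderive f z 1 + (complex.Im h)%:C%C * rderive f z 'i%C).
Proof.
move=> oU sf Uz; split.
  exists (nrm (rderive f z 1) + nrm (rderive f z 'i%C)).
    by rewrite addr_ge0// nrm_ge0.
  move=> h; rewrite (le_trans (nrmD _ _))// !nrmM !nrm_real mulrDl lerD// mulrC ler_wpM2l ?nrm_ge0//.
    exact: Re_le_nrm.
  exact: Im_le_nrm.
(* Two legs, each with the factor 2 of the mean value bound: hence [e / 4]. *)
move=> e e0; have e4 : 0 < e / 4 by rewrite divr_gt0.
have /open_nrmP/(_ _ Uz) [d0 d00 d0P] := oU.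
have c v : v = 1 \/ v = 'i%C -> exists2 d, 0 < d & forall y, nrm (y - z) < d ->
    nrm (rderive f y v - rderive f z v) < e / 4.
  by move=> hv; have /ccont_nrmP := smooth_continuous (smooth_rderive sf hv) Uz; apply.
have [d1 d10 d1P] := c 1 v1; have [d2 d20 d2P] := c 'i%C vi.
exists (Num.min (d0 / 2) (Num.min (d1 / 2) (d2 / 2))).
  by rewrite !lt_min !divr_gt0.
move=> h; rewrite !lt_min => /and3P[hd0 hd1 hd2].
have near (s1 s2 : R) : `|s1| <= nrm h -> `|s2| <= nrm h ->
    nrm (z + s1%:C%C * 1 + s2%:C%C * 'i%C - z) <= 2 * nrm h.
  move=> h1 h2; have -> : z + s1%:C%C * 1 + s2%:C%C * 'i%C - z = s1%:C%C * 1 + s2%:C%C * 'i%C by ring.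
  rewrite (le_trans (nrmD _ _))// !nrmM nrm1 nrm_i !mulr1 !nrm_real.
  by rewrite mulr_natl mulr2n lerD.
have nh0 := nrm_ge0 h.
have lt2 (d : R) : nrm h < d / 2 -> 2 * nrm h < d by clear; lra.
have h1n : `|complex.Re h| <= nrm h := Re_le_nrm h.
have h2n : `|complex.Im h| <= nrm h := Im_le_nrm h.
have n0 : `|0 : R| <= nrm h by rewrite normr0.
pose h1 := complex.Re h; pose h2 := complex.Im h.
have hE : h = h1%:C%C * 1 + h2%:C%C * 'i%C.
  by rewrite {1}[h]complexE mulr1 [h2%:C%C * _]mulrC.
pose z1 := z + h1%:C%C * 1.
have b1 : nrm ((f (z + h1%:C%C * 1) - h1%:C%C * rderive f z 1) -
               (f (z + 0%:C%C * 1) - 0%:C%C * rderive f z 1)) <= 2 * (e / 4) * `|h1|.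
  apply: (@tder_bound_sym (fun s => f (z + s%:C%C * 1) - s%:C%C * rderive f z 1)
      (fun s => rderive f (z + s%:C%C * 1) 1 - rderive f z 1)) => s sh.
    have sn := le_trans sh h1n.
    have Us : U (z + s%:C%C * 1).
      apply: d0P; have := near s 0 sn n0; rewrite mul0r addr0 => /le_lt_trans; apply.
      exact: lt2.
    have t1 := rder_tder (smooth_rder sf Us v1).
    have t2 : tder (fun s : R => - (s%:C%C * rderive f z 1)) s (- rderive f z 1).
      split.
        by exists (nrm (- rderive f z 1)) => [|y]; rewrite ?nrm_ge0// nrmM nrm_real mulrC.
      move=> e' e'0; exists 1 => // y _; rewrite rmorphD /=.
      have -> : - ((s%:C%C + y%:C%C) * rderive f z 1) - - (s%:C%C * rderive f z 1) -
         y%:C%C * - rderive f z 1 = 0 by ring.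
      by rewrite nrm0 mulr_ge0// ltW.
    exact: tder_add t1 t2.
  apply/ltW/d1P; have := near s 0 (le_trans sh h1n) n0; rewrite mul0r addr0.
  by move/le_lt_trans; apply; exact: lt2.
have b2 : nrm ((f (z1 + h2%:C%C * 'i%C) - h2%:C%C * rderive f z 'i%C) -
               (f (z1 + 0%:C%C * 'i%C) - 0%:C%C * rderive f z 'i%C)) <= 2 * (e / 4) * `|h2|.
  apply: (@tder_bound_sym (fun s => f (z1 + s%:C%C * 'i%C) - s%:C%C * rderive f z 'i%C)
      (fun s => rderive f (z1 + s%:C%C * 'i%C) 'i%C - rderive f z 'i%C)) => s sh.
    have sn := le_trans sh h2n.
    have Us : U (z1 + s%:C%C * 'i%C).
      by apply: d0P; apply: le_lt_trans (near _ _ h1n sn) _; exact: lt2.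
    have t1 := rder_tder (smooth_rder sf Us vi).
    have t2 : tder (fun s : R => - (s%:C%C * rderive f z 'i%C)) s (- rderive f z 'i%C).
      split.
        by exists (nrm (- rderive f z 'i%C)) => [|y]; rewrite ?nrm_ge0// nrmM nrm_real mulrC.
      move=> e' e'0; exists 1 => // y _; rewrite rmorphD /=.
      have -> : - ((s%:C%C + y%:C%C) * rderive f z 'i%C) - - (s%:C%C * rderive f z 'i%C) -
         y%:C%C * - rderive f z 'i%C = 0 by ring.
      by rewrite nrm0 mulr_ge0// ltW.
    exact: tder_add t1 t2.
  apply/ltW/d2P; apply: le_lt_trans (near _ _ h1n (le_trans sh h2n)) _.
  exact: lt2.
rewrite -/h1 -/h2 {1}hE addrA -/z1.
rewrite !mul0r !addr0 !subr0 -/z1 in b1 b2.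
have -> : f (z1 + h2%:C%C * 'i%C) - f z - (h1%:C%C * rderive f z 1 + h2%:C%C * rderive f z 'i%C) =
  (f z1 - h1%:C%C * rderive f z 1 - f z) + (f (z1 + h2%:C%C * 'i%C) - h2%:C%C * rderive f z 'i%C - f z1) by ring.
apply: le_trans (nrmD _ _) _.
have -> : e * nrm h = 2 * (e / 4) * nrm h + 2 * (e / 4) * nrm h by field.
apply: lerD; first by apply: le_trans b1 _; rewrite ler_wpM2l// mulr_ge0// ltW.
by apply: le_trans b2 _; rewrite ler_wpM2l// mulr_ge0// ltW.
Qed.

End SmoothFunctions.

(** * Holomorphic families *)

Section HolomorphicFamilies.
Context {R : realType}.
Local Notation C := (R[i]^o).
Implicit Types (f g : C -> C) (F G : C -> C -> C) (U D : set C) (z v l m : C).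

Lemma rder_comp_holomorphic U f (phi : C -> C) z v p : open U -> smooth U f -> U (phi z) ->
  cder phi z p ->
  rder (fun y => f (phi y)) z v
   ((complex.Re (v * p))%:C%C * rderive f (phi z) 1 + (complex.Im (v * p))%:C%C * rderive f (phi z) 'i%C).
Proof.
move=> oU sf Uz /(cder_rder v) dphi.
have add (x y : R[i]) :
    (complex.Re (x + y))%:C%C * rderive f (phi z) 1 + (complex.Im (x + y))%:C%C * rderive f (phi z) 'i%C =
    ((complex.Re x)%:C%C * rderive f (phi z) 1 + (complex.Im x)%:C%C * rderive f (phi z) 'i%C) +
    ((complex.Re y)%:C%C * rderive f (phi z) 1 + (complex.Im y)%:C%C * rderive f (phi z) 'i%C).
  have -> : complex.Re (x + y) = complex.Re x + complex.Re y by case: x y => [? ?] [? ?].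
  have -> : complex.Im (x + y) = complex.Im x + complex.Im y by case: x y => [? ?] [? ?].
  by rewrite !rmorphD /=; ring.
have := expn_comp (@normr_ge0 _ _) dphi (total_differential oU sf Uz) add.
rewrite /rder; congr (expn _ _ _ _); apply/funext => t.
have ReR (x : R[i]) : complex.Re (t%:C%C * x) = t * complex.Re x by case: x => a b /=; ring.
have ImR (x : R[i]) : complex.Im (t%:C%C * x) = t * complex.Im x by case: x => a b /=; ring.
by rewrite ReR ImR !rmorphM /=; ring.
Qed.

Lemma holo_Ck_ext D U n F G : open D -> open U ->
  (forall l z, D l -> U z -> F l z = G l z) -> holo_Ck n D U F -> holo_Ck n D U G.
Proof.
move=> oD oU; elim: n F G => [|n ih] F G FG /=.
  move=> cF l z Dl Uz; have /cont_nrmP c := cF l z Dl Uz; apply/cont_nrmP => e e0.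
  have nD : \forall p \near ((l, z) : C * C), D p.1 /\ U p.2.
    exists (D, U) => /=; first by split; exact: open_nbhs_nbhs.
    by move=> [x y] /= [].
  apply: filterS2 nD (c e e0) => -[x y] /= [Dx Uy].
  by rewrite !FG.
have FGl l z : D l -> U z -> derivable (F ^~ z) l 1 -> cder (G ^~ z) l ('D_1 (F ^~ z) l).
  move=> Dl Uz /derivable_cder h; apply: (cder_open_eq oD Dl _ h) => y Dy.
  exact: FG.
have FGz v l z : D l -> U z -> rderivable (F l) z v -> rder (G l) z v (rderive (F l) z v).
  move=> Dl Uz /rderivableP h; apply: (rder_open_eq oU Uz _ h) => y Uy.
  exact: FG.
move=> [d h1 h2 h3]; split.
- move=> l z Dl Uz; have [d1 d2 d3] := d l z Dl Uz.
  split; [exact: cder_derivable (FGl l z Dl Uz d1)|exact: rder_rderivable (FGz _ l z Dl Uz d2)|exact: rder_rderivable (FGz _ l z Dl Uz d3)].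
- apply: ih h1 => l z Dl Uz; have [d1 d2 d3] := d l z Dl Uz.
  by rewrite (cder_derive (FGl l z Dl Uz d1)).
- apply: ih h2 => l z Dl Uz; have [d1 d2 d3] := d l z Dl Uz.
  by rewrite (rder_rderive (FGz _ l z Dl Uz d2)).
- apply: ih h3 => l z Dl Uz; have [d1 d2 d3] := d l z Dl Uz.
  by rewrite (rder_rderive (FGz _ l z Dl Uz d3)).
Qed.

Lemma cder_sum (I : Type) (s : seq I) (f : I -> C -> C) (df : I -> C) z :
  (forall k, cder (f k) z (df k)) ->
  cder (fun y => \sum_(k <- s) f k y) z (\sum_(k <- s) df k).
Proof.
move=> h; elim: s => [|k s ih].
  rewrite big_nil (_ : (fun y => _) = fun=> 0); first exact: cder_cst.
  by apply/funext => y; rewrite big_nil.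
rewrite big_cons (_ : (fun y => _) = fun y => f k y + \sum_(k <- s) f k y).
  exact: cderD.
by apply/funext => y; rewrite big_cons.
Qed.

Lemma rder_sum (I : Type) (s : seq I) (f : I -> C -> C) (df : I -> C) z v :
  (forall k, rder (f k) z v (df k)) ->
  rder (fun y => \sum_(k <- s) f k y) z v (\sum_(k <- s) df k).
Proof.
move=> h; elim: s => [|k s ih].
  rewrite big_nil (_ : (fun y => _) = fun=> 0); first exact: rder_cst.
  by apply/funext => y; rewrite big_nil.
rewrite big_cons (_ : (fun y => _) = fun y => f k y + \sum_(k <- s) f k y).
  exact: rderD.
by apply/funext => y; rewrite big_cons.
Qed.

Lemma smooth_sum U (I : Type) (s : seq I) (f : I -> C -> C) : open U ->
  (forall k, smooth U (f k)) -> smooth U (fun y => \sum_(k <- s) f k y).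
Proof.
move=> oU h; elim: s => [|k s ih].
  by apply: (smooth_ext oU _ (smooth_cst 0 oU)) => y _; rewrite big_nil.
by apply: (smooth_ext oU _ (smoothD oU (h k) ih)) => y _; rewrite big_cons.
Qed.

(** Finite sums of products [c(l) * f(z)] are stable under derivation in [l] and in [z], so joint
    regularity reduces to that of the factors. All families constructed later are brought to this
    form. *)
Lemma holo_family_sum D U (I : Type) (s : seq I) (c f : I -> C -> C) F :
  open D -> open U -> (forall k l, D l -> derivable (c k) l 1) ->
  (forall k, smooth U (f k)) ->
  (forall l z, D l -> U z -> F l z = \sum_(k <- s) c k l * f k z) ->
  holo_family D U F.
Proof.
move=> oD oU dc sf FE n.
apply: (@holo_Ck_ext _ _ _ (fun l z => \sum_(k <- s) c k l * f k z)) => //.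
  by move=> l z Dl Uz; rewrite FE.
elim: n c f dc sf {FE} => [|n ih] c f dc sf.
  move=> l z Dl Uz.
  have ch k : {for (l, z), continuous (fun p : C * C => c k p.1 * f k p.2 : C)}.
    apply: (@continuousM_C _ _ (fun p : C * C => c k p.1) (fun p : C * C => f k p.2)).
      apply: (continuous_comp_C (f := fun p : C * C => p.1)); first exact: cvg_fst.
      exact: cder_cont (derivable_cder (dc k l Dl)).
    apply: (continuous_comp_C (f := fun p : C * C => p.2)); first exact: cvg_snd.
    exact: smooth_continuous (sf k) Uz.
  elim: s => [|k s ihs].
    rewrite (_ : (fun p => _) = fun=> 0); first exact: continuous_cst_C.
    by apply/funext => p; rewrite big_nil.
  rewrite (_ : (fun p => _) = fun p : C * C => c k p.1 * f k p.2 + \sum_(k <- s) c k p.1 * f k p.2).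
    exact: (continuousD_C (ch k) ihs).
  by apply/funext => p; rewrite big_cons.
have dl l z : D l -> cder (fun l => \sum_(k <- s) c k l * f k z) l
    (\sum_(k <- s) 'D_1 (c k) l * f k z).
  move=> Dl; apply: cder_sum => k.
  have := cderM (derivable_cder (dc k l Dl)) (cder_cst (f k z) l).
  by move/cder_eq; apply; rewrite mulr0 addr0.
have dz v l z : U z -> v = 1 \/ v = 'i%C ->
    rder (fun z => \sum_(k <- s) c k l * f k z) z v (\sum_(k <- s) c k l * rderive (f k) z v).
  by move=> Uz hv; apply: rder_sum => k; apply: rderZ; exact: smooth_rder (sf k) Uz hv.
have v1 : (1 : C) = 1 \/ (1 : C) = 'i%C by left.
have vi : ('i%C : C) = 1 \/ ('i%C : C) = 'i%C by right.
split.
- move=> l z Dl Uz; split; first exact: cder_derivable (dl l z Dl).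
    exact: rder_rderivable (dz 1 l z Uz v1).
  exact: rder_rderivable (dz 'i%C l z Uz vi).
- have h : holo_Ck n D U (fun l z => \sum_(k <- s) 'D_1 (c k) l * f k z).
    by apply: (ih (fun k => 'D_1 (c k)) f _ sf) => k l Dl; exact: (derivable_derive oD (dc k) Dl).
  by apply: (holo_Ck_ext oD oU _ h) => l z Dl Uz; rewrite (cder_derive (dl l z Dl)).
- have h : holo_Ck n D U (fun l z => \sum_(k <- s) c k l * rderive (f k) z 1).
    by apply: (ih c (fun k z => rderive (f k) z 1) dc) => k; exact: (smooth_rderive (sf k) v1).
  by apply: (holo_Ck_ext oD oU _ h) => l z Dl Uz; rewrite (rder_rderive (dz 1 l z Uz v1)).
- have h : holo_Ck n D U (fun l z => \sum_(k <- s) c k l * rderive (f k) z 'i%C).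
    by apply: (ih c (fun k z => rderive (f k) z 'i%C) dc) => k; exact: (smooth_rderive (sf k) vi).
  by apply: (holo_Ck_ext oD oU _ h) => l z Dl Uz; rewrite (rder_rderive (dz 'i%C l z Uz vi)).
Qed.

Lemma holo_family_derivable D U F l z : holo_family D U F -> D l -> U z ->
  derivable (F ^~ z) l 1.
Proof. by move=> /(_ 1%N) [h _ _ _] Dl Uz; have [] := h l z Dl Uz. Qed.

Lemma holo_family_derive D U F : holo_family D U F ->
  holo_family D U (fun l z => 'D_1 (F ^~ z) l).
Proof. by move=> h n; have [] := h n.+1. Qed.

Lemma holo_family_smooth D U F l : holo_family D U F -> D l -> smooth U (F l).
Proof.
move=> h Dl n; elim: n F h => [|n ih] F h.
  move=> z Uz; have := h 0%N l z Dl Uz.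
  move=> /cont_nrmP c; apply/cont_nrmP => e /c [[A B] /= [nA nB] AB].
  by apply: filterS nB => y By; apply: (AB (l, y)); split => //=; exact: nbhs_singleton nA.
have [d _ _ _] := h 1%N; split.
- by move=> z Uz; have [] := d l z Dl Uz.
- by apply: (ih (fun l z => rderive (F l) z 1)) => m; have [] := h m.+1.
- by apply: (ih (fun l z => rderive (F l) z 'i%C)) => m; have [] := h m.+1.
Qed.

Lemma holo_family_iter D U F l j : holo_family D U F -> D l ->
  smooth U (fun z => iter j (fun g => 'D_1 g) (F ^~ z) l).
Proof.
move=> h Dl.
have hj : holo_family D U (fun l z => iter j (fun g : C -> C => 'D_1 g) (F ^~ z) l).
  by elim: j => [|j ih] //=; exact: holo_family_derive ih.
exact: holo_family_smooth hj Dl.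
Qed.

(** The coefficients are the Taylor coefficients at [l = 0]; they are smooth in [z] because
    derivation in [l] preserves holomorphic families. *)
Lemma polynomial_family U k F G : open U ->
  holo_family setT U F -> holo_family setT U G ->
  (forall w z, w != 0 -> U z -> G w z = w ^+ k * F w^-1 z) ->
  exists2 a : nat -> C -> C, (forall j, smooth U (a j)) &
    forall l z, U z -> F l z = \sum_(j < k.+1) l ^+ j * a j z.
Proof.
move=> oU hF hG FG.
exists (fun j z => j`!%:R^-1 * iter j (fun g => 'D_1 g) (F ^~ z) 0).
  by move=> j; apply: smoothZ => //; exact: (holo_family_iter (l := 0) j hF I).
move=> l z Uz; apply: (@entire_polynomial _ k (F ^~ z) (G ^~ z)).
- by move=> w; exact: (holo_family_derivable hF I Uz).
- by move=> w; exact: (holo_family_derivable hG I Uz).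
- by move=> w w0; exact: FG.
Qed.

End HolomorphicFamilies.

(** * Reflections and simple factors *)

Section LinearAlgebra.
Context {R : realType} {n : nat}.
Local Notation C := (R[i]).
Local Notation N := n.+2.
Local Notation eta := (lorentz C n).
Implicit Types (u v w l m : 'rV[C]_N) (g : 'M[C]_N) (a b c : C).

Lemma trmx_lorentz : eta^T = eta.
Proof. exact: tr_diag_mx. Qed.

Lemma lorentzK : eta *m eta = 1%:M.
Proof.
rewrite /lorentz mulmx_diag; apply/matrixP => i j; rewrite !mxE.
by case: ifP => _; rewrite ?mulrNN mulr1.
Qed.

Lemma conj_lorentz : conj_mx eta = eta.
Proof.
apply/matrixP => i j; rewrite !mxE; case: (i == j); last by rewrite !mulr0n rmorph0.
by rewrite !mulr1n; case: ifP => _; rewrite ?rmorphN1 ?rmorph1.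
Qed.

Opaque lorentz.

Lemma innerE u v : u *m eta *m v^T = (inner u v)%:M.
Proof. exact: mx11_scalar. Qed.

Lemma innerC u v : inner u v = inner v u.
Proof.
rewrite /inner (_ : v *m eta *m u^T = (u *m eta *m v^T)^T) ?mxE//.
by rewrite !trmx_mul !trmxK trmx_lorentz mulmxA.
Qed.

Lemma innerDl u v w : inner (u + v) w = inner u w + inner v w.
Proof. by rewrite /inner !mulmxDl mxE. Qed.

Lemma innerZl c u v : inner (c *: u) v = c * inner u v.
Proof. by rewrite /inner -!scalemxAl mxE. Qed.

Lemma innerDr u v w : inner w (u + v) = inner w u + inner w v.
Proof. by rewrite !(innerC w) innerDl. Qed.

Lemma innerZr c u v : inner v (c *: u) = c * inner v u.
Proof. by rewrite !(innerC v) innerZl. Qed.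

Lemma innerBl u v w : inner (u - v) w = inner u w - inner v w.
Proof. by rewrite innerDl -scaleN1r innerZl mulN1r. Qed.

Lemma innerBr u v w : inner w (u - v) = inner w u - inner w v.
Proof. by rewrite !(innerC w) innerBl. Qed.

Lemma inner0l v : inner 0 v = 0.
Proof. by rewrite /inner !mul0mx mxE. Qed.

Lemma inner_conj u v : inner (conj_mx u) (conj_mx v) = ((inner u v)^*)%C.
Proof.
by rewrite /inner -{1}conj_lorentz /conj_mx map_trmx -!map_mxM mxE.
Qed.

Lemma inner_orthogonal g u v : g *m eta *m g^T = eta -> inner (u *m g) (v *m g) = inner u v.
Proof.
move=> og; rewrite /inner trmx_mul; congr (fun_of_matrix _ _ _).
by rewrite -!mulmxA [eta *m (g^T *m _)]mulmxA [g *m _]mulmxA [g *m _]mulmxA og.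
Qed.

Lemma outerE v u l : v *m (eta *m u^T *m l) = inner v u *: l.
Proof. by rewrite !mulmxA innerE mul_scalar_mx. Qed.

Lemma eq_row_action (A B : 'M[C]_N) : (forall v, v *m A = v *m B) -> A = B.
Proof. by move=> h; apply/row_matrixP => i; rewrite !rowE. Qed.

Lemma orthogonal_inv g : g *m eta *m g^T = eta ->
  g \in unitmx /\ invmx g = eta *m g^T *m eta.
Proof.
move=> og; have h : g *m (eta *m g^T *m eta) = 1%:M.
  by rewrite !mulmxA og lorentzK.
have [gu _] := mulmx1_unit h; split=> //.
by rewrite -[LHS]mulmx1 -h mulKmx.
Qed.

Lemma orthogonal_mul g h : g *m eta *m g^T = eta -> h *m eta *m h^T = eta ->
  (g *m h) *m eta *m (g *m h)^T = eta.
Proof.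
move=> og oh; rewrite trmx_mul -!mulmxA [h *m _]mulmxA [h *m _ *m _]mulmxA oh.
by rewrite mulmxA.
Qed.

Lemma perpP r (A : 'M[C]_(r, N)) (V : 'M[C]_N) : (A <= perp V)%MS = (A *m eta *m V^T == 0).
Proof. by rewrite /perp; apply/sub_kermxP/eqP; rewrite mulmxA. Qed.

(** [proj_mx U W] is controlled on [U + W] and for a direct sum. The first two conditions force the
    sum to be direct, the last two make it everything. *)
Lemma proj_mx_eq (U W P : 'M[C]_N) : U *m P = U -> W *m P = 0 -> (P <= U)%MS ->
  (1%:M - P <= W)%MS -> proj_mx U W = P.
Proof.
move=> UP WP PU PW; have UW0 : (U :&: W)%MS = 0.
  apply/eqP; rewrite -submx0; apply/rV_subP => v; rewrite sub_capmx => /andP[/submxP[x ->] /submxP[y h]].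
  have -> : x *m U = x *m U *m P by rewrite -mulmxA UP.
  by rewrite h -mulmxA WP mulmx0 sub0mx.
rewrite -[LHS]mul1mx -(subrK P 1%:M) mulmxDl proj_mx_0// proj_mx_id// add0r.
by [].
Qed.

(** Orthogonal projection onto the span of the rows of [B], through the Gram matrix. It is rational
    in [B], so a smooth frame of [V] makes [rho V] smooth. *)
Definition frame_proj r (B : 'M[C]_(r, N)) : 'M[C]_N :=
  eta *m B^T *m invmx (B *m eta *m B^T) *m B.

(** A kernel vector [w] of the Gram matrix gives [w *m B] both in [V] and orthogonal to [V]. *)
Lemma gram_unit r (B : 'M[C]_(r, N)) (V : 'M[C]_N) : row_free B -> (B :=: V)%MS ->
  (V :&: perp V)%MS = 0 -> B *m eta *m B^T \in unitmx.
Proof.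
move=> fB BV ndV; rewrite -row_free_unit -kermx_eq0.
apply/eqP/row_matrixP => i; rewrite row0.
set w := row i _; have wQ : w *m (B *m eta *m B^T) = 0.
  by apply/sub_kermxP; exact: row_sub.
have : (w *m B <= V :&: perp V)%MS.
  rewrite sub_capmx -{1}BV submxMl perpP /=.
  have /submxP[X ->] : (V <= B)%MS by rewrite BV.
  by rewrite trmx_mul !mulmxA; move: wQ; rewrite !mulmxA => ->; rewrite mul0mx.
rewrite ndV submx0 => /eqP wB; apply: (row_free_inj fB).
by rewrite wB mul0mx.
Qed.

Lemma frame_proj_id r (B : 'M[C]_(r, N)) : B *m eta *m B^T \in unitmx ->
  B *m frame_proj B = B.
Proof. by move=> uQ; rewrite /frame_proj !mulmxA mulmxV// mul1mx. Qed.

Lemma frame_proj_sym r (B : 'M[C]_(r, N)) : frame_proj B *m eta = eta *m (frame_proj B)^T.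
Proof.
rewrite /frame_proj !trmx_mul trmx_inv !trmx_mul !trmxK trmx_lorentz.
rewrite (mulmxA B eta B^T); move: (invmx (B *m eta *m B^T)) => Q.
by rewrite !mulmxA.
Qed.

Lemma frame_projK r (B : 'M[C]_(r, N)) : B *m eta *m B^T \in unitmx ->
  frame_proj B *m frame_proj B = frame_proj B.
Proof.
move=> uQ; have /submxP[X E] : (frame_proj B <= B)%MS by exact: submxMl.
by rewrite {1}E -mulmxA frame_proj_id// -E.
Qed.

Lemma refl_frame r (B : 'M[C]_(r, N)) (V : 'M[C]_N) : row_free B -> (B :=: V)%MS ->
  (V :&: perp V)%MS = 0 -> refl V = 2 *: frame_proj B - 1%:M.
Proof.
move=> fB BV ndV; have uQ := gram_unit fB BV ndV.
have /submxP[X VX] : (V <= B)%MS by rewrite BV.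
have VP : V *m frame_proj B = V.
  rewrite VX /frame_proj !mulmxA -2!(mulmxA X) -(mulmxA X) mulmxV//.
  by rewrite mulmx1.
have WP : perp V *m frame_proj B = 0.
  have /submxP[Y BY] : (B <= V)%MS by rewrite BV.
  have /eqP h : perp V *m eta *m V^T == 0 by rewrite -perpP.
  by rewrite /frame_proj {1}BY trmx_mul !mulmxA h !mul0mx.
have PV : (frame_proj B <= V)%MS by rewrite -BV /frame_proj submxMl.
have PW : (1%:M - frame_proj B <= perp V)%MS.
  rewrite perpP VX trmx_mul mulmxA (_ : _ *m eta *m B^T = 0) ?mul0mx//.
  rewrite !mulmxBl mul1mx /frame_proj -!mulmxA (mulmxA B) mulVmx//.
  by rewrite mulmx1 subrr.
have -> : refl V = frame_proj B - (1%:M - frame_proj B).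
  congr (_ - _); apply: proj_mx_eq => //.
    by rewrite mulmxBr mulmx1 WP subr0.
    by rewrite mulmxBr mulmx1 VP subrr.
  by rewrite opprB addrC subrK.
by rewrite scaler_nat mulr2n opprB addrA.
Qed.

Section NonDegenerate.
Variable V : 'M[C]_N.
Hypothesis ndV : (V :&: perp V)%MS = 0.

Lemma refl_frameP : exists r (B : 'M[C]_(r, N)),
  [/\ row_free B, (B :=: V)%MS, B *m eta *m B^T \in unitmx &
      refl V = 2 *: frame_proj B - 1%:M].
Proof.
have fB : row_free (row_base V) by exact: row_base_free.
have BV : (row_base V :=: V)%MS by exact: eq_row_base.
exists (\rank V), (row_base V); split=> //; first exact: (gram_unit fB BV ndV).
exact: (refl_frame fB BV ndV).
Qed.

Lemma refl_K : refl V *m refl V = 1%:M.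
Proof.
have [r [B [fB BV uQ rE]]] := refl_frameP.
rewrite rE mulmxBr mulmx1 mulmxBl mul1mx -scalemxAl -scalemxAr (frame_projK uQ).
rewrite scalerA; set P := frame_proj B; apply/matrixP => i j; rewrite !mxE; ring.
Qed.

Lemma refl_sym : refl V *m eta = eta *m (refl V)^T.
Proof.
have [r [B [fB BV uQ rE]]] := refl_frameP.
have h := frame_proj_sym B.
by rewrite rE mulmxBl mul1mx linearB /= linearZ /= trmx1 mulmxBr mulmx1 -scalemxAl -scalemxAr h.
Qed.

Lemma refl_orthogonal : refl V *m eta *m (refl V)^T = eta.
Proof. by rewrite -mulmxA -refl_sym mulmxA refl_K mul1mx. Qed.

Lemma refl_id r (A : 'M[C]_(r, N)) : (A <= V)%MS -> A *m refl V = A.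
Proof.
have [s [B [fB BV uQ rE]]] := refl_frameP.
rewrite -BV => /submxP[X ->]; rewrite -mulmxA; congr (_ *m _).
by rewrite rE mulmxBr mulmx1 -scalemxAr frame_proj_id// scaler_nat mulr2n addrK.
Qed.

Lemma refl_inv_image g : g *m eta *m g^T = eta ->
  ((V *m g) :&: perp (V *m g))%MS = 0 /\ refl (V *m g) = invmx g *m refl V *m g.
Proof.
have [r [B [fB BV uQ rE]]] := refl_frameP.
move=> og; have [gu gi] := orthogonal_inv og.
have nd : ((V *m g) :&: perp (V *m g))%MS = 0.
  apply/eqP; rewrite -submx0; apply/rV_subP => v; rewrite sub_capmx perpP => /andP[/submxP[x ->]].
  rewrite (_ : _ *m (V *m g)^T = x *m V *m (g *m eta *m g^T) *m V^T); last first.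
    by rewrite trmx_mul !mulmxA.
  rewrite og => h.
  have : (x *m V <= V :&: perp V)%MS by rewrite sub_capmx submxMl perpP.
  by rewrite ndV submx0 mulmxA => /eqP ->; rewrite mul0mx sub0mx.
split=> //.
have fBg : row_free (B *m g) by rewrite /row_free mxrankMfree ?row_free_unit.
have BgV : (B *m g :=: V *m g)%MS by apply: eqmxMr.
rewrite (refl_frame fBg BgV nd) rE mulmxBr mulmx1 mulmxBl mulVmx//; congr (_ - _).
rewrite -scalemxAr -scalemxAl; congr (_ *: _); rewrite /frame_proj trmx_mul.
rewrite (_ : B *m g *m eta *m (g^T *m B^T) = B *m eta *m B^T).
  by rewrite gi !mulmxA -!(mulmxA _ eta eta) lorentzK mulmx1.
by rewrite !mulmxA -2!(mulmxA B) og.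
Qed.
End NonDegenerate.
End LinearAlgebra.

Section Conjugation.
Context {R : realType}.
Local Notation C := (R[i]).

Lemma conj_mxK p q (A : 'M[C]_(p, q)) : conj_mx (conj_mx A) = A.
Proof. by apply/matrixP => i j; rewrite !mxE conjcK. Qed.

Lemma conj_mxM p q r (A : 'M[C]_(p, q)) (B : 'M[C]_(q, r)) :
  conj_mx (A *m B) = conj_mx A *m conj_mx B.
Proof. exact: map_mxM. Qed.

Lemma conj_mxD p q (A B : 'M[C]_(p, q)) : conj_mx (A + B) = conj_mx A + conj_mx B.
Proof. exact: map_mxD. Qed.

Lemma conj_mxZ p q (c : C) (A : 'M[C]_(p, q)) : conj_mx (c *: A) = (c^*)%C *: conj_mx A.
Proof. exact: map_mxZ. Qed.

Lemma conj_mx_tr p q (A : 'M[C]_(p, q)) : conj_mx A^T = (conj_mx A)^T.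
Proof. by apply/matrixP => i j; rewrite !mxE. Qed.

End Conjugation.

Section SimpleFactors.
Context {R : realType} {n : nat}.
Local Notation C := (R[i]).
Local Notation N := n.+2.
Local Notation eta := (lorentz C n).
Implicit Types (u v w l m : 'rV[C]_N) (g : 'M[C]_N) (a b c : C).

Fact gam_key : unit. Proof. exact: tt. Qed.
(** The simple factor in terms of spanning vectors: [eta *m m^T *m l] divided by [inner l m] is the
    projection onto [l], and symmetrically for [m]. The division makes it depend on the two lines
    only. *)
Definition gam : 'rV[C]_N -> 'rV[C]_N -> C -> 'M[C]_N := locked_with gam_key
  (fun l m c => 1%:M + ((c - 1) / inner l m) *: (eta *m m^T *m l)
    + ((c^-1 - 1) / inner l m) *: (eta *m l^T *m m)).
Lemma gam_def l m c : gam l m c = 1%:M + ((c - 1) / inner l m) *: (eta *m m^T *m l)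
    + ((c^-1 - 1) / inner l m) *: (eta *m l^T *m m).
Proof. by rewrite [gam]unlock. Qed.

Lemma gamE v l m c : v *m gam l m c =
  v + ((c - 1) / inner l m * inner v m) *: l + ((c^-1 - 1) / inner l m * inner v l) *: m.
Proof. by rewrite !gam_def !mulmxDr mulmx1 -!scalemxAr !outerE !scalerA. Qed.

Definition null_pair l m := [/\ inner l l = 0, inner m m = 0 & inner l m != 0].

Lemma gamC l m c : gam l m c = gam m l c^-1.
Proof. by rewrite !gam_def addrAC invrK (innerC l m). Qed.

Lemma gam1 l m : gam l m 1 = 1%:M.
Proof. by rewrite !gam_def invr1 subrr mul0r !scale0r !addr0. Qed.

Lemma gamM l m b c : null_pair l m -> b != 0 -> c != 0 ->
  gam l m b *m gam l m c = gam l m (b * c).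
Proof.
move=> [h1 h2 h3] b0 c0; apply: eq_row_action => v; rewrite mulmxA !gamE.
rewrite !(innerDl, innerZl, h1, h2, innerC m l); apply/rowP => j; rewrite !mxE.
by field; rewrite b0 c0 h3.
Qed.

Lemma gam_unit l m c : null_pair l m -> c != 0 ->
  gam l m c \in unitmx /\ invmx (gam l m c) = gam l m c^-1.
Proof.
move=> h c0; have k : gam l m c *m gam l m c^-1 = 1%:M.
  by rewrite gamM ?invr_eq0// mulfV// gam1.
have [gu _] := mulmx1_unit k; split=> //.
by rewrite -[LHS]mulmx1 -k mulKmx.
Qed.

(** The adjoint for [eta] exchanges the two rank-one terms, so it is the factor with scalar [c^-1],
    which is the inverse. *)
Lemma gam_orthogonal l m c : null_pair l m -> c != 0 ->
  gam l m c *m eta *m (gam l m c)^T = eta.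
Proof.
move=> h c0; have [h1 h2 h3] := h.
have sym : gam l m c *m eta = eta *m (gam l m c^-1)^T.
  rewrite !gam_def invrK !linearD /= !linearZ /= trmx1 !trmx_mul !trmxK trmx_lorentz.
  rewrite !mulmxDl mulmx1 mul1mx -!scalemxAl.
  rewrite !mulmxA addrAC.
  by [].
by rewrite sym -mulmxA -trmx_mul gamM ?invr_eq0// mulfV// gam1 trmx1 mulmx1.
Qed.

Lemma gam_conjugate g l m c : g *m eta *m g^T = eta ->
  gam (l *m g) (m *m g) c = invmx g *m gam l m c *m g.
Proof.
move=> og; have [gu gi] := orthogonal_inv og; apply: eq_row_action => v.
rewrite !mulmxA -[in LHS](mulmxKV gu v) gamE !inner_orthogonal//.
by rewrite gamE !mulmxDl -!scalemxAl.
Qed.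

Lemma gam_scale (k k' : C) l m c : k != 0 -> k' != 0 -> inner l m != 0 ->
  gam (k *: l) (k' *: m) c = gam l m c.
Proof.
move=> k0 k'0 a0; apply: eq_row_action => v; rewrite !gamE !(innerZl, innerZr).
rewrite !scalerA; move: (c - 1) (c^-1 - 1) => x y.
by congr (_ + _ *: _ + _ *: _); field; rewrite k0 k'0 a0.
Qed.

Lemma gam_conj l m c : conj_mx (gam l m c) = gam (conj_mx l) (conj_mx m) (c^*)%C.
Proof.
apply: eq_row_action => v; rewrite -(conj_mxK v) -conj_mxM !gamE !conj_mxD !conj_mxZ.
by rewrite !inner_conj !rmorphM !rmorphB !rmorph1 !fmorphV.
Qed.

(** Each of the three projections in [Gamma] is recognised by [proj_mx_eq] as a combination of the
    identity and the rank-one maps [P u v], sending [w] to [(w, v) / (u, v)] times [u]. *)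
Lemma Gamma_frame (Lp Lm : 'M[C]_N) l m c : (l :=: Lp)%MS -> (m :=: Lm)%MS ->
  null_pair l m -> Gamma Lp Lm c = gam l m c.
Proof.
move=> lL mL [h1 h2 h3].
have [P [PE Psub]] : exists P : 'rV[C]_N -> 'rV[C]_N -> 'M[C]_N,
    (forall u v w, w *m P u v = (inner w v / inner u v) *: u) /\
    (forall u v, (P u v <= u)%MS).
  exists (fun u v => (inner u v)^-1 *: (eta *m v^T *m u)); split=> u v.
    by move=> w; rewrite -scalemxAr outerE scalerA mulrC.
  by rewrite scalemx_sub// submxMl.
have Pid (U : 'M[C]_N) u v : inner u v != 0 -> (U <= u)%MS -> U *m P u v = U.
  move=> a0 /submxP[X ->]; rewrite -mulmxA PE divff// scale1r.
  by [].
have Pz (U : 'M[C]_N) u v w : inner w v = 0 -> (U <= w)%MS -> U *m P u v = 0.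
  by move=> wv /submxP[X ->]; rewrite -mulmxA PE wv mul0r scale0r mulmx0.
have Ll : (Lp <= l)%MS by rewrite lL.
have Mm : (Lm <= m)%MS by rewrite mL.
have h3' : inner m l != 0 by rewrite innerC.
have [P0 P0E] : exists P0 : 'M[C]_N, P0 = 1%:M - P l m - P m l by eexists.
have [T TE] : exists T : 'M[C]_N, T = perp (Lp + Lm)%MS by eexists.
have Tz u : (u <= Lp + Lm)%MS -> forall w, (w <= T)%MS -> inner w u = 0.
  move=> /submxP[X ->] w; rewrite TE perpP => /eqP h.
  by rewrite /inner trmx_mul mulmxA h mul0mx mxE.
have Tzl := Tz l (submx_trans _ (addsmxSl _ _)).
have Tzm := Tz m (submx_trans _ (addsmxSr _ _)).
have TP u v : (forall w, (w <= T)%MS -> inner w v = 0) -> T *m P u v = 0.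
  move=> h; apply/row_matrixP => i; rewrite row_mul PE h ?row_sub// mul0r scale0r.
  by rewrite row0.
have TPl : T *m P m l = 0 by apply: TP => w wT; apply: Tzl => //; rewrite lL.
have TPm : T *m P l m = 0 by apply: TP => w wT; apply: Tzm => //; rewrite mL.
have P0T : (P0 <= T)%MS.
  apply/row_subP => i; rewrite rowE; set w := delta_mx _ _; rewrite TE perpP.
  have z : inner (w *m P0) l = 0 /\ inner (w *m P0) m = 0.
    rewrite P0E !mulmxBr mulmx1 !PE !innerBl !innerZl h1 h2 (innerC m l) !mulr0 !subr0.
    by rewrite !divfK// !subrr.
  have /submxP[X ->] : (Lp + Lm <= col_mx l m)%MS.
    by rewrite addsmx_sub (submx_trans Ll) ?(submx_trans Mm)// -addsmxE ?addsmxSl ?addsmxSr.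
  rewrite trmx_mul tr_col_mx mulmxA mul_mx_row !innerE z.1 z.2.
  by rewrite (_ : (0%:M : 'M[C]_1) = 0) ?raddf0// row_mx0 mul0mx.
have P0P : P0 = 1%:M - P m l - P l m by rewrite P0E addrAC.
have e1 : proj_mx Lp (Lm + T)%MS = P l m.
  apply: proj_mx_eq.
  - exact: Pid.
  - apply/sub_kermxP; rewrite addsmx_sub; apply/andP; split; apply/sub_kermxP => //.
    exact: Pz h2 Mm.
  - by rewrite -lL.
  - rewrite (_ : _ - _ = P0 + P m l); last by rewrite P0E subrK.
    rewrite addmx_sub//.
      exact: submx_trans P0T (addsmxSr _ _).
    by apply: submx_trans (addsmxSl _ _); rewrite -mL.
have e2 : proj_mx Lm (Lp + T)%MS = P m l.
  apply: proj_mx_eq.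
  - exact: Pid.
  - apply/sub_kermxP; rewrite addsmx_sub; apply/andP; split; apply/sub_kermxP => //.
    exact: Pz h1 Ll.
  - by rewrite -mL.
  - rewrite (_ : _ - _ = P0 + P l m); last by rewrite P0P subrK.
    rewrite addmx_sub//.
      exact: submx_trans P0T (addsmxSr _ _).
    by apply: submx_trans (addsmxSl _ _); rewrite -lL.
have e3 : proj_mx T (Lp + Lm)%MS = P0.
  apply: proj_mx_eq.
  - by rewrite P0E !mulmxBr TPl TPm mulmx1 !subr0.
  - apply/sub_kermxP; rewrite addsmx_sub; apply/andP; split; apply/sub_kermxP.
      by rewrite P0E !mulmxBr mulmx1 (Pid _ _ _ h3 Ll) (Pz _ _ _ _ h1 Ll) subrr subr0.
    by rewrite P0E !mulmxBr mulmx1 (Pid _ _ _ h3' Mm) (Pz _ _ _ _ h2 Mm) subr0 subrr.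
  - exact: P0T.
  - rewrite (_ : _ - _ = P l m + P m l); last first.
      by rewrite P0E -addrA -opprD opprB addrC subrK.
    rewrite addmx_sub//.
      by apply: submx_trans (addsmxSl _ _); rewrite -lL.
    by apply: submx_trans (addsmxSr _ _); rewrite -mL.
rewrite /Gamma -TE e1 e2 e3; apply: eq_row_action => v.
rewrite gamE !mulmxDr -!scalemxAr P0E !mulmxBr mulmx1 !PE (innerC m l).
by apply/rowP => j; rewrite !mxE; ring.
Qed.

End SimpleFactors.

(** * Permutability *)

Section PermutabilityCoefficients.
Variables (F : fieldType) (a b s t r x y E : F).
Hypotheses (a0 : a != 0) (b0 : b != 0) (r0 : r != 0) (x0 : x != 0) (y0 : y != 0).
Hypothesis r1 : r ^+ 2 != 1.
Hypothesis rel : r * (1 - x * y) = x - y.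
Hypothesis EE : E = a * b + (r ^+ 2 - 1) * t ^+ 2 + (r^-1 ^+ 2 - 1) * s ^+ 2.
Hypothesis E0 : E != 0.

(** [rel] is the addition law of the hyperbolic tangent: [r], [x], [y] stand for [cay al be],
    [cay al la], [cay be la], and each of these is formally the tanh of half a difference of
    logarithms. The law eliminates [x]. *)
Lemma cayley_addition : 1 + r * y != 0 /\ x = (r + y) / (1 + r * y).
Proof.
have xE : x * (1 + r * y) = r + y.
  have e : x * (1 + r * y) - (r + y) = (x - y) - r * (1 - x * y) by ring.
  by apply/eqP; rewrite -subr_eq0 e rel subrr.
have h : 1 + r * y != 0.
  apply/eqP => h; move: xE; rewrite h mulr0 => /eqP; rewrite eq_sym addr_eq0 => /eqP ry.
  move: h => /eqP; rewrite addr_eq0 ry mulNr opprK eq_sym => /eqP h.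
  by move/eqP: r1; rewrite ry sqrrN expr2 h.
by split=> //; apply: (canRL (mulfK h)).
Qed.

(** Compares the coefficients of [l] when the two products act on a vector whose inner products with
    [l], [l'], [m], [m'] are [v1], [v2], [v3], [v4]. The coefficient of [m] follows by exchanging
    the pairs and replacing [r] by [- r]. *)
Lemma coefficient_l v1 v2 v3 v4 :
  (x - 1) / a * v2
  + (y - 1) / (E / a) * (v4 + (x * r - 1) / a * v2 * t + ((x * r)^-1 - 1) / a * v1 * s)
     * ((r - 1) / a * t)
  + (y^-1 - 1) / (E / a) * (v3 + (x / r - 1) / a * v2 * s + ((x / r)^-1 - 1) / a * v1 * t)
     * ((r^-1 - 1) / a * s)
  = (x - 1) / (E / b) * (v2 + (y * - r - 1) / b * v4 * t + ((y * - r)^-1 - 1) / b * v3 * s).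
Proof.
have [q0 xE] := cayley_addition.
have ry0 : r + y != 0 by move: x0; rewrite xE mulf_eq0 negb_or => /andP[].
(* Once [x] and [b] are eliminated through [rel] and [EE], the claim is an identity of rational
   functions in independent variables. *)
have bE : b = (E - (r ^+ 2 - 1) * t ^+ 2 - (r^-1 ^+ 2 - 1) * s ^+ 2) / a.
  by rewrite EE; field; rewrite a0 r0.
rewrite xE.
have -> : (((r + y) / (1 + r * y) - 1) / (E / b) * (v2 + (y * - r - 1) / b * v4 * t + ((y * - r)^-1 - 1) / b * v3 * s)) =
  ((r + y) / (1 + r * y) - 1) / E * (b * v2 + (y * - r - 1) * v4 * t + ((y * - r)^-1 - 1) * v3 * s).
  by field; rewrite ?oppr_eq0 ?E0 ?b0 ?r0 ?y0 ?q0 ?ry0.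
rewrite bE; field.
by rewrite ?oppr_eq0 ?E0 ?a0 ?r0 ?y0 ?q0 ?ry0.
Qed.

Lemma coefficient_l' v1 v2 v3 v4 :
  (x^-1 - 1) / a * v1
  + (y - 1) / (E / a) * (v4 + (x * r - 1) / a * v2 * t + ((x * r)^-1 - 1) / a * v1 * s)
     * ((r^-1 - 1) / a * s)
  + (y^-1 - 1) / (E / a) * (v3 + (x / r - 1) / a * v2 * s + ((x / r)^-1 - 1) / a * v1 * t)
     * ((r - 1) / a * t)
  = (x^-1 - 1) / (E / b) * (v1 + (y / - r - 1) / b * v4 * s + ((y / - r)^-1 - 1) / b * v3 * t).
Proof.
have [q0 xE] := cayley_addition.
have ry0 : r + y != 0 by move: x0; rewrite xE mulf_eq0 negb_or => /andP[].
have bE : b = (E - (r ^+ 2 - 1) * t ^+ 2 - (r^-1 ^+ 2 - 1) * s ^+ 2) / a.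
  by rewrite EE; field; rewrite a0 r0.
rewrite xE.
have -> : ((((r + y) / (1 + r * y))^-1 - 1) / (E / b) * (v1 + (y / - r - 1) / b * v4 * s + ((y / - r)^-1 - 1) / b * v3 * t)) =
  (((r + y) / (1 + r * y))^-1 - 1) / E * (b * v1 + (y / - r - 1) * v4 * s + ((y / - r)^-1 - 1) * v3 * t).
  by field; rewrite ?oppr_eq0 ?E0 ?b0 ?r0 ?y0 ?q0 ?ry0.
rewrite bE; field.
by rewrite ?oppr_eq0 ?E0 ?a0 ?r0 ?y0 ?q0 ?ry0.
Qed.

End PermutabilityCoefficients.

Section Permutability.
Context {R : realType} {n : nat}.
Local Notation C := (R[i]).
Local Notation N := n.+2.
Implicit Types (u v w l m : 'rV[C]_N) (g : 'M[C]_N) (a b c r s t x y : C).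

Lemma inner_gam_row l m c u v : null_pair l m -> c != 0 ->
  inner (u *m gam l m c) v = inner u (v *m gam l m c^-1).
Proof.
move=> lm c0; have oc := gam_orthogonal lm c0.
rewrite -[in RHS](inner_orthogonal _ _ oc) -mulmxA gamM// ?invr_eq0//.
by rewrite mulVf// gam1 mulmx1.
Qed.

(** Inner product of the second pair after dressing by the first. Its numerator is unchanged when
    the pairs are exchanged and [r] becomes [- r], so it is the common [E] of both products. *)
Definition pair_norm a b s t r : C := (a * b + (r ^+ 2 - 1) * t ^+ 2 + (r^-1 ^+ 2 - 1) * s ^+ 2) / a.

Section TwoPairs.
Variables (l l' m m' : 'rV[C]_N).
Hypothesis pl : null_pair l l'.
(** These relations hold when one orthogonal involution exchanges [l] with [l'] and [m] with [m'],
    as [rho V] will. *)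
Hypotheses (E1 : inner l' m' = inner l m) (E2 : inner l' m = inner l m').
Let a := inner l l'.
Let b := inner m m'.
Let s := inner l m.
Let t := inner l m'.

Lemma dressed_norm r : r != 0 ->
  inner (m *m gam l l' r) (m' *m gam l l' r^-1) = pair_norm a b s t r.
Proof.
move=> r0; have [h1 h2 a0] := pl.
rewrite inner_gam_row// -mulmxA gamM ?invr_eq0// gamE innerDr innerDr !innerZr.
rewrite (innerC m' l') (innerC m' l) (innerC m l) (innerC m l') E1 E2 -/a -/b -/s -/t.
rewrite /pair_norm; move: (a0); rewrite -/a; move: a b s t => {}a0' b' s' t' a0''.
by field; rewrite r0 a0''.
Qed.

Lemma dressed_action v x y r : x != 0 -> r != 0 ->
  let D := pair_norm a b s t r in
  let v1 := inner v l in let v2 := inner v l' in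
  let v3 := inner v m in let v4 := inner v m' in
  let W := v4 + (x * r - 1) / a * v2 * t + ((x * r)^-1 - 1) / a * v1 * s in
  let Z := v3 + (x / r - 1) / a * v2 * s + ((x / r)^-1 - 1) / a * v1 * t in
  v *m (gam l l' x *m gam (m *m gam l l' r) (m' *m gam l l' r^-1) y) =
  v + ((x - 1) / a * v2 + (y - 1) / D * W * ((r - 1) / a * t)
         + (y^-1 - 1) / D * Z * ((r^-1 - 1) / a * s)) *: l
    + ((x^-1 - 1) / a * v1 + (y - 1) / D * W * ((r^-1 - 1) / a * s)
         + (y^-1 - 1) / D * Z * ((r - 1) / a * t)) *: l'
    + ((y - 1) / D * W) *: m + ((y^-1 - 1) / D * Z) *: m'.
Proof.
move=> x0 r0 D v1 v2 v3 v4 W Z; have [h1 h2 a0] := pl.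
have r'0 : r^-1 != 0 by rewrite invr_eq0.
have x'0 : x^-1 != 0 by rewrite invr_eq0.
have WE : inner (v *m gam l l' x) (m' *m gam l l' r^-1) = W.
  rewrite innerC inner_gam_row// invrK -mulmxA gamM// innerC gamE innerDl innerDl !innerZl.
  by rewrite E1.
have ZE : inner (v *m gam l l' x) (m *m gam l l' r) = Z.
  rewrite innerC inner_gam_row// -mulmxA gamM// innerC gamE innerDl innerDl !innerZl.
  by rewrite E2.
rewrite mulmxA gamE WE ZE dressed_norm// gamE.
rewrite (gamE m) (gamE m') invrK (innerC m l) (innerC m l') (innerC m' l) (innerC m' l').
rewrite E1 E2 -/a -/s -/t -/v1 -/v2 -/D.
move: ((y - 1) / D * W) ((y^-1 - 1) / D * Z) ((x - 1) / a * v2) ((x^-1 - 1) / a * v1) => k1 k2 k3 k4.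
move: ((r - 1) / a * t) ((r^-1 - 1) / a * s) ((r^-1 - 1) / a * s) => k5 k6 k7.
apply/rowP => j; rewrite !mxE.
ring.
Qed.

End TwoPairs.

(** Both products differ from the identity by terms along [l], [l'], [m], [m'], so four coefficients
    are compared. The scalars are those normalised to 1 at infinity; the parameter enters through
    the relation between [x], [y] and [r] alone. *)
Lemma permute_infty (l l' m m' : 'rV[C]_N) x y r :
  null_pair l l' -> null_pair m m' ->
  inner l' m' = inner l m -> inner l' m = inner l m' ->
  x != 0 -> y != 0 -> r != 0 -> r ^+ 2 != 1 -> r * (1 - x * y) = x - y ->
  inner (m *m gam l l' r) (m' *m gam l l' r^-1) != 0 ->
  gam l l' x *m gam (m *m gam l l' r) (m' *m gam l l' r^-1) y =
  gam m m' y *m gam (l *m gam m m' (- r)) (l' *m gam m m' (- r)^-1) x.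
Proof.
move=> pl pm E1 E2 x0 y0 r0 r1 rel D0.
have [h1 h2 a0] := pl; have [h3 h4 b0] := pm.
have E1' : inner m' l' = inner m l by rewrite innerC E1 innerC.
have E2' : inner m' l = inner m l' by rewrite innerC -E2 innerC.
have nr0 : - r != 0 by rewrite oppr_eq0.
rewrite (dressed_norm pl E1 E2 r0) in D0.
apply: eq_row_action => v.
have q1 := @dressed_action _ _ _ _ pl E1 E2 v x y r x0 r0; cbv zeta in q1.
have q2 := @dressed_action _ _ _ _ pm E1' E2' v y x (- r) y0 nr0; cbv zeta in q2.
apply: (etrans q1); apply/esym; apply: (etrans q2); apply/esym.
rewrite (innerC m l) (innerC m l') E2.
pose E := inner l l' * inner m m' + (r ^+ 2 - 1) * inner l m' ^+ 2 + (r^-1 ^+ 2 - 1) * inner l m ^+ 2.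
have E0 : E != 0 by move: D0; rewrite /pair_norm mulf_eq0 negb_or => /andP[].
have n1 : pair_norm (inner l l') (inner m m') (inner l m) (inner l m') r = E / inner l l' by [].
have n2 : pair_norm (inner m m') (inner l l') (inner l m) (inner l m') (- r) = E / inner m m'.
  by rewrite /pair_norm /E sqrrN invrN sqrrN (mulrC (inner m m')).
rewrite n1 n2.
have r1' : (- r) ^+ 2 != 1 by rewrite sqrrN.
have rel' : - r * (1 - y * x) = y - x by rewrite mulNr (mulrC y) rel opprB.
have EE' : E = inner m m' * inner l l' + ((- r) ^+ 2 - 1) * inner l m' ^+ 2 + ((- r)^-1 ^+ 2 - 1) * inner l m ^+ 2.
  by rewrite /E sqrrN invrN sqrrN (mulrC (inner m m')).
have k1 := coefficient_l a0 b0 r0 x0 y0 r1 rel (erefl E) E0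
  (inner v l) (inner v l') (inner v m) (inner v m').
have k2 := coefficient_l' a0 b0 r0 x0 y0 r1 rel (erefl E) E0
  (inner v l) (inner v l') (inner v m) (inner v m').
have k3 := coefficient_l b0 a0 nr0 y0 x0 r1' rel' EE' E0
  (inner v m) (inner v m') (inner v l) (inner v l').
have k4 := coefficient_l' b0 a0 nr0 y0 x0 r1' rel' EE' E0
  (inner v m) (inner v m') (inner v l) (inner v l').
rewrite !opprK in k3 k4.
rewrite k1 k2 k3 k4 -!addrA; congr (v + _).
by rewrite addrA [LHS]addrC -addrA.
Qed.

Definition cay (al la : C) : C := (la - al) / (la + al).

Lemma cay_eq0 al la : la - al != 0 -> la + al != 0 -> cay al la != 0.
Proof. by move=> h1 h2; rewrite /cay mulf_neq0// invr_eq0. Qed.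

Lemma cay_rel al be la : be + al != 0 -> la + al != 0 -> la + be != 0 ->
  cay al be * (1 - cay al la * cay be la) = cay al la - cay be la.
Proof. by move=> h1 h2 h3; rewrite /cay; field; rewrite h1 h2 h3. Qed.

(* The simple factors are normalised at [la = 1] by constants [ka], [kb];
   both products are a constant multiple of the products normalised at
   infinity, which agree by [permute_infty]. *)
Lemma permute (l l' m m' : 'rV[C]_N) al be ka kb x y :
  null_pair l l' -> null_pair m m' ->
  inner l' m' = inner l m -> inner l' m = inner l m' ->
  al != 0 -> be != 0 -> be - al != 0 -> be + al != 0 ->
  ka != 0 -> kb != 0 -> ka * cay al 1 = 1 -> kb * cay be 1 = 1 ->
  (x = ka /\ y = kb \/ exists la, [/\ la - al != 0, la + al != 0, la - be != 0, la + be != 0 &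
    x = ka * cay al la /\ y = kb * cay be la]) ->
  inner (m *m gam l l' (ka * cay al be)) (m' *m gam l l' (ka / cay al be)) != 0 ->
  gam l l' x *m gam (m *m gam l l' (ka * cay al be)) (m' *m gam l l' (ka / cay al be)) y =
  gam m m' y *m gam (l *m gam m m' (kb * cay be al)) (l' *m gam m m' (kb / cay be al)) x.
Proof.
move=> pl pm E1 E2 al0 be0 ba bap ka0 kb0 ka1 kb1 xy D0.
have [h1 h2 a0] := pl; have [h3 h4 b0] := pm.
pose r := cay al be.
have r0 : r != 0 by exact: cay_eq0.
have rN : cay be al = - r by rewrite /r /cay -mulNr opprB addrC [al + be]addrC [- be + al]addrC.
have r1 : r ^+ 2 != 1.
  rewrite /r /cay expr_div_n -subr_eq0 -(divff (_ : (be + al) ^+ 2 != 0)) ?expf_neq0//.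
  rewrite -mulrBl mulf_neq0 ?invr_eq0 ?expf_neq0//.
  rewrite (_ : _ - _ = - (4 * (al * be))); last by ring.
  by rewrite oppr_eq0 !mulf_neq0// pnatr_eq0.
have nr0 : - r != 0 by rewrite oppr_eq0.
have r'0 : r^-1 != 0 by rewrite invr_eq0.
have nr'0 : (- r)^-1 != 0 by rewrite invr_eq0.
have oG := gam_orthogonal pl ka0; have oH := gam_orthogonal pm kb0.
have [uG iG] := gam_unit pl ka0; have [uH iH] := gam_unit pm kb0.
rewrite -/r rN in D0 *.
pose lr := m *m gam l l' r; pose lr' := m' *m gam l l' r^-1.
pose mr := l *m gam m m' (- r); pose mr' := l' *m gam m m' (- r)^-1.
have gG (u : C) : u != 0 -> gam l l' (ka * u) = gam l l' u *m gam l l' ka.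
  by move=> u0; rewrite gamM// mulrC.
have gH (u : C) : u != 0 -> gam m m' (kb * u) = gam m m' u *m gam m m' kb.
  by move=> u0; rewrite gamM// mulrC.
have D1 : inner lr lr' != 0.
  by move: D0; rewrite (gG _ r0) (gG _ r'0) (mulmxA m) (mulmxA m') inner_orthogonal.
have e1 z : gam (m *m gam l l' (ka * r)) (m' *m gam l l' (ka / r)) z =
    invmx (gam l l' ka) *m gam lr lr' z *m gam l l' ka.
  by rewrite (gG _ r0) (gG _ r'0) (mulmxA m) (mulmxA m') gam_conjugate.
have e2 z : gam (l *m gam m m' (kb * - r)) (l' *m gam m m' (kb / - r)) z =
    invmx (gam m m' kb) *m gam mr mr' z *m gam m m' kb.
  by rewrite (gH _ nr0) (gH _ nr'0) (mulmxA l) (mulmxA l') gam_conjugate.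
rewrite e1 e2.
have nlr : null_pair lr lr'.
  split=> //; rewrite inner_orthogonal ?h3 ?h4//; exact: gam_orthogonal.
have nmr : null_pair mr mr'.
  split; try by rewrite inner_orthogonal ?h1 ?h2//; exact: gam_orthogonal.
  have E1' : inner m' l' = inner m l by rewrite innerC E1 innerC.
  have E2' : inner m' l = inner m l' by rewrite innerC -E2 innerC.
  rewrite (dressed_norm pm E1' E2')//; move: D1; rewrite (dressed_norm pl E1 E2)//.
  rewrite /pair_norm !mulf_eq0 !negb_or sqrrN [(- r)^-1]invrN sqrrN (innerC m l) (innerC m l') E2.
  by rewrite [inner m m' * _]mulrC !invr_eq0 b0 => /andP[-> _].
pose Phi (u w : C) := gam l l' u *m gam lr lr' w.
pose Psi (u w : C) := gam m m' w *m gam mr mr' u.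
have PP la : la - al != 0 -> la + al != 0 -> la - be != 0 -> la + be != 0 ->
    Phi (cay al la) (cay be la) = Psi (cay al la) (cay be la).
  move=> q1 q2 q3 q4; apply: permute_infty => //; try exact: cay_eq0.
  exact: cay_rel.
have c1al : cay al 1 != 0 by apply: contra_eq_neq ka1 => ->; rewrite mulr0 eq_sym oner_eq0.
have c1be : cay be 1 != 0 by apply: contra_eq_neq kb1 => ->; rewrite mulr0 eq_sym oner_eq0.
have P1 : Phi (cay al 1) (cay be 1) = Psi (cay al 1) (cay be 1).
  move: c1al c1be; rewrite /cay !mulf_eq0 !invr_eq0 !negb_or => /andP[q1 q2] /andP[q3 q4].
  exact: PP.
have lhs (u w : C) : u != 0 -> w != 0 -> gam l l' (ka * u) *m (invmx (gam l l' ka) *m gam lr lr' (kb * w) *m gam l l' ka) =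
    Phi u w *m (gam lr lr' kb *m gam l l' ka).
  move=> u0 w0; have -> : gam lr lr' (kb * w) = gam lr lr' w *m gam lr lr' kb.
    by rewrite gamM// mulrC.
  by rewrite (gG _ u0) /Phi !mulmxA mulmxK.
have rhs (u w : C) : u != 0 -> w != 0 -> gam m m' (kb * w) *m (invmx (gam m m' kb) *m gam mr mr' (ka * u) *m gam m m' kb) =
    Psi u w *m (gam mr mr' ka *m gam m m' kb).
  move=> u0 w0; have -> : gam mr mr' (ka * u) = gam mr mr' u *m gam mr mr' ka.
    by rewrite gamM// mulrC.
  by rewrite (gH _ w0) /Psi !mulmxA mulmxK.
(* At [la = 1] both full products are the identity. The constant right-hand factors left by the
   change of normalisation are therefore inverse to the same matrix, and agree. *)
have K1 : Phi (cay al 1) (cay be 1) *m (gam lr lr' kb *m gam l l' ka) = 1%:M.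
  by rewrite -lhs// ka1 kb1 gam1 mul1mx gam1 mulmx1 mulVmx.
have K2 : Phi (cay al 1) (cay be 1) *m (gam mr mr' ka *m gam m m' kb) = 1%:M.
  by rewrite P1 -rhs// ka1 kb1 gam1 mul1mx gam1 mulmx1 mulVmx.
have KK : gam lr lr' kb *m gam l l' ka = gam mr mr' ka *m gam m m' kb.
  have [uP _] := mulmx1_unit K1.
  by rewrite -[LHS](mulKmx uP) K1 -K2 mulKmx.
case: xy => [[-> ->]|[la [q1 q2 q3 q4 [-> ->]]]].
  have := lhs 1 1 (oner_neq0 _) (oner_neq0 _); rewrite !mulr1 => ->.
  have := rhs 1 1 (oner_neq0 _) (oner_neq0 _); rewrite !mulr1 => ->.
  by rewrite /Phi /Psi !gam1 KK.
by rewrite lhs ?rhs ?PP ?KK//; exact: cay_eq0.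
Qed.

End Permutability.

(** * Gauging by a simple factor *)

Section PolynomialFamilies.
Context {K : fieldType}.

Definition polyf k (f : K -> K) :=
  exists2 p : {poly K}, (size p <= k.+1)%N & forall x, f x = p.[x].

Lemma polyfD k f g : polyf k f -> polyf k g -> polyf k (fun x => f x + g x).
Proof.
move=> [p sp fp] [q sq gq]; exists (p + q); last by move=> x; rewrite hornerD fp gq.
by rewrite (leq_trans (size_polyD _ _))// geq_max sp.
Qed.

Lemma polyfZ k c f : polyf k f -> polyf k (fun x => c * f x).
Proof.
move=> [p sp fp]; exists (c *: p); last by move=> x; rewrite hornerZ fp.
exact: leq_trans (size_scale_leq _ _) sp.
Qed.

Lemma polyf_cst k c : polyf k (fun=> c).
Proof. by exists c%:P => [|x]; rewrite ?hornerC// (leq_trans (size_polyC_leq1 _)). Qed.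

Lemma polyf_ext k f g : (forall x, f x = g x) -> polyf k f -> polyf k g.
Proof. by move=> fg [p sp fp]; exists p => // x; rewrite -fg. Qed.

Lemma polyf_sum k (I : Type) (s : seq I) (f : I -> K -> K) :
  (forall i, polyf k (f i)) -> polyf k (fun x => \sum_(i <- s) f i x).
Proof.
move=> h; elim: s => [|i s ih].
  by apply: polyf_ext (polyf_cst k 0) => x; rewrite big_nil.
by apply: polyf_ext (polyfD (h i) ih) => x; rewrite big_cons.
Qed.

(** The root at [al] is divided out and replaced by one at [- al], which keeps the degree bound. *)
Lemma polyf_div k f al c : polyf k f -> f al = 0 ->
  exists2 g, polyf k g & forall x, x - al != 0 -> g x = c * (x + al) / (x - al) * f x.
Proof.
move=> [p sp fp] f0; have /factor_theorem[q pq] : root p al by rewrite /root -fp f0.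
exists (fun x => (c *: (q * ('X + al%:P))).[x]).
  exists (c *: (q * ('X + al%:P))) => //.
  apply: leq_trans (size_scale_leq _ _) _; have [->|q0] := eqVneq q 0; first by rewrite mul0r size_poly0.
  move: sp; rewrite pq size_Mmonic ?monicXsubC// size_XsubC addn2 /= => sq.
  by apply: leq_trans (size_polyMleq _ _) _; rewrite size_XaddC addn2.
move=> x x0; rewrite fp pq hornerZ !hornerM hornerD hornerX hornerC hornerXsubC.
by field.
Qed.

Definition polymx k m n (F : K -> 'M[K]_(m, n)) :=
  forall i j, polyf k (fun x => F x i j).

Lemma polymxD k m n (F G : K -> 'M[K]_(m, n)) :
  polymx k F -> polymx k G -> polymx k (fun x => F x + G x).
Proof. by move=> hF hG i j; apply: polyf_ext (polyfD (hF i j) (hG i j)) => x; rewrite mxE. Qed.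

Lemma polymxB k m n (F G : K -> 'M[K]_(m, n)) :
  polymx k F -> polymx k G -> polymx k (fun x => F x - G x).
Proof.
move=> hF hG i j; apply: polyf_ext (polyfD (hF i j) (polyfZ (-1) (hG i j))) => x.
by rewrite !mxE mulN1r.
Qed.

Lemma polymx_cst k m n (M : 'M[K]_(m, n)) : polymx k (fun=> M).
Proof. by move=> i j; exact: polyf_cst. Qed.

Lemma polymx_ext k m n (F G : K -> 'M[K]_(m, n)) : (forall x, F x = G x) -> polymx k F -> polymx k G.
Proof. by move=> FG hF i j; apply: polyf_ext (hF i j) => x; rewrite FG. Qed.

Lemma polymx_tr k m n (F : K -> 'M[K]_(m, n)) : polymx k F -> polymx k (fun x => (F x)^T).
Proof. by move=> hF i j; apply: polyf_ext (hF j i) => x; rewrite mxE. Qed.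

Lemma polymxMl k m n p (M : 'M[K]_(m, n)) (F : K -> 'M[K]_(n, p)) :
  polymx k F -> polymx k (fun x => M *m F x).
Proof.
move=> hF i j; apply: (@polyf_ext _ (fun x => \sum_l M i l * F x l j)).
  by move=> x; rewrite mxE.
by apply: polyf_sum => l; apply: polyfZ; exact: hF.
Qed.

Lemma polymxMr k m n p (M : 'M[K]_(n, p)) (F : K -> 'M[K]_(m, n)) :
  polymx k F -> polymx k (fun x => F x *m M).
Proof.
move=> hF; have := polymx_tr (polymxMl M^T (polymx_tr hF)).
by apply: polymx_ext => x; rewrite trmx_mul !trmxK.
Qed.

Lemma polymx_div k m n (F : K -> 'M[K]_(m, n)) al c : polymx k F -> F al = 0 ->
  exists2 G, polymx k G & forall x, x - al != 0 -> G x = (c * (x + al) / (x - al)) *: F x.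
Proof.
move=> hF F0; have h i j : exists2 g, polyf k g & forall x, x - al != 0 -> g x = c * (x + al) / (x - al) * F x i j.
  by apply: (polyf_div (f := fun x => F x i j)) => //; rewrite F0 mxE.
have /choice[G GP] : forall ij : 'I_m * 'I_n, exists g, polyf k g /\
    forall x, x - al != 0 -> g x = c * (x + al) / (x - al) * F x ij.1 ij.2.
  by move=> [i j]; have [g g1 g2] := h i j; exists g.
exists (fun x => \matrix_(i, j) G (i, j) x).
  by move=> i j; apply: polyf_ext (GP (i, j)).1 => x; rewrite mxE.
by move=> x x0; apply/matrixP => i j; rewrite !mxE (GP (i, j)).2.
Qed.

End PolynomialFamilies.

Section GaugeStep.
Context {R : realType} {n : nat}.
Local Notation C := (R[i]).
Local Notation N := n.+2.
Local Notation eta := (lorentz C n).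
Implicit Types (u v w l m : 'rV[C]_N) (A : 'M[C]_N) (c k al : C).

Definition skew A := forall u v, inner (u *m A) v = - inner u (v *m A).

(* The derivative of [gam l m c] when [l], [m] have derivatives [l1], [m1]
   and [inner l m = 1]. *)
Definition dgam l l1 m m1 c : 'M[C]_N :=
  (c - 1) *: (eta *m m1^T *m l + eta *m m^T *m l1)
  + (c^-1 - 1) *: (eta *m l1^T *m m + eta *m l^T *m m1).

Lemma dgamE v l l1 m m1 c : v *m dgam l l1 m m1 c =
  (c - 1) *: (inner v m1 *: l + inner v m *: l1)
  + (c^-1 - 1) *: (inner v l1 *: m + inner v l *: m1).
Proof. by rewrite /dgam mulmxDr -!scalemxAr !mulmxDr !outerE. Qed.

Definition wedge u v : 'M[C]_N := eta *m u^T *m v - eta *m v^T *m u.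

Lemma wedgeE w u v : w *m wedge u v = inner w u *: v - inner w v *: u.
Proof. by rewrite /wedge mulmxBr !outerE. Qed.

Lemma wedge_skew u v : skew (wedge u v).
Proof.
move=> x y; rewrite !wedgeE innerBl innerBr !innerZl !innerZr (innerC v) (innerC u).
by ring.
Qed.

Lemma skewD A B : skew A -> skew B -> skew (A + B).
Proof. by move=> hA hB u v; rewrite !mulmxDr innerDl innerDr hA hB opprD. Qed.

Lemma skewZ c A : skew A -> skew (c *: A).
Proof. by move=> hA u v; rewrite -!scalemxAr innerZl innerZr hA mulrN. Qed.

(** [p] and [q] are the covariant derivatives of [l] and [m]. Conjugation by the factor has only the
    eigenvalues [c], 1 and [c^-1] on skew endomorphisms, because a line has zero exterior square.
    The correcting terms project [q] and [p] to the orthogonal complement of the plane of [l] and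
    [m], where they vanish for parallel lines. *)
Lemma gauge_expansion A l l1 m m1 c : skew A -> c != 0 ->
  inner l l = 0 -> inner m m = 0 -> inner l m = 1 ->
  inner l1 l = 0 -> inner m1 m = 0 -> inner l m1 = - inner l1 m ->
  let p := l1 + l *m A in let q := m1 + m *m A in
  dgam l l1 m m1 c^-1 *m gam l m c + gam l m c^-1 *m A *m gam l m c =
  A + (c - 1) *: wedge l (q + inner p m *: m) + (c^-1 - 1) *: wedge m (p - inner p m *: l).
Proof.
move=> sA c0 h1 h2 h3 h4 h5 h6 p q; rewrite {}/p {}/q; apply: eq_row_action => v.
have lA : inner (l *m A) l = 0.
  have /eqP := sA l l; rewrite (innerC l) -addr_eq0 -mulr2n -mulr_natl mulf_eq0 pnatr_eq0 /=.
  by move/eqP.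
have mA : inner (m *m A) m = 0.
  have /eqP := sA m m; rewrite (innerC m) -addr_eq0 -mulr2n -mulr_natl mulf_eq0 pnatr_eq0 /=.
  by move/eqP.
have lmA : inner (m *m A) l = - inner (l *m A) m by rewrite innerC sA opprK.
have vl : inner (v *m A) l = - inner (l *m A) v by rewrite sA innerC.
have vm : inner (v *m A) m = - inner (m *m A) v by rewrite sA innerC.
have W : v *m (dgam l l1 m m1 c^-1 *m gam l m c + gam l m c^-1 *m A *m gam l m c) =
    (v *m dgam l l1 m m1 c^-1 + v *m gam l m c^-1 *m A) *m gam l m c.
  by rewrite mulmxDl mulmxDr !mulmxA.
have wA : v *m gam l m c^-1 *m A = v *m A
    + ((c^-1 - 1) * inner v m) *: (l *m A) + ((c - 1) * inner v l) *: (m *m A).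
  by rewrite gamE h3 !divr1 invrK !mulmxDl -!scalemxAl.
rewrite {}W {}wA dgamE invrK gamE h3 !divr1.
rewrite !mulmxDr -!scalemxAr !wedgeE.
have innerNr x y : inner x (- y) = - inner x y by rewrite -scaleN1r innerZr mulN1r.
rewrite !(innerNr, innerDl, innerZl, innerDr, innerZr).
rewrite (innerC m l) (innerC m1 l) h1 h2 h3 h4 h5 h6 lA mA lmA vl vm.
rewrite (innerC (l *m A) v) (innerC (m *m A) v).
move: (inner l1 m) (inner (l *m A) m) (inner v l) (inner v m) (inner v l1) (inner v m1).
move: (inner v (l *m A)) (inner v (m *m A)) => i1 i2 i3 i4 i5 i6 i7 i8.
apply/rowP => j; rewrite !mxE.
move: (v 0 j) (l 0 j) (m 0 j) (l1 0 j) (m1 0 j).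
move: (\sum_(j0 < N) v 0 j0 * A j0 j) (\sum_(j0 < N) l 0 j0 * A j0 j) (\sum_(j0 < N) m 0 j0 * A j0 j).
move=> vA lA' mA' vj lj mj l1j m1j.
by field.
Qed.

(* The coefficients of [c] and [c^-1] in [gauge_expansion] vanish at the zero
   [- al] of [c^-1] and at the zero [al] of [c] respectively. *)
Lemma gauge_step (d : nat) (A : C -> 'M[C]_N) l l1 m m1 (al ka : C) : polymx d A -> ka != 0 ->
  inner l l = 0 -> inner m m = 0 -> inner l m = 1 ->
  inner l1 l = 0 -> inner m1 m = 0 -> inner l m1 = - inner l1 m -> skew (A (- al)) ->
  ((l1 + l *m A al)%R <= l)%MS -> ((m1 + m *m A (- al))%R <= m)%MS ->
  exists2 B, polymx d B & forall la, skew (A la) -> la - al != 0 -> la + al != 0 ->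
   let c := ka * cay al la in
   dgam l l1 m m1 c^-1 *m gam l m c + gam l m c^-1 *m A la *m gam l m c = B la /\ skew (B la).
Proof.
move=> pA ka0 h1 h2 h3 h4 h5 h6 sA H1 H2.
have [k1 e1] : exists a, l1 + l *m A al = a *: l by apply/sub_rVP.
have [k2 e2] : exists a, m1 + m *m A (- al) = a *: m by apply/sub_rVP.
pose p (la : C) := l1 + l *m A la; pose q (la : C) := m1 + m *m A la.
have pp : polymx d p by apply: polymxD (polymx_cst d l1) (polymxMl l pA).
have pq : polymx d q by apply: polymxD (polymx_cst d m1) (polymxMl m pA).
have pt (f : C -> 'rV[C]_N) u v : polymx d f -> polymx d (fun la => inner (f la) u *: v).
  move=> pf; have := polymxMr (eta *m u^T *m v) pf.
  by apply: polymx_ext => la; rewrite outerE.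
have pw (f : C -> 'rV[C]_N) u : polymx d f -> polymx d (fun la => wedge u (f la)).
  move=> pf; rewrite /wedge; apply: polymxB; first exact: polymxMl.
  apply: (@polymxMr _ _ _ _ _ u (fun la => eta *m (f la)^T)).
  by apply: polymxMl; exact: polymx_tr.
pose X1 (la : C) := wedge m (p la - inner (p la) m *: l).
pose X2 (la : C) := wedge l (q la + inner (p la) m *: m).
have pX1 : polymx d X1 by apply: pw; apply: polymxB pp (pt _ _ _ pp).
have pX2 : polymx d X2 by apply: pw; apply: polymxD pq (pt _ _ _ pp).
have w0 u : wedge u 0 = 0 by rewrite /wedge mulmx0 trmx0 mulmx0 mul0mx subrr.
have X10 : X1 al = 0.
  by rewrite /X1 /p e1 innerZl h3 mulr1 subrr w0.
(* At [- al] it is [m] that is parallel; skewness of [A (- al)] makes the component of [p] along [l]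
   minus the eigenvalue of [m], so that the correction cancels [q]. *)
have tE : inner (p (- al)) m = - k2.
  rewrite /p innerDl sA; have -> : m *m A (- al) = k2 *: m - m1 by rewrite -e2 addrC addKr.
  by rewrite innerBr innerZr h3 h6; ring.
have X20 : X2 (- al) = 0 by rewrite /X2 tE /q e2 scaleNr subrr w0.
have [Y1 pY1 Y1E] := polymx_div ka^-1 pX1 X10.
have [Y2 pY2 Y2E] := polymx_div ka pX2 X20.
(* [Y2] and [Y1] extend [c *: X2] and [c^-1 *: X1] across the poles of [c] and of [c^-1]. *)
exists (fun la => A la + (Y2 la - X2 la) + (Y1 la - X1 la)).
  by apply: polymxD; [apply: polymxD => //|]; exact: polymxB.
move=> la sAl la1 la2 c.
have cE : c = ka * (la - al) / (la + al) by rewrite /c /cay mulrA.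
have c0 : c != 0 by rewrite cE !mulf_neq0// invr_eq0.
have Y1c : Y1 la = c^-1 *: X1 la by rewrite Y1E// cE; congr (_ *: _); field; rewrite la1 la2 ka0.
have Y2c : Y2 la = c *: X2 la by rewrite Y2E ?opprK// cE.
have BE : A la + (Y2 la - X2 la) + (Y1 la - X1 la) =
    A la + (c - 1) *: X2 la + (c^-1 - 1) *: X1 la.
  by rewrite Y1c Y2c !scalerBl !scale1r.
rewrite BE; split.
  exact: (gauge_expansion sAl c0 h1 h2 h3 h4 h5 h6).
by apply: skewD; [apply: skewD => //|]; apply: skewZ; exact: wedge_skew.
Qed.

End GaugeStep.

(** * Calculus on a Riemann surface *)

Section SurfaceCalculus.
Context {R : realType} {S : riemannSurface R}.
Local Notation C := (R[i]).
Local Notation coord := (@Defs.coord R S).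
Implicit Types (W : set S) (i j : chart S) (x : S) (f g : S -> C).

Lemma coord_image i W x : dom i x -> W x -> (coord i @` (dom i `&` W)) (coord i x).
Proof. by move=> dx Wx; exists x. Qed.

Lemma chartV_image i W z : (coord i @` (dom i `&` W)) z ->
  [/\ dom i (chartV i z), W (chartV i z) & coord i (chartV i z) = z].
Proof. by move=> [x [dx Wx] <-]; rewrite coordK. Qed.

Lemma open_coord_image i W : open W -> open (coord i @` (dom i `&` W)).
Proof.
move=> oW; rewrite openE => z zI; have [dz_ Wz _] := chartV_image zI.
have rz : (coord i @` dom i) z by case: zI => x [dx _] <-; exists x.
have n1 : nbhs z (coord i @` dom i).
  by apply: open_nbhs_nbhs; split => //; exact: range_open.
have n2 : nbhs z (chartV i @^-1` W).
  by apply: (chartV_continuous rz); apply: open_nbhs_nbhs.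
apply: filterS2 n1 n2 => y [x dx <-]; rewrite /preimage /= coordK// => Wx.
exact: coord_image.
Qed.

Definition smooth_fun W f := forall i, smooth (coord i @` (dom i `&` W)) (f \o chartV i).

Section Closure.
Variable W : set S.
Hypothesis oW : open W.
Let oI i : open (coord i @` (dom i `&` W)).
Proof. exact: open_coord_image. Qed.

Lemma smooth_fun_ext f g : (forall x, W x -> f x = g x) -> smooth_fun W f -> smooth_fun W g.
Proof.
move=> fg sf i; apply: (@smooth_ext _ _ (f \o chartV i) (g \o chartV i) (@oI i) _ (sf i)).
by move=> z /chartV_image[_ Wz _]; exact: fg.
Qed.

Lemma smooth_fun_cst (c : C) : smooth_fun W (fun=> c).
Proof. by move=> i; exact: (smooth_cst c (@oI i)). Qed.

Lemma smooth_funD f g : smooth_fun W f -> smooth_fun W g -> smooth_fun W (fun x => f x + g x).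
Proof. by move=> sf sg i; exact: (smoothD (@oI i) (sf i) (sg i)). Qed.

Lemma smooth_funM f g : smooth_fun W f -> smooth_fun W g -> smooth_fun W (fun x => f x * g x).
Proof. by move=> sf sg i; exact: (smoothM (@oI i) (sf i) (sg i)). Qed.

Lemma smooth_fun_conj f : smooth_fun W f -> smooth_fun W (fun x => (f x)^*%C).
Proof. by move=> sf i; exact: (smooth_conj (@oI i) (sf i)). Qed.

Lemma smooth_funV f : (forall x, W x -> f x != 0) -> smooth_fun W f ->
  smooth_fun W (fun x => (f x)^-1).
Proof.
move=> f0 sf i; apply: (@smoothV _ _ (f \o chartV i) (@oI i) _ (sf i)) => z /chartV_image[_ Wz _].
exact: f0.
Qed.

Lemma smooth_fun_sum (I : Type) (s : seq I) (f : I -> S -> C) :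
  (forall k, smooth_fun W (f k)) -> smooth_fun W (fun x => \sum_(k <- s) f k x).
Proof. by move=> sf i; exact: (smooth_sum s (@oI i) (fun k => sf k i)). Qed.

Lemma smooth_fun_prod (I : Type) (s : seq I) (f : I -> S -> C) :
  (forall k, smooth_fun W (f k)) -> smooth_fun W (fun x => \prod_(k <- s) f k x).
Proof.
move=> sf; elim: s => [|k s ih].
  by apply: (smooth_fun_ext _ (smooth_fun_cst 1)) => x _; rewrite big_nil.
by apply: (smooth_fun_ext _ (smooth_funM (sf k) ih)) => x _; rewrite big_cons.
Qed.

Lemma smooth_mxP m n (F : S -> 'M[C]_(m, n)) :
  smooth_mx W F <-> forall a b, smooth_fun W (fun x => F x a b).
Proof. by split=> h; [move=> a b i; exact: h|move=> i a b; exact: (h a b i)]. Qed.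

Lemma smooth_mx_ext m n (F G : S -> 'M[C]_(m, n)) : (forall x, W x -> F x = G x) ->
  smooth_mx W F -> smooth_mx W G.
Proof.
move=> FG /smooth_mxP sF; apply/smooth_mxP => a b.
by apply: smooth_fun_ext (sF a b) => x Wx; rewrite FG.
Qed.

Lemma smooth_mx_cst m n (M : 'M[C]_(m, n)) : smooth_mx W (fun=> M).
Proof. by apply/smooth_mxP => a b; exact: smooth_fun_cst. Qed.

Lemma smooth_mxD m n (F G : S -> 'M[C]_(m, n)) : smooth_mx W F -> smooth_mx W G ->
  smooth_mx W (fun x => F x + G x).
Proof.
move=> /smooth_mxP sF /smooth_mxP sG; apply/smooth_mxP => a b.
by apply: smooth_fun_ext (smooth_funD (sF a b) (sG a b)) => x _; rewrite mxE.
Qed.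

Lemma smooth_mxZ m n f (F : S -> 'M[C]_(m, n)) : smooth_fun W f -> smooth_mx W F ->
  smooth_mx W (fun x => f x *: F x).
Proof.
move=> sf /smooth_mxP sF; apply/smooth_mxP => a b.
by apply: smooth_fun_ext (smooth_funM sf (sF a b)) => x _; rewrite mxE.
Qed.

Lemma smooth_mxM m n p (F : S -> 'M[C]_(m, n)) (G : S -> 'M[C]_(n, p)) :
  smooth_mx W F -> smooth_mx W G -> smooth_mx W (fun x => F x *m G x).
Proof.
move=> /smooth_mxP sF /smooth_mxP sG; apply/smooth_mxP => a b.
apply: (@smooth_fun_ext (fun x => \sum_(k <- index_enum 'I_n) F x a k * G x k b)).
  by move=> x _; rewrite mxE.
by apply: smooth_fun_sum => k; apply: smooth_funM; [exact: sF|exact: sG].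
Qed.

Lemma smooth_mx_tr m n (F : S -> 'M[C]_(m, n)) : smooth_mx W F ->
  smooth_mx W (fun x => (F x)^T).
Proof.
move=> /smooth_mxP sF; apply/smooth_mxP => a b.
by apply: smooth_fun_ext (sF b a) => x _; rewrite mxE.
Qed.

Lemma smooth_mx_conj m n (F : S -> 'M[C]_(m, n)) : smooth_mx W F ->
  smooth_mx W (fun x => conj_mx (F x)).
Proof.
move=> /smooth_mxP sF; apply/smooth_mxP => a b.
by apply: smooth_fun_ext (smooth_fun_conj (sF a b)) => x _; rewrite mxE.
Qed.

Lemma smooth_det n (F : S -> 'M[C]_n) : smooth_mx W F -> smooth_fun W (fun x => \det (F x)).
Proof.
move=> /smooth_mxP sF; rewrite /determinant; apply: smooth_fun_sum => s.
apply: smooth_funM; first exact: smooth_fun_cst.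
by apply: smooth_fun_prod => k; exact: sF.
Qed.

Lemma smooth_mx_inv n (F : S -> 'M[C]_n) : (forall x, W x -> F x \in unitmx) ->
  smooth_mx W F -> smooth_mx W (fun x => invmx (F x)).
Proof.
move=> uF sF; apply: (@smooth_mx_ext _ _ (fun x => (\det (F x))^-1 *: \adj (F x))).
  by move=> x Wx; rewrite /invmx uF.
apply: smooth_mxZ.
  apply: smooth_funV (smooth_det sF) => x Wx.
  by have := uF x Wx; rewrite unitmxE unitfE.
apply/smooth_mxP => a b; apply: (@smooth_fun_ext (fun x => cofactor (F x) b a)).
  by move=> x _; rewrite mxE.
rewrite /cofactor; apply: smooth_funM; first exact: smooth_fun_cst.
apply: smooth_det; apply/smooth_mxP => c d; move/smooth_mxP : sF => sF.
by apply: smooth_fun_ext (sF (lift b c) (lift a d)) => x _; rewrite !mxE.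
Qed.

End Closure.

Lemma smooth_mx_sub W W' m n (F : S -> 'M[C]_(m, n)) : W' `<=` W -> smooth_mx W F ->
  smooth_mx W' F.
Proof.
move=> sW sF i a b; apply: smooth_sub (sF i a b) => z [x [dx Wx] <-].
by apply: coord_image => //; exact: sW.
Qed.

Lemma smooth_mx_local W m n (F : S -> 'M[C]_(m, n)) :
  (forall x, W x -> exists W', W' x /\ smooth_mx W' F) -> smooth_mx W F.
Proof.
move=> h i a b; apply: smooth_local => z [x [dx Wx] <-].
have [W' [W'x sF]] := h x Wx; exists (coord i @` (dom i `&` W')); first exact: coord_image.
exact: sF.
Qed.

Lemma smooth_inner W n (u v : S -> 'rV[C]_n.+2) : open W -> smooth_mx W u -> smooth_mx W v ->
  smooth_fun W (fun x => inner (u x) (v x)).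
Proof.
move=> oW su sv; rewrite /inner.
have h : smooth_mx W (fun x => u x *m lorentz C n *m (v x)^T).
  apply: smooth_mxM => //; last exact: smooth_mx_tr.
  by apply: smooth_mxM => //; exact: smooth_mx_cst.
by move/smooth_mxP : h; exact.
Qed.

End SurfaceCalculus.

Section Derivations.
Context {R : realType} {S : riemannSurface R}.
Local Notation C := (R[i]).
Local Notation coord := (@Defs.coord R S).
Implicit Types (W : set S) (i j : chart S) (x : S) (f g : S -> C) (b : bool).

(* The Boolean selects the (1,0) part ([false]) or the (0,1) part ([true]). *)
Definition dd b i f x : C := if b then dzb i f x else dz i f x.
Definition ddmx b m n i (F : S -> 'M[C]_(m, n)) x : 'M[C]_(m, n) :=
  \matrix_(p, q) dd b i (fun y => F y p q) x.
Definition dtr b i j x : C := if b then (dtransition i j x)^*%C else dtransition i j x.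

Lemma ddE b i f x : dd b i f x = (rderive (f \o chartV i) (coord i x) 1
   + (-1) ^+ (~~ b) * 'i%C * rderive (f \o chartV i) (coord i x) 'i%C) / 2.
Proof. by rewrite /dd /dz /dzb; case: b => /=; rewrite ?expr0 ?expr1 ?mul1r// mulN1r mulNr. Qed.

Section At.
Variables (W : set S) (b : bool) (i : chart S) (x : S).
Hypotheses (oW : open W) (Wx : W x) (dx : dom i x).
Let cx : (coord i @` (dom i `&` W)) (coord i x) := coord_image dx Wx.
Let oI : open (coord i @` (dom i `&` W)) := @open_coord_image _ _ i _ oW.
Let v1 : (1 : C) = 1 \/ (1 : C) = 'i%C := or_introl erefl.
Let vi : ('i%C : C) = 1 \/ ('i%C : C) = 'i%C := or_intror erefl.

Lemma dd_rder f l m : rder (f \o chartV i) (coord i x) 1 l ->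
  rder (f \o chartV i) (coord i x) 'i%C m -> dd b i f x = (l + (-1) ^+ (~~ b) * 'i%C * m) / 2.
Proof. by move=> h1 h2; rewrite ddE (rder_rderive h1) (rder_rderive h2). Qed.

Lemma dd_eq f g : smooth_fun W f -> (forall y, W y -> f y = g y) -> dd b i f x = dd b i g x.
Proof.
move=> sf fg; have h v : v = 1 \/ v = 'i%C ->
    rder (g \o chartV i) (coord i x) v (rderive (f \o chartV i) (coord i x) v).
  move=> hv; apply: (@rder_open_eq _ _ (f \o chartV i) _ _ _ _ oI cx).
    by move=> y /chartV_image[_ Wy _]; exact: fg.
  exact: (smooth_rder (sf i) cx hv).
by rewrite (dd_rder (h _ v1) (h _ vi)) ddE.
Qed.

Lemma dd_cst (c : C) : dd b i (fun=> c) x = 0.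
Proof. by rewrite (dd_rder (rder_cst c _ _) (rder_cst c _ _)) mulr0 addr0 mul0r. Qed.

Lemma ddD f g : smooth_fun W f -> smooth_fun W g ->
  dd b i (fun y => f y + g y) x = dd b i f x + dd b i g x.
Proof.
move=> sf sg; have h v (hv : v = 1 \/ v = 'i%C) :=
  rderD (smooth_rder (sf i) cx hv) (smooth_rder (sg i) cx hv).
by rewrite (dd_rder (h _ v1) (h _ vi)) !ddE -mulrDl; congr (_ / _); ring.
Qed.

Lemma ddM f g : smooth_fun W f -> smooth_fun W g ->
  dd b i (fun y => f y * g y) x = dd b i f x * g x + f x * dd b i g x.
Proof.
move=> sf sg; have h v (hv : v = 1 \/ v = 'i%C) :=
  rderM (smooth_rder (sf i) cx hv) (smooth_rder (sg i) cx hv).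
rewrite (dd_rder (h _ v1) (h _ vi)) !ddE /= coordK//.
move: (rderive _ _ _) (rderive _ _ _) (rderive _ _ _) (rderive _ _ _) (2^-1) => p q r s t.
by ring.
Qed.

Lemma dd_sum (I : Type) (s : seq I) (f : I -> S -> C) : (forall k, smooth_fun W (f k)) ->
  dd b i (fun y => \sum_(k <- s) f k y) x = \sum_(k <- s) dd b i (f k) x.
Proof.
move=> sf; elim: s => [|k s ih].
  rewrite big_nil; apply: etrans (dd_cst 0); apply/esym/dd_eq; first exact: smooth_fun_cst.
  by move=> y _; rewrite big_nil.
rewrite big_cons -ih -(ddD (sf k) (smooth_fun_sum oW s sf)).
apply/esym; apply: dd_eq => [|y _]; last by rewrite big_cons.
by apply: smooth_funD => //; exact: smooth_fun_sum.
Qed.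

Lemma ddmx_eq m n (F G : S -> 'M[C]_(m, n)) : smooth_mx W F -> (forall y, W y -> F y = G y) ->
  ddmx b i F x = ddmx b i G x.
Proof.
move=> /(smooth_mxP) sF FG; apply/matrixP => p q; rewrite !mxE.
by apply: dd_eq => // y Wy; rewrite FG.
Qed.

Lemma ddmx_cst m n (M : 'M[C]_(m, n)) : ddmx b i (fun=> M) x = 0.
Proof. by apply/matrixP => p q; rewrite !mxE dd_cst. Qed.

Lemma ddmxD m n (F G : S -> 'M[C]_(m, n)) : smooth_mx W F -> smooth_mx W G ->
  ddmx b i (fun y => F y + G y) x = ddmx b i F x + ddmx b i G x.
Proof.
move=> /smooth_mxP sF /smooth_mxP sG; apply/matrixP => p q; rewrite !mxE -(ddD (sF p q) (sG p q)).
apply/esym; apply: dd_eq => [|y _]; last by rewrite mxE.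
exact: smooth_funD.
Qed.

Lemma ddmxM m n p (F : S -> 'M[C]_(m, n)) (G : S -> 'M[C]_(n, p)) :
  smooth_mx W F -> smooth_mx W G ->
  ddmx b i (fun y => F y *m G y) x = ddmx b i F x *m G x + F x *m ddmx b i G x.
Proof.
move=> /smooth_mxP sF /smooth_mxP sG; apply/matrixP => u v; rewrite !mxE.
have sFG k : smooth_fun W (fun y => F y u k * G y k v) by apply: smooth_funM.
rewrite -(@dd_eq (fun y => \sum_(k <- index_enum 'I_n) F y u k * G y k v)); last 2 first.
  exact: smooth_fun_sum.
  by move=> y _; rewrite mxE.
rewrite dd_sum// -big_split; apply: eq_bigr => k _ /=.
by rewrite ddM// !mxE.
Qed.

Lemma ddmx_tr m n (F : S -> 'M[C]_(m, n)) : ddmx b i (fun y => (F y)^T) x = (ddmx b i F x)^T.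
Proof.
apply/matrixP => p q; rewrite [LHS]mxE [RHS]mxE [RHS]mxE.
by rewrite (_ : (fun y => (F y)^T p q) = (fun y => F y q p))//; apply/funext => y; rewrite mxE.
Qed.

Lemma ddmxZ m n (c : C) (F : S -> 'M[C]_(m, n)) : smooth_mx W F ->
  ddmx b i (fun y => c *: F y) x = c *: ddmx b i F x.
Proof.
move=> sF; have := ddmxM (smooth_mx_cst oW c%:M) sF; rewrite ddmx_cst mul0mx add0r mul_scalar_mx => <-.
apply: ddmx_eq => [|y _]; last by rewrite mul_scalar_mx.
by apply: smooth_mxZ => //; exact: smooth_fun_cst.
Qed.

Lemma dd_inner n (u v : S -> 'rV[C]_n.+2) : smooth_mx W u -> smooth_mx W v ->
  dd b i (fun y => inner (u y) (v y)) x = inner (ddmx b i u x) (v x) + inner (u x) (ddmx b i v x).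
Proof.
move=> su sv.
have ce : smooth_mx W (fun=> lorentz C n) by exact: smooth_mx_cst.
have sue : smooth_mx W (fun y => u y *m lorentz C n) by exact: smooth_mxM.
have svt : smooth_mx W (fun y => (v y)^T) by exact: smooth_mx_tr.
have := ddmxM sue svt; rewrite ddmx_tr (ddmxM su ce) ddmx_cst mulmx0 addr0.
by move=> /matrixP/(_ 0 0); rewrite [LHS]mxE [RHS]mxE.
Qed.

End At.

(** The real differential of a holomorphic transition is multiplication by a complex number [p], so
    the [dz] part scales by [p] and the part along the conjugate differential by the conjugate of
    [p]. *)
Lemma dd_transition b i j x W f : open W -> W x -> dom i x -> dom j x -> smooth_fun W f ->
  dd b i f x = dtr b i j x * dd b j f x.
Proof.
move=> oW Wx dxi dxj sf.
have dphi : cder (coord j \o chartV i : R[i]^o -> R[i]^o) (coord i x) (dtransition i j x).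
  by apply: derivable_cder; exact: transition_holomorphic.
have phix : (coord j \o chartV i) (coord i x) = coord j x by rewrite /= coordK.
have oJ := @open_coord_image _ _ j _ oW.
have cj : (coord j @` (dom j `&` W)) ((coord j \o chartV i) (coord i x)).
  by rewrite phix; exact: coord_image.
have h v := rder_comp_holomorphic v oJ (sf j) cj dphi.
have oij : open (coord i @` (dom i `&` dom j)) by apply: open_coord_image; exact: dom_open.
have EQ y : (coord i @` (dom i `&` dom j)) y ->
    (f \o chartV j) ((coord j \o chartV i) y) = (f \o chartV i) y.
  by move=> /chartV_image[_ dj _]; rewrite /= coordK.
have k v := @rder_open_eq _ _ (fun y => (f \o chartV j) ((coord j \o chartV i) y)) (f \o chartV i)
  _ v _ oij (coord_image dxi dxj) EQ (h v).
rewrite phix in k.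
rewrite (dd_rder _ (k 1) (k 'i%C)) ddE /dtr.
move: (rderive _ _ _) (rderive _ _ _) (dtransition _ _ _) => s t p.
rewrite mulrA; congr (_ / _); rewrite mul1r.
have -> : (complex.Re ('i * p))%:C%C = - (complex.Im p)%:C%C by case: p => ? ? /=; rewrite mul0r mul1r sub0r rmorphN.
have -> : (complex.Im ('i * p))%:C%C = (complex.Re p)%:C%C by case: p => ? ? /=; rewrite mul0r mul1r add0r.
have i2 : 'i%C * 'i%C = -1 :> C by rewrite -expr2 sqr_i.
case: b => /=; rewrite ?expr0 ?expr1.
  rewrite (_ : p^*%C = (complex.Re p)%:C%C - 'i%C * (complex.Im p)%:C%C); last first.
    by case: p => p q; apply/eqP; rewrite eq_complex /= ?mul0r ?mul1r ?subr0 ?sub0r ?oppr0 ?addr0 ?add0r !eqxx.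
  move: (complex.Re p)%:C%C (complex.Im p)%:C%C => a c.
  ring: i2.
rewrite [in RHS](complexE p).
move: (complex.Re p)%:C%C (complex.Im p)%:C%C => a c.
ring: i2.
Qed.

End Derivations.

Section Connections.
Context {R : realType} {S : riemannSurface R}.
Local Notation C := (R[i]).
Local Notation coord := (@Defs.coord R S).
Implicit Types (W : set S) (i j : chart S) (x : S) (f : S -> C) (b : bool).

(** Transitions are only assumed complex differentiable; that their derivative is differentiable
    again is [derivable_derive]. *)
Lemma smooth_dtransition b i j :
  smooth (coord j @` (dom j `&` dom i)) (fun z => dtr b i j (chartV j z)).
Proof.
have oij := @open_coord_image _ S j _ (@dom_open R S i).
have oji := @open_coord_image _ S i _ (@dom_open R S j).
suff h : smooth (coord j @` (dom j `&` dom i)) (fun z => dtransition i j (chartV j z)).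
  by case: b => //; exact: (@smooth_conj _ _ (fun z => dtransition i j (chartV j z)) oij h).
apply: (@derivable_smooth _ _ (fun z => dtransition i j (chartV j z)) oij) => z zI.
have [djz diz zE] := chartV_image zI.
have h1 : derivable (coord i \o chartV j : R[i]^o -> R[i]^o) z 1.
  by rewrite -{1}zE; exact: transition_holomorphic.
have h2 : derivable ('D_1 (coord j \o chartV i : R[i]^o -> R[i]^o)) ((coord i \o chartV j) z) 1.
  apply: (@derivable_derive _ (coord i @` (dom i `&` dom j)) _ oji).
    by move=> y /chartV_image[diy djy yE]; rewrite -yE; exact: transition_holomorphic.
  exact: coord_image.
exact: cder_derivable (cder_comp (derivable_cder h1) (derivable_cder h2)).
Qed.

(** Smoothness is tested in every chart [j], while the derivative is taken in the chart [i]; the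
    transition rule rewrites it as a derivative in [j] times a smooth factor. *)
Lemma smooth_dd b i W f : open W -> smooth_fun W f -> smooth_fun (dom i `&` W) (dd b i f).
Proof.
move=> oW sf j; have oiW : open (dom i `&` W) by apply: openI => //; exact: dom_open.
have oJ := @open_coord_image _ S j _ oiW.
have sub1 : coord j @` (dom j `&` (dom i `&` W)) `<=` coord j @` (dom j `&` dom i).
  by move=> z [x [dx [dix Wx]] <-]; exact: coord_image.
have sub2 : coord j @` (dom j `&` (dom i `&` W)) `<=` coord j @` (dom j `&` W).
  by move=> z [x [dx [dix Wx]] <-]; exact: coord_image.
have s1 := smooth_sub sub1 (smooth_dtransition b i j).
have s2 := smooth_sub sub2 (sf j).
have d1 := smooth_rderive s2 (or_introl erefl).
have d2 := smooth_rderive s2 (or_intror erefl).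
have s3 := smoothM oJ (smooth_cst 2^-1 oJ)
  (smoothD oJ d1 (smoothM oJ (smooth_cst ((-1) ^+ (~~ b) * 'i%C) oJ) d2)).
apply: (@smooth_ext _ _ _ (dd b i f \o chartV j) oJ _ (smoothM oJ s1 s3)) => z zI.
have [djz [diz Wz] zE] := chartV_image zI.
rewrite /= (dd_transition b oW Wz diz djz sf) ddE zE.
by rewrite [2^-1 * _]mulrC.
Qed.

Lemma smooth_ddmx b i W m n (F : S -> 'M[C]_(m, n)) : open W -> smooth_mx W F ->
  smooth_mx (dom i `&` W) (ddmx b i F).
Proof.
move=> oW /smooth_mxP sF; apply/smooth_mxP => p q.
apply: (@smooth_fun_ext _ _ _ _ (dd b i (fun y => F y p q))).
- by apply: openI => //; exact: dom_open.
- by move=> x _; rewrite mxE.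
- exact: smooth_dd.
Qed.

Section Gauge.
Variable n : nat.
Local Notation N := n.+2.
Local Notation eta := (lorentz C n).
Implicit Types (A B : connection S N) (g : S -> 'M[C]_N) (s : S -> 'rV[C]_N).

Definition cn b A i x : 'M[C]_N := if b then conn01 A i x else conn10 A i x.
Definition nab b A i s x : 'rV[C]_N := ddmx b i s x + s x *m cn b A i x.

Lemma cn_smooth b A i : smooth_mx (dom i) (cn b A i).
Proof. by case: b; [exact: conn01_smooth|exact: conn10_smooth]. Qed.

Lemma cn_transition b A i j x : dom i x -> dom j x -> cn b A i x = dtr b i j x *: cn b A j x.
Proof. by case: b => di dj; [exact: conn01_transition|exact: conn10_transition]. Qed.

(** With endomorphisms acting on the right, [g o A o g^-1] takes [s] to the covariant derivative of
    [s g^-1], multiplied by [g]; this is its connection form. *)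
Definition gauge_form b g A i x : 'M[C]_N :=
  ddmx b i (fun y => invmx (g y)) x *m g x + invmx (g x) *m cn b A i x *m g x.

Lemma orthogonal_gauge_inv g : orthogonal_gauge g -> smooth_mx setT (fun x => invmx (g x)).
Proof.
move=> [sg og]; have oT := @openT S.
apply: (@smooth_mx_ext _ _ _ oT _ _ (fun x => eta *m (g x)^T *m eta)).
  by move=> x _; have [_ ->] := orthogonal_inv (og x).
apply: smooth_mxM => //; last exact: smooth_mx_cst.
by apply: smooth_mxM => //; [exact: smooth_mx_cst|exact: smooth_mx_tr].
Qed.

Lemma gauge_form_smooth b g A i : orthogonal_gauge g -> smooth_mx (dom i) (gauge_form b g A i).
Proof.
move=> og; have [sg _] := og; have sgi := orthogonal_gauge_inv og.
have oi := @dom_open _ S i.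
have s1 : smooth_mx (dom i) g by exact: smooth_mx_sub sg.
have s2 : smooth_mx (dom i) (fun x => invmx (g x)) by exact: smooth_mx_sub sgi.
apply: smooth_mxD => //.
  apply: smooth_mxM => //; have := smooth_ddmx b i (@openT S) sgi.
  by apply: smooth_mx_sub => x dx.
apply: smooth_mxM => //; apply: smooth_mxM => //; exact: cn_smooth.
Qed.

Lemma ddmx_transition b i j W m p (F : S -> 'M[C]_(m, p)) x : open W -> W x -> smooth_mx W F ->
  dom i x -> dom j x -> ddmx b i F x = dtr b i j x *: ddmx b j F x.
Proof.
move=> oW Wx /smooth_mxP sF di dj; apply/matrixP => k l.
rewrite [LHS]mxE [RHS]mxE [in RHS]mxE.
exact: (dd_transition b oW Wx di dj (sF k l)).
Qed.

Lemma gauge_form_transition b g A i j x : orthogonal_gauge g -> dom i x -> dom j x ->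
  gauge_form b g A i x = dtr b i j x *: gauge_form b g A j x.
Proof.
move=> og di dj; have sgi := orthogonal_gauge_inv og.
rewrite /gauge_form (ddmx_transition b (@openT S) I sgi di dj) (cn_transition b A di dj).
by rewrite -!scalemxAr -!scalemxAl scalerDr.
Qed.

Lemma gauge_formP g A B : orthogonal_gauge g ->
  (forall b i x, dom i x -> cn b B i x = gauge_form b g A i x) -> is_gauge_of g A B.
Proof.
move=> og BE W i s oW sW x Wx dx; have [sg ogx] := og.
have [gu _] := orthogonal_inv (ogx x).
have sgi : smooth_mx W (fun y => invmx (g y)) by apply: smooth_mx_sub (orthogonal_gauge_inv og).
have h b : nab b B i s x = nab b A i (fun y => s y *m invmx (g y)) x *m g x.
  rewrite /nab BE// (ddmxM b oW Wx dx sW sgi) /gauge_form mulmxDr !mulmxDl.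
  by rewrite (mulmxKV gu) -!mulmxA addrA.
by split; [exact: (h false)|exact: (h true)].
Qed.

End Gauge.
End Connections.

(** * Simple factors of bundles *)

Section SimpleFactorFields.
Context {R : realType} {S : riemannSurface R} {n : nat}.
Local Notation C := (R[i]).
Local Notation N := n.+2.
Local Notation eta := (lorentz C n).
Local Notation nondegenerate := (@Defs.nondegenerate R S n).
Implicit Types (V L : S -> 'M[C]_N) (x : S) (W : set S).

Lemma rho_smooth r V : subbundle r V -> nondegenerate V -> smooth_mx setT (rho V).
Proof.
move=> sV ndV; apply: smooth_mx_local => x0 _; have [W [F [oW Wx0 sF FV]]] := sV x0.
exists W; split=> //.
apply: (@smooth_mx_ext _ _ _ oW _ _ (fun x => 2 *: frame_proj (F x) + (- 1%:M))).
  by move=> x Wx; have [fF FVx] := FV x Wx; rewrite /rho (refl_frame fF FVx (ndV x)).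
have sFt : smooth_mx W (fun x => (F x)^T) by exact: smooth_mx_tr.
have ce : smooth_mx W (fun=> eta) by exact: smooth_mx_cst.
apply: smooth_mxD => //; last exact: smooth_mx_cst.
apply: smooth_mxZ => //; first exact: smooth_fun_cst.
rewrite /frame_proj; apply: smooth_mxM => //; apply: smooth_mxM => //; first exact: smooth_mxM.
apply: smooth_mx_inv => // [x Wx|]; last by do 2!apply: smooth_mxM => //.
by have [fF FVx] := FV x Wx; exact: gram_unit fF FVx (ndV x).
Qed.

Lemma rho_orthogonal_gauge r V : subbundle r V -> nondegenerate V -> orthogonal_gauge (rho V).
Proof. by move=> sV ndV; split; [exact: rho_smooth sV ndV|move=> x; exact: refl_orthogonal]. Qed.

Section OneFactor.
Variables V L : S -> 'M[C]_N.
Hypothesis rhoV : orthogonal_gauge (rho V).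
Hypothesis ndV : nondegenerate V.
Hypothesis nL : null_line_subbundle L.
Hypothesis cL : complementary L (bundle_image L (rho V)).

Let Lr := bundle_image L (rho V).

(** The second vector is [l rho] rescaled so that [(l, m) = 1] on a whole neighbourhood:
    [gauge_expansion] uses the derivative of this relation. *)
Lemma local_pair x0 : exists W (l m : S -> 'rV[C]_N),
  [/\ open W, W x0, smooth_mx W l, smooth_mx W m &
   forall x, W x -> [/\ (l x :=: L x)%MS, (m x :=: Lr x)%MS, null_pair (l x) (m x),
     inner (l x) (m x) = 1 & (l x *m rho V x :=: m x)%MS]].
Proof.
have [sL nLx] := nL; have [W [l [oW Wx0 sl lL]]] := sL x0.
have [srho orho] := rhoV.
have slr : smooth_mx W (fun x => l x *m rho V x).
  by apply: smooth_mxM => //; exact: smooth_mx_sub srho.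
have l0 x : W x -> inner (l x) (l x) = 0.
  move=> Wx; have [_ lLx] := lL x Wx; have /submxP[Y ->] : (l x <= L x)%MS by rewrite lLx.
  by rewrite /inner trmx_mul !mulmxA -!(mulmxA Y) nLx mul0mx mulmx0 mxE.
have a0 x : W x -> inner (l x) (l x *m rho V x) != 0.
  move=> Wx; have [_ lLx] := lL x Wx; have /submxP[X LX] : (L x <= l x)%MS by rewrite lLx.
  have E : L x *m eta *m (L x *m rho V x)^T = X *m (inner (l x) (l x *m rho V x))%:M *m X^T.
    by rewrite -innerE LX !trmx_mul !mulmxA.
  by apply: contra (cL x) => /eqP a0; rewrite E a0 raddf0 mulmx0 mul0mx.
pose m x := (inner (l x) (l x *m rho V x))^-1 *: (l x *m rho V x).
exists W, l, m; split=> //.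
  apply: smooth_mxZ => //; apply: smooth_funV => //.
  exact: smooth_inner.
move=> x Wx; have [_ lLx] := lL x Wx; have c0 : (inner (l x) (l x *m rho V x))^-1 != 0.
  by rewrite invr_eq0 a0.
have mE : (m x :=: l x *m rho V x)%MS by apply: eqmx_scale.
have m1 : inner (l x) (m x) = 1 by rewrite innerZr mulVf// a0.
split=> //.
- by apply: eqmx_trans mE _; apply: eqmxMr.
- by split; rewrite ?m1 ?oner_neq0 ?l0// innerZl innerZr inner_orthogonal// l0// !mulr0.
- exact: eqmx_sym.
Qed.

Definition factor c x : 'M[C]_N := Gamma (L x) (Lr x) c.

Lemma factorP x : exists l m : 'rV[C]_N, [/\ null_pair l m, (l :=: L x)%MS,
  (l *m rho V x :=: m)%MS & forall c, factor c x = gam l m c].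
Proof.
have [W [l [m [oW Wx _ _ h]]]] := local_pair x; have [h1 h2 h3 _ h5] := h x Wx.
by exists (l x), (m x); split=> // c; exact: Gamma_frame.
Qed.

Lemma factor1 x : factor 1 x = 1%:M.
Proof. by have [l [m [_ _ _ ->]]] := factorP x; exact: gam1. Qed.

Lemma factorM b c x : b != 0 -> c != 0 -> factor b x *m factor c x = factor (b * c) x.
Proof. by have [l [m [lm _ _ E]]] := factorP x => b0 c0; rewrite !E gamM. Qed.

Lemma factorV c x : c != 0 -> factor c x \in unitmx /\ invmx (factor c x) = factor c^-1 x.
Proof. by have [l [m [lm _ _ E]]] := factorP x => c0; rewrite !E; exact: gam_unit. Qed.

(** [rho V] exchanges the two lines of the factor, and exchanging them inverts the scalar. *)
Lemma factor_rho c x : c != 0 -> factor c x *m rho V x = rho V x *m factor c^-1 x.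
Proof.
have [l [m [lm lL rm E]]] := factorP x => c0; rewrite !E.
have rK : rho V x *m rho V x = 1%:M by exact: refl_K.
have [ru ri] := orthogonal_inv (rhoV.2 x).
have iE : invmx (rho V x) = rho V x.
  by rewrite -[LHS]mulmx1 -rK mulKmx.
have [k mk] : exists k, l *m rho V x = k *: m by apply/sub_rVP; rewrite rm.
have k0 : k != 0.
  apply/eqP => k0; have : inner l m != 0 by case: lm.
  by rewrite -(inner_orthogonal _ _ (rhoV.2 x)) mk k0 scale0r inner0l eqxx.
have mr : m *m rho V x = k^-1 *: l.
  have -> : l = k *: (m *m rho V x) by rewrite scalemxAl -mk -mulmxA rK mulmx1.
  by rewrite scalerA mulVf// scale1r.
have := gam_conjugate l m c (rhoV.2 x).
rewrite mk mr gam_scale ?invr_eq0//; last by rewrite innerC; case: lm.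
by rewrite iE (gamC m) => ->; rewrite !mulmxA rK mul1mx.
Qed.

(** As a function of [c] a factor lies in the span of 1, [c] and [c^-1], so three values determine
    it; the weights are the Lagrange basis of this space at 1, -1 and 2. This separates the scalar
    from smooth matrices, as [holo_family_sum] requires. *)
Lemma factor_interpolation c x : c != 0 -> factor c x =
  ((c + 1) * (c - 2) / (- 2 * c)) *: factor 1 x
  + ((c - 1) * (c - 2) / (- 6 * c)) *: factor (-1) x
  + (2 * (c - 1) * (c + 1) / (3 * c)) *: factor 2 x.
Proof.
have [l [m [lm _ _ E]]] := factorP x => c0; rewrite !E; apply: eq_row_action => v.
rewrite !mulmxDr -!scalemxAr !gamE; apply/rowP => j; rewrite !mxE.
have a0 : inner l m != 0 by case: lm.
move: (inner l m) (inner v m) (inner v l) (v 0 j) (l 0 j) (m 0 j) a0 => a p q r s t a0.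
by field; rewrite c0 a0.
Qed.

Lemma factor_orthogonal c : c != 0 -> orthogonal_gauge (factor c).
Proof.
move=> c0; split; last first.
  by move=> x; have [l [m [lm _ _ E]]] := factorP x; rewrite E; exact: gam_orthogonal.
apply: smooth_mx_local => x0 _; have [W [l [m [oW Wx sl sm h]]]] := local_pair x0.
exists W; split=> //.
apply: (@smooth_mx_ext _ _ _ oW _ _ (fun x => 1%:M + (c - 1) *: (eta *m (m x)^T *m l x)
    + (c^-1 - 1) *: (eta *m (l x)^T *m m x))).
  move=> x Wx'; have [h1 h2 h3 h4 _] := h x Wx'.
  by rewrite /factor (Gamma_frame _ h1 h2 h3) gam_def h4 !divr1.
have slt : smooth_mx W (fun x => (l x)^T) by exact: smooth_mx_tr.
have smt : smooth_mx W (fun x => (m x)^T) by exact: smooth_mx_tr.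
have ce : smooth_mx W (fun=> eta) by exact: smooth_mx_cst.
apply: smooth_mxD => //.
  apply: smooth_mxD => //; first exact: smooth_mx_cst.
  by apply: smooth_mxZ => //; [exact: smooth_fun_cst|do 2!apply: smooth_mxM => //].
by apply: smooth_mxZ => //; [exact: smooth_fun_cst|do 2!apply: smooth_mxM => //].
Qed.

End OneFactor.
End SimpleFactorFields.

Section BundleImages.
Context {R : realType} {S : riemannSurface R} {n : nat}.
Local Notation C := (R[i]).
Local Notation N := n.+2.
Local Notation eta := (lorentz C n).
Local Notation nondegenerate := (@Defs.nondegenerate R S n).
Local Notation coord := (@Defs.coord R S).
Implicit Types (V L g : S -> 'M[C]_N) (x : S) (W : set S) (b : bool) (i : chart S).
Implicit Types (A : connection S N).

Lemma nondegenerate_image V g : orthogonal_gauge g -> nondegenerate V ->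
  nondegenerate (bundle_image V g).
Proof. by move=> [_ og] ndV x; exact: (refl_inv_image (ndV x) (og x)).1. Qed.

Lemma rho_image V g x : orthogonal_gauge g -> nondegenerate V ->
  rho (bundle_image V g) x = invmx (g x) *m rho V x *m g x.
Proof. by move=> [_ og] ndV; exact: (refl_inv_image (ndV x) (og x)).2. Qed.

Lemma subbundle_image r V g : orthogonal_gauge g -> subbundle r V ->
  subbundle r (bundle_image V g).
Proof.
move=> [sg og] sV x0; have [W [F [oW Wx0 sF FV]]] := sV x0.
exists W, (fun x => F x *m g x); split=> //.
  by apply: smooth_mxM => //; exact: smooth_mx_sub sg.
move=> x Wx; have [fF FVx] := FV x Wx; have [gu _] := orthogonal_inv (og x); split.
  by rewrite /row_free mxrankMfree// row_free_unit.
exact: eqmxMr.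
Qed.

Lemma null_line_image L g : orthogonal_gauge g -> null_line_subbundle L ->
  null_line_subbundle (bundle_image L g).
Proof.
move=> og [sL nL]; split; first exact: subbundle_image.
move=> x; rewrite /bundle_image trmx_mul.
by rewrite -!mulmxA (mulmxA eta) (mulmxA (g x)) (mulmxA (g x) eta) og.2 mulmxA.
Qed.

Lemma null_line_conj L : null_line_subbundle L -> null_line_subbundle (fun x => conj_mx (L x)).
Proof.
move=> [sL nL]; split; last first.
  move=> x; rewrite -conj_lorentz -conj_mx_tr -!conj_mxM nL.
  by apply/matrixP => p q; rewrite !mxE rmorph0.
move=> x0; have [W [F [oW Wx0 sF FL]]] := sL x0.
exists W, (fun x => conj_mx (F x)); split=> //; first exact: smooth_mx_conj.
move=> x Wx; have [fF FLx] := FL x Wx; split; first by rewrite /row_free mxrank_map.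
by move: FLx => /eqmxP /andP [h1 h2]; apply/eqmxP; rewrite /conj_mx !map_submx h1.
Qed.

(** Parallelism at one point, in one chart and for one type, with a matrix [M] in place of a
    connection: after the first factor the form is available only as a polynomial in lambda at a
    fixed point. [gform] is the matching form of a gauge transformation. *)
Definition parallel_at b i x L (M : 'M[C]_N) := forall W (s : S -> 'rV[C]_N),
  open W -> W x -> smooth_mx W s -> (forall y, W y -> (s y <= L y)%MS) ->
  ((ddmx b i s x + s x *m M)%R <= L x)%MS.

Lemma parallel_parallel_at A L b i x : parallel A L -> dom i x ->
  parallel_at b i x L (cn b A i x).
Proof.
move=> pA dx W s oW Wx sW sL; have [h1 h2] := pA W i s oW sW sL x Wx dx.
by case: b; [exact: h2|exact: h1].
Qed.

Definition gform b i x g (M : 'M[C]_N) : 'M[C]_N :=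
  ddmx b i (fun y => invmx (g y)) x *m g x + invmx (g x) *m M *m g x.

Lemma parallel_at_gauge b i x g L M : dom i x -> orthogonal_gauge g -> parallel_at b i x L M ->
  parallel_at b i x (bundle_image L g) (gform b i x g M).
Proof.
move=> dx og pL W s oW Wx sW sL; have sgi := smooth_mx_sub (@subsetT _ W) (orthogonal_gauge_inv og).
have uni y := (orthogonal_inv (og.2 y)).1.
have s1 : smooth_mx W (fun y => s y *m invmx (g y)) by exact: smooth_mxM.
have := pL W _ oW Wx s1; rewrite (ddmxM b oW Wx dx sW sgi) => h.
have E : ddmx b i s x + s x *m gform b i x g M =
  (ddmx b i s x *m invmx (g x) + s x *m ddmx b i (fun y => invmx (g y)) x
   + s x *m invmx (g x) *m M) *m g x.
  by rewrite /gform mulmxDr !mulmxDl mulmxKV// !mulmxA addrA.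
rewrite E /bundle_image; apply: submxMr; apply: h => y Wy.
have := sL y Wy; rewrite /bundle_image => /(submxMr (invmx (g y))).
by rewrite mulmxK.
Qed.

Lemma gform_mul b i x g h M : dom i x -> orthogonal_gauge g -> orthogonal_gauge h ->
  gform b i x (fun y => g y *m h y) M = gform b i x h (gform b i x g M).
Proof.
move=> dx og oh; have sgi := orthogonal_gauge_inv og; have shi := orthogonal_gauge_inv oh.
have ug y := (orthogonal_inv (og.2 y)).1; have uh y := (orthogonal_inv (oh.2 y)).1.
have iM y : invmx (g y *m h y) = invmx (h y) *m invmx (g y).
  have k : g y *m h y *m (invmx (h y) *m invmx (g y)) = 1%:M.
    by rewrite mulmxA mulmxK// mulmxV.
  have [u _] := mulmx1_unit k.
  by rewrite -[LHS]mulmx1 -k mulKmx.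
rewrite /gform (_ : (fun y => invmx (g y *m h y)) = (fun y => invmx (h y) *m invmx (g y))); last exact/funext.
rewrite iM (ddmxM b (@openT S) I dx shi sgi) mulmxDl !mulmxDr !mulmxDl.
by rewrite !mulmxA mulmxKV// !addrA.
Qed.

Lemma orthogonal_gauge_mul g h : orthogonal_gauge g -> orthogonal_gauge h ->
  orthogonal_gauge (fun x => g x *m h x).
Proof.
move=> [sg og] [sh oh]; split; first exact: (smooth_mxM (@openT S)).
by move=> x; exact: orthogonal_mul.
Qed.

Section Step.
Variables V L : S -> 'M[C]_N.
Hypothesis rhoV : orthogonal_gauge (rho V).
Hypothesis ndV : nondegenerate V.
Hypothesis nL : null_line_subbundle L.
Hypothesis cL : complementary L (bundle_image L (rho V)).

(** [gauge_step] for bundles: the null pair comes from [local_pair], and the relations between the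
    derivatives come from [(l, l) = 0], [(m, m) = 0] and [(l, m) = 1]. *)
Lemma factor_step b i x d (A : C -> 'M[C]_N) (al ka : C) : dom i x -> polymx d A ->
  ka != 0 -> skew (A (- al)) ->
  parallel_at b i x L (A al) -> parallel_at b i x (bundle_image L (rho V)) (A (- al)) ->
  exists2 B, polymx d B & forall nu, skew (A nu) -> nu - al != 0 -> nu + al != 0 ->
    gform b i x (factor V L (ka * cay al nu)) (A nu) = B nu /\ skew (B nu).
Proof.
move=> dx pA ka0 sA pl pm.
have [W [l [m [oW Wx sl sm h]]]] := local_pair rhoV nL cL x.
pose l1 := ddmx b i l x; pose m1 := ddmx b i m x.
have [lL mL lm lm1 rm] := h x Wx; have [h1 h2 h3] := lm.
have dinn (u v : S -> 'rV[C]_N) (c : C) : smooth_mx W u -> smooth_mx W v ->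
    (forall y, W y -> inner (u y) (v y) = c) ->
    inner (ddmx b i u x) (v x) + inner (u x) (ddmx b i v x) = 0.
  move=> su sv uv; rewrite -(dd_inner b oW Wx dx su sv) -[RHS](dd_cst b i x c).
  by apply: (dd_eq b oW Wx dx _ uv); exact: smooth_inner.
have two (z : C) : z + z = 0 -> z = 0.
  by move=> /eqP; rewrite -mulr2n -mulr_natl mulf_eq0 pnatr_eq0 /= => /eqP.
have k1 : inner l1 (l x) = 0.
  apply: two; rewrite {2}innerC; apply: (dinn l l 0) => // y Wy.
  by have [_ _ []] := h y Wy.
have k2 : inner m1 (m x) = 0.
  apply: two; rewrite {2}innerC; apply: (dinn m m 0) => // y Wy.
  by have [_ _ []] := h y Wy.
have k3 : inner (l x) m1 = - inner l1 (m x).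
  apply/eqP; rewrite -addr_eq0 addrC; apply/eqP; apply: (dinn l m 1) => // y Wy.
  by have [] := h y Wy.
have q1 : ((l1 + l x *m A al)%R <= l x)%MS.
  rewrite lL; apply: (pl W l) => // y Wy; by have [-> _ _ _ _] := h y Wy.
have q2 : ((m1 + m x *m A (- al))%R <= m x)%MS.
  rewrite mL; apply: (pm W m) => // y Wy; by have [_ -> _ _ _] := h y Wy.
have [B pB BE] := gauge_step pA ka0 h1 h2 lm1 k1 k2 k3 sA q1 q2.
exists B => // nu sAn n1 n2; have [<- sB] := BE nu sAn n1 n2; split=> //.
have c0 : ka * cay al nu != 0 by rewrite mulf_neq0// cay_eq0.
move: (ka * cay al nu) c0 => c c0; rewrite /gform.
have fE y : W y -> forall c, factor V L c y = gam (l y) (m y) c.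
  by move=> Wy e; have [g1 g2 g3 _ _] := h y Wy; exact: Gamma_frame.
have ce : smooth_mx W (fun=> eta) by exact: smooth_mx_cst.
have slt : smooth_mx W (fun x => (l x)^T) by exact: smooth_mx_tr.
have smt : smooth_mx W (fun x => (m x)^T) by exact: smooth_mx_tr.
have sel : smooth_mx W (fun x => eta *m (l x)^T) by exact: smooth_mxM.
have sem : smooth_mx W (fun x => eta *m (m x)^T) by exact: smooth_mxM.
have selm : smooth_mx W (fun x => eta *m (l x)^T *m m x) by exact: smooth_mxM.
have seml : smooth_mx W (fun x => eta *m (m x)^T *m l x) by exact: smooth_mxM.
have t1 : smooth_mx W (fun x => (c^-1 - 1) *: (eta *m (m x)^T *m l x)).
  by apply: smooth_mxZ => //; exact: smooth_fun_cst.
have t2 : smooth_mx W (fun x => (c - 1) *: (eta *m (l x)^T *m m x)).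
  by apply: smooth_mxZ => //; exact: smooth_fun_cst.
have t0 : smooth_mx W (fun=> 1%:M : 'M[C]_N) by exact: smooth_mx_cst.
have t01 := smooth_mxD oW t0 t1.
have iE y : W y -> 1%:M + (c^-1 - 1) *: (eta *m (m y)^T *m l y) + (c - 1) *: (eta *m (l y)^T *m m y)
    = invmx (factor V L c y).
  move=> Wy; have [_ ->] := factorV rhoV nL cL y c0.
  by have [_ _ _ lmy _] := h y Wy; rewrite fE// gam_def invrK lmy !divr1.
(* The inverse factor is the factor with scalar [c^-1], so its derivative is [dgam] at [c^-1]. *)
have dE : ddmx b i (fun y => invmx (factor V L c y)) x = dgam (l x) l1 (m x) m1 c^-1.
  rewrite -(ddmx_eq b oW Wx dx (smooth_mxD oW t01 t2) iE).
  rewrite (ddmxD b oW Wx dx t01 t2) (ddmxD b oW Wx dx t0 t1) ddmx_cst add0r.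
  rewrite (ddmxZ b oW Wx dx _ seml) (ddmxZ b oW Wx dx _ selm).
  rewrite (ddmxM b oW Wx dx sem sl) (ddmxM b oW Wx dx sel sm).
  rewrite (ddmxM b oW Wx dx ce smt) (ddmxM b oW Wx dx ce slt) !ddmx_cst !mul0mx !add0r !ddmx_tr.
  by rewrite /dgam invrK.
have [_ gi] := factorV rhoV nL cL x c0.
by rewrite dE gi !(fE x Wx).
Qed.

End Step.
End BundleImages.

(** * Connection forms of a perturbed harmonic bundle *)

Section PerturbedHarmonic.
Context {R : realType} {S : riemannSurface R} {n : nat}.
Local Notation C := (R[i]).
Local Notation N := n.+2.
Local Notation coord := (@Defs.coord R S).
Implicit Types (V L g : S -> 'M[C]_N) (x : S) (W : set S) (b : bool) (i : chart S).
Implicit Types (A B : connection S N).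

(* [cstar] uses the conjugation of closed fields, [conj_mx] that of [R[i]]. *)
Lemma cstarE (l : C) : cstar l = ((l^*)%C)^-1.
Proof. by []. Qed.

Lemma nab_cst b A i x (v : 'rV[C]_N) : dom i x -> nab b A i (fun=> v) x = v *m cn b A i x.
Proof. by move=> dx; rewrite /nab (ddmx_cst b i x v) add0r. Qed.

(** The operator identity, tested on constant sections, becomes an identity of forms; conjugation
    exchanges the two types. *)
Lemma cn_conj b A B i x : is_conj_of A B -> dom i x ->
  cn (~~ b) B i x = conj_mx (cn b A i x).
Proof.
move=> cAB dx; apply: eq_row_action => v.
have oT := @openT S.
have sv : smooth_mx setT (fun _ : S => v) by exact: smooth_mx_cst.
have [h1 h2] := cAB setT i _ (@openT S) sv x I dx.
have h : nab (~~ b) B i (fun=> v) x = conj_mx (nab b A i (fun=> conj_mx v) x).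
  by case: b; [exact: h1|exact: h2].
by rewrite !nab_cst// conj_mxM conj_mxK in h.
Qed.

Lemma cn_skew b A i x : metric A -> dom i x -> skew (cn b A i x).
Proof.
move=> mA dx u v; have oT := @openT S.
have su : smooth_mx setT (fun _ : S => u) by exact: smooth_mx_cst.
have sv : smooth_mx setT (fun _ : S => v) by exact: smooth_mx_cst.
have [h1 h2] := mA setT i _ _ oT su sv x I dx.
have : dd b i (fun=> inner u v) x =
    inner (nab b A i (fun=> u) x) v + inner u (nab b A i (fun=> v) x).
  by case: b; [exact: h2|exact: h1].
by rewrite (dd_cst b i x) !nab_cst// => /eqP; rewrite eq_sym addr_eq0 => /eqP.
Qed.

Lemma parallel_conj A B L : is_conj_of A B -> parallel A L ->
  parallel B (fun x => conj_mx (L x)).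
Proof.
move=> cAB pA W i s oW sW sL x Wx dx; have [-> ->] := cAB W i s oW sW x Wx dx.
have sc : smooth_mx W (fun y => conj_mx (s y)) by exact: smooth_mx_conj.
have cL y : W y -> (conj_mx (s y) <= L y)%MS.
  by move=> Wy; rewrite -(conj_mxK (L y)) /conj_mx map_submx; exact: sL.
have [h1 h2] := pA W i _ oW sc cL x Wx dx.
by rewrite /conj_mx !map_submx.
Qed.

Lemma parallel_gauge A B L g : orthogonal_gauge g -> is_gauge_of g A B -> parallel A L ->
  parallel B (bundle_image L g).
Proof.
move=> og gAB pA W i s oW sW sL x Wx dx; have [-> ->] := gAB W i s oW sW x Wx dx.
have sgi := smooth_mx_sub (@subsetT _ W) (orthogonal_gauge_inv og).
have s1 : smooth_mx W (fun y => s y *m invmx (g y)) by exact: smooth_mxM.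
have h y : W y -> (s y *m invmx (g y) <= L y)%MS.
  move=> Wy; have [gu _] := orthogonal_inv (og.2 y).
  by have := submxMr (invmx (g y)) (sL y Wy); rewrite /bundle_image mulmxK.
have [h1 h2] := pA W i _ oW s1 h x Wx dx.
by split; exact: submxMr.
Qed.

(** The coordinate in which the form is polynomial: the (1,0) part has its pole at infinity, the
    (0,1) part at 0. *)
Definition nu b (l : C) : C := if b then l^-1 else l.

Lemma polymx_conj k m p (F : C -> 'M[C]_(m, p)) : polymx k F ->
  polymx k (fun z => conj_mx (F (z^*)%C)).
Proof.
move=> pF i j; have [q sq qE] := pF i j; exists (map_poly (@conjc R) q).
  by rewrite size_map_poly.
move=> z; rewrite mxE qE -[in RHS](conjcK z) horner_map.
by [].
Qed.

Lemma conn_family k (d : C -> connection S N) b i x : pole10 k d ->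
  (forall l, l != 0 -> is_conj_of (d l) (d (cstar l))) -> dom i x ->
  exists2 A, polymx k A & forall l, l != 0 -> cn b (d l) i x = A (nu b l).
Proof.
move=> [F [G [hF hG FE GE _]]] cd dx.
have [A pA AE] : exists2 A, polymx k A & forall l, l != 0 -> cn false (d l) i x = A l.
  exists (fun l => F l i x); last by move=> l l0; rewrite FE.
  move=> p q; have oI := @range_open R S i.
  have [a _ aE] := @polynomial_family R _ k _ _ oI (hF i p q) (hG i p q)
    (fun w z w0 zI => ltac:(case: zI => y dy <-; rewrite /= coordK// GE// mxE; reflexivity)).
  exists (\poly_(j < k.+1) a j (coord i x)); first exact: size_poly.
  move=> l; rewrite horner_poly.
  have /(aE l) : (coord i @` dom i) (coord i x) by exists x.
  by rewrite coordK// => ->; apply: eq_bigr => j _; rewrite mulrC.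
case: b; last by exists A.
(* The (0,1) part at [l] is the conjugate of the (1,0) part at [cstar l], and [cstar l] is the
   conjugate of [l^-1]. *)
exists (fun z => conj_mx (A (z^*)%C)); first exact: polymx_conj.
move=> l l0; have l'0 : cstar l != 0 by rewrite cstarE invr_eq0 conjc_eq0.
have cV (z : C) : ((z^-1)^*)%C = ((z^*)%C)^-1 by exact: fmorphV.
have ll : cstar (cstar l) = l by rewrite !cstarE cV conjcK invrK.
have := cn_conj false (cd _ l'0) dx; rewrite ll AE//= => ->.
by congr (conj_mx (A _)); rewrite cstarE -cV.
Qed.

End PerturbedHarmonic.

(** * The two-step dressing *)

Section Scalars.
Context {R : realType}.
Local Notation C := (R[i]).
Local Notation P1 := (one_point_compactification R[i]^o).
Local Notation pinv := (@Defs.pinv R).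
Implicit Types (a z : C) (l : P1).

Let cM (u v : C) : ((u * v)^*)%C = (u^*)%C * (v^*)%C. Proof. exact: rmorphM. Qed.
Let cD (u v : C) : ((u + v)^*)%C = (u^*)%C + (v^*)%C. Proof. exact: rmorphD. Qed.
Let cN (u : C) : ((- u)^*)%C = - (u^*)%C. Proof. exact: rmorphN. Qed.
Let cV (u : C) : ((u^-1)^*)%C = ((u^*)%C)^-1. Proof. exact: fmorphV. Qed.
Let c1 : (1^*)%C = 1 :> C. Proof. exact: conjc1. Qed.

Definition kap a : C := (1 + a) / (1 - a).

Lemma scalar_Some a z : simple_scalar a (Some z) = kap a * cay a z.
Proof. by rewrite /= /kap /cay invfM mulrACA. Qed.

Lemma scalar_None a : simple_scalar a None = kap a.
Proof. by []. Qed.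

Lemma kap_neq0 a : a != 1 -> a != -1 -> kap a != 0.
Proof.
move=> a1 am1; rewrite /kap mulf_neq0 ?invr_eq0//; last by rewrite subr_eq0 eq_sym.
by rewrite addrC addr_eq0.
Qed.

Lemma simple_domP a z : simple_dom a (Some z) <-> z - a != 0 /\ z + a != 0.
Proof.
rewrite /simple_dom /= subr_eq0 addr_eq0; split=> [[h1 h2]|[/eqP h1 /eqP h2]].
  by split; apply/eqP => e; [apply: h1|apply: h2]; rewrite e.
by split=> -[].
Qed.

Lemma simple_domN a : simple_dom a None.
Proof. by []. Qed.

Lemma scalar_neq0 a l : a != 1 -> a != -1 -> simple_dom a l -> simple_scalar a l != 0.
Proof.
move=> a1 am1; case: l => [z /simple_domP[h1 h2]|_]; last by rewrite scalar_None kap_neq0.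
by rewrite scalar_Some mulf_neq0 ?kap_neq0// cay_eq0.
Qed.

(** [cay a z] and [cay a (- z)] are inverse to each other. That the product does not depend on [l]
    is the source of condition (i). *)
Lemma scalar_popp a l : simple_dom a l ->
  simple_scalar a l * simple_scalar a (popp l) = kap a ^+ 2.
Proof.
case: l => [z /simple_domP[h1 h2]|_]; last by rewrite expr2.
have h3 : - z + a != 0 by rewrite addrC -opprB oppr_eq0.
rewrite /popp !scalar_Some /cay; move: (kap a) => k.
by field; rewrite h2 h3.
Qed.

Lemma scalar_0 a : a != 0 -> simple_scalar a (Some 0) = - kap a.
Proof. by move=> a0; rewrite scalar_Some /cay !add0r mulNr divff// mulrN1. Qed.

Lemma cstarK a : cstar (cstar a) = a.
Proof.
by rewrite !cstarE cV conjcK invrK.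
Qed.

Lemma kap_star a : a != 0 -> a != 1 -> kap (cstar a) = - ((kap a)^*)%C.
Proof.
move=> a0 a1; rewrite cstarE /kap.
have -> : (((1 + a) / (1 - a))^*)%C = (1 + (a^*)%C) / (1 - (a^*)%C).
  by rewrite cM cV !cD cN c1.
have b0 : (a^*)%C != 0 by rewrite conjc_eq0.
have b1 : 1 - (a^*)%C != 0.
  rewrite subr_eq0 eq_sym; apply: contra a1 => /eqP h.
  by apply/eqP; rewrite -[a]conjcK h conjc1.
move: (a^*)%C b0 b1 => b b0 b1; field.
rewrite b1 b0 /= -opprB oppr_eq0; exact: b1.
Qed.

Lemma cay_conj a z : ((cay a z)^*)%C = cay (a^*)%C (z^*)%C.
Proof.
by rewrite /cay cM cV !cD cN.
Qed.

Lemma cay_inv a z : a != 0 -> z != 0 -> cay a^-1 z^-1 = - cay a z.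
Proof.
move=> a0 z0; rewrite /cay; have -> : z^-1 - a^-1 = - (z - a) / (z * a).
  by field; rewrite a0 z0.
have -> : z^-1 + a^-1 = (z + a) / (z * a) by field; rewrite a0 z0.
have za : z * a != 0 by rewrite mulf_neq0.
have [->|h] := eqVneq (z + a) 0; first by rewrite mul0r invr0 !mulr0 oppr0.
by field; rewrite h a0 z0.
Qed.

(** Conjugation carries the factor at [a] to the factor at [cstar a]. For finite nonzero [l], the
    signs of [kap_star] and of [cay_inv] cancel. *)
Lemma scalar_star a l : a != 0 -> a != 1 ->
  simple_scalar (cstar a) (pstar l) = ((simple_scalar a l)^*)%C.
Proof.
move=> a0 a1; have b0 : cstar a != 0 by rewrite cstarE invr_eq0 conjc_eq0.
case: l => [z|]; last by rewrite /pstar scalar_0// kap_star// opprK.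
have [->|z0] := eqVneq z 0.
  by rewrite /pstar /pinv conjc0 eqxx scalar_None scalar_0// kap_star// cN.
rewrite /pstar /Defs.pinv conjc_eq0 (negbTE z0) !scalar_Some kap_star// (cM (kap a) (cay a z)) cay_conj.
by rewrite cstarE cay_inv ?conjc_eq0// mulrNN.
Qed.

Lemma simple_dom_star a l : a != 0 -> simple_dom a l -> simple_dom (cstar a) (pstar l).
Proof.
move=> a0; have b0 : cstar a != 0 by rewrite cstarE invr_eq0 conjc_eq0.
case: l => [z|_]; last by apply/simple_domP; rewrite sub0r add0r oppr_eq0.
rewrite simple_domP => -[h1 h2]; rewrite /pstar /Defs.pinv conjc_eq0.
have [//|z0] := eqVneq z 0; apply/simple_domP.
have c0 : (z^*)%C != 0 by rewrite conjc_eq0.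
have d0 : (a^*)%C != 0 by rewrite conjc_eq0.
have e1 : ((z^*)%C)^-1 - cstar a = - ((z - a)^*)%C / ((z^*)%C * (a^*)%C).
  have -> : ((z - a)^*)%C = (z^*)%C - (a^*)%C by rewrite cD cN.
  by rewrite cstarE; field; rewrite c0 d0.
have e2 : ((z^*)%C)^-1 + cstar a = ((z + a)^*)%C / ((z^*)%C * (a^*)%C).
  have -> : ((z + a)^*)%C = (z^*)%C + (a^*)%C by rewrite cD.
  by rewrite cstarE; field; rewrite c0 d0.
rewrite e1 e2; split; by rewrite mulf_neq0 ?oppr_eq0 ?conjc_eq0// invr_eq0 mulf_neq0.
Qed.

Lemma simple_dom_opp a l : simple_dom a l -> simple_dom a (popp l).
Proof.
case: l => [z|//]; rewrite !simple_domP => -[h1 h2].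
by rewrite -opprD oppr_eq0 h2 -oppr_eq0 opprD opprK h1.
Qed.

(** [cstar a] equals [a] or [- a] only if [a] times its conjugate is 1 or -1; the former means the
    unit circle, and the latter contradicts positivity. *)
Lemma off_circle a : a != 0 -> `|a| != 1 -> [/\ a != 1, a != -1, cstar a != 1, cstar a != -1 &
  cstar a - a != 0 /\ cstar a + a != 0].
Proof.
move=> a0 na; have d0 : (a^*)%C != 0 by rewrite conjc_eq0.
have nE : `|a| ^+ 2 = a * (a^*)%C by exact: normCK.
have a1 : a != 1 by apply: contraNneq na => ->; rewrite normr1.
have am1 : a != -1 by apply: contraNneq na => ->; rewrite normrN1.
have h1 : a * (a^*)%C != 1.
  by rewrite -nE sqrf_eq1 negb_or na /=; apply/eqP => e; have := normr_ge0 a; rewrite e ler0N1.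
have h2 : a * (a^*)%C != -1.
  by rewrite -nE; apply/eqP => e; have := exprn_ge0 2 (normr_ge0 a); rewrite e ler0N1.
have sE : a = ((cstar a)^-1^*)%C by rewrite cstarE invrK conjcK.
split=> //.
- by apply: contra a1 => /eqP e; rewrite sE e invr1 c1.
- by apply: contra am1 => /eqP e; rewrite sE e invrN1 cN c1.
- split.
    rewrite subr_eq0; apply: contra h1 => /eqP e.
    by rewrite -{1}e cstarE mulVf.
  rewrite addr_eq0; apply: contra h2 => /eqP e.
  by rewrite -eqr_oppLR -mulNr -e cstarE mulVf.
Qed.

End Scalars.

(** One block matrix is factored through the Schur complement of either diagonal block. *)
Lemma det_rank_one (K : comUnitRingType) r (u : 'cV[K]_r) (w : 'rV[K]_r) :
  \det (1%:M - u *m w) = 1 - (w *m u) 0 0.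
Proof.
have e1 : block_mx 1%:M u w (1%:M : 'M[K]_1) =
    block_mx 1%:M 0 w 1%:M *m block_mx 1%:M u 0 (1%:M - w *m u).
  by rewrite mulmx_block !(mul1mx, mul0mx, mulmx1, mulmx0, addr0, add0r) [w *m u + _]addrC subrK.
have e2 : block_mx 1%:M u w (1%:M : 'M[K]_1) =
    block_mx 1%:M u 0 1%:M *m block_mx (1%:M - u *m w) 0 w 1%:M.
  by rewrite mulmx_block !(mul1mx, mul0mx, mulmx1, mulmx0, addr0, add0r) subrK.
have := congr1 determinant e1; rewrite e2 !det_mulmx det_ublock det_lblock det_lblock det_ublock.
by rewrite !det1 !mul1r !mulr1 [X in _ = X]det_mx11 !mxE => ->.
Qed.

Section Reflections.
Context {R : realType} {S : riemannSurface R} {n : nat}.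
Local Notation C := (R[i]).
Local Notation N := n.+2.
Local Notation eta := (lorentz C n).
Local Notation nondegenerate := (@Defs.nondegenerate R S n).
Implicit Types (V L : S -> 'M[C]_N) (x : S).

Lemma refl_conj (V : 'M[C]_N) : (V :&: perp V)%MS = 0 -> (conj_mx V :=: V)%MS ->
  conj_mx (refl V) = refl V.
Proof.
move=> ndV rV; have [r [B [fB BV uQ rE]]] := refl_frameP ndV.
have fB' : row_free (conj_mx B) by rewrite /row_free mxrank_map.
have BV' : (conj_mx B :=: V)%MS.
  apply: eqmx_trans rV; move: (BV) => /eqmxP /andP [h1 h2]; apply/eqmxP.
  by rewrite /conj_mx !map_submx h1.
have h : conj_mx (frame_proj B) = frame_proj (conj_mx B).
  have iE (M : 'M[C]_r) : conj_mx (invmx M) = invmx (conj_mx M) by exact: map_invmx.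
  by rewrite /frame_proj !conj_mxM iE !conj_mxM conj_lorentz conj_mx_tr.
transitivity (2 *: frame_proj (conj_mx B) - 1%:M); last exact/esym/refl_frame.
rewrite rE conj_mxD conj_mxZ h; congr (_ *: _ + _); first exact: (rmorph_nat (@conjc R) 2).
apply/matrixP => i j; rewrite !mxE; apply: (etrans (rmorphN _ _)); congr (- _).
exact: (rmorph_nat (@conjc R)).
Qed.

Lemma refl_fixed (V : 'M[C]_N) (u : 'rV[C]_N) : (V :&: perp V)%MS = 0 ->
  u *m refl V = u -> (u <= V)%MS.
Proof.
move=> ndV; have [r [B [fB BV uQ rE]]] := refl_frameP ndV.
rewrite rE mulmxBr mulmx1 -scalemxAr => /eqP; rewrite subr_eq => /eqP h.
have n2 : (2 : C) != 0 by rewrite pnatr_eq0.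
have : u *m frame_proj B = u.
  by rewrite -[LHS]scale1r -(mulVf n2) -scalerA h -mulr2n -(scaler_nat 2 u) scalerA mulVf// scale1r.
by move=> <-; rewrite -BV /frame_proj !mulmxA submxMl.
Qed.

(* [gam l (l rho) (-1)] is the reflection in the line of [l + l rho], which lies in [V]. *)
Lemma det_reflection (V : 'M[C]_N) (l : 'rV[C]_N) r (B : 'M[C]_(r, N)) :
  (V :&: perp V)%MS = 0 -> (B :=: V)%MS -> null_pair l (l *m refl V) ->
  exists2 K, B *m gam l (l *m refl V) (-1) = K *m B & \det K = -1.
Proof.
move=> ndV BV; set m := l *m refl V => -[h1 h2 h3].
have mr : m *m refl V = l by rewrite /m -mulmxA refl_K// mulmx1.
have eV : ((l + m)%R <= B)%MS.
  by rewrite BV; apply: refl_fixed => //; rewrite mulmxDl mr addrC.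
have [w wE] := submxP eV.
(* For [v] in [V] one has [(v, m) = (v, l)], so the factor subtracts [2 (v, l) / (l, m)] times
   [l + m] from [v]. In the frame [B] this is [1 - u w], with [w] the coordinates of [l + m]. *)
pose u := (2 / inner l m) *: (B *m eta *m l^T).
exists (1%:M - u *m w); last first.
  rewrite det_rank_one /u -scalemxAr !mulmxA -wE innerE mxE mxE mulr1n.
  rewrite innerDl h1 add0r (innerC m) divfK//.
  by rewrite opprD addrA subrr add0r.
rewrite mulmxBl mul1mx -mulmxA -wE /u -scalemxAl.
apply/row_matrixP => i; rewrite linearB linearZ /= !row_mul; set v := row i B.
have vV : (v <= V)%MS by rewrite -BV row_sub.
have vm : inner v m = inner v l.
  by rewrite -[in RHS]mr -[in RHS](refl_id ndV vV) inner_orthogonal//; exact: refl_orthogonal.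
rewrite innerE mul_scalar_mx gamE vm invrN1; move: (inner l m) (inner v l) => a c.
by apply/rowP => j; rewrite !mxE; ring.
Qed.
End Reflections.

Lemma invmx_mulmx (K : fieldType) d (g h : 'M[K]_d) : g \in unitmx -> h \in unitmx ->
  invmx (g *m h) = invmx h *m invmx g.
Proof.
move=> gu hu; have k : (g *m h) *m (invmx h *m invmx g) = 1%:M.
  by rewrite mulmxA mulmxK// mulmxV.
by have [u _] := mulmx1_unit k; rewrite -[LHS]mulmx1 -k mulKmx.
Qed.

Section TwoFactors.
Context {R : realType} {S : riemannSurface R} {n : nat}.
Local Notation C := (R[i]).
Local Notation N := n.+2.
Local Notation eta := (lorentz C n).
Local Notation nondegenerate := (@Defs.nondegenerate R S n).
Local Notation P1 := (one_point_compactification R[i]^o).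
Implicit Types (x : S) (l : P1).

(** Moving the inverted first factor past [rho V] restores its scalar, so the scalars at [l] and
    [- l] multiply. *)
Lemma twist (V L : S -> 'M[C]_N) (a : C) l x : orthogonal_gauge (rho V) -> nondegenerate V ->
  null_line_subbundle L -> complementary L (bundle_image L (rho V)) ->
  a != 1 -> a != -1 -> simple_dom a l ->
  invmx (simple_factor V a L l x) *m rho V x *m simple_factor V a L (popp l) x =
  rho V x *m factor V L (kap a ^+ 2) x.
Proof.
move=> rV ndV nL cL a1 am1 dl; have c0 := scalar_neq0 a1 am1 dl.
have c0' : (simple_scalar a l)^-1 != 0 by rewrite invr_eq0.
have d0 := scalar_neq0 a1 am1 (simple_dom_opp dl).
have [_ iE] := factorV rV nL cL x c0.
have fr := factor_rho rV ndV nL cL x c0'; rewrite invrK in fr.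
rewrite [simple_factor V a L l x]/(factor V L (simple_scalar a l) x).
rewrite [simple_factor V a L _ x]/(factor V L (simple_scalar a (popp l)) x).
rewrite iE fr -mulmxA (factorM rV nL cL x c0 d0).
by rewrite (scalar_popp dl).
Qed.

(** A factor depends on its two lines only, so the second spanning vector may be taken to be exactly
    the image of the first. *)
Lemma null_pair_refl (g : 'M[C]_N) (u v : 'rV[C]_N) : null_pair u v -> (u *m g :=: v)%MS ->
  g *m eta *m g^T = eta ->
  null_pair u (u *m g) /\ forall c, gam u v c = gam u (u *m g) c.
Proof.
move=> [h1 h2 h3] uv og.
have [k kE] : exists k, u *m g = k *: v by apply/sub_rVP; rewrite uv.
have k0 : k != 0.
  apply: contra_neq h3 => k0; have : (v <= u *m g)%MS by rewrite uv.
  by rewrite kE k0 scale0r => /submxP[X ->]; rewrite mulmx0 innerC inner0l.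
split; last by move=> c; rewrite kE -[u in RHS]scale1r gam_scale ?oner_neq0.
split=> //; first by rewrite inner_orthogonal.
by rewrite kE innerZr mulf_neq0.
Qed.

Variables (V L : S -> 'M[C]_N) (alpha : C).
Hypothesis rhoV : orthogonal_gauge (rho V).
Hypothesis ndV : nondegenerate V.
Hypothesis nL : null_line_subbundle L.
Hypothesis cL : complementary L (bundle_image L (rho V)).
Hypotheses (a0 : alpha != 0) (na : `|alpha| != 1).

Local Notation be := (cstar alpha).
Local Notation p := (simple_factor V alpha L).
Local Notation L' := (bundle_image (fun x => conj_mx (L x)) (p (Some be))).
Local Notation V' := (bundle_image V (p (Some 0))).

Lemma dom_be : simple_dom alpha (Some be).
Proof. by have [_ _ _ _ [h1 h2]] := off_circle a0 na; apply/simple_domP. Qed.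

Lemma dom_nbe : simple_dom alpha (Some (- be)).
Proof. exact: (simple_dom_opp dom_be). Qed.

Lemma dom_0 : simple_dom alpha (Some 0).
Proof. by apply/simple_domP; rewrite sub0r add0r oppr_eq0. Qed.

Lemma simple_factor_orthogonal l : simple_dom alpha l -> orthogonal_gauge (p l).
Proof.
have [a1 am1 _ _ _] := off_circle a0 na.
by move=> dl; exact: (factor_orthogonal rhoV nL cL (scalar_neq0 a1 am1 dl)).
Qed.

Lemma rho_dressed x : rho V' x = rho V x *m factor V L (kap alpha ^+ 2) x.
Proof.
have [a1 am1 _ _ _] := off_circle a0 na.
rewrite (rho_image x (simple_factor_orthogonal dom_0) ndV) -(twist x rhoV ndV nL cL a1 am1 dom_0).
by rewrite /popp oppr0.
Qed.

Lemma dressed_rho_orthogonal : orthogonal_gauge (rho V').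
Proof.
have [a1 am1 _ _ _] := off_circle a0 na.
have k0 : kap alpha ^+ 2 != 0 by rewrite expf_neq0// kap_neq0.
have := orthogonal_gauge_mul rhoV (factor_orthogonal rhoV nL cL k0).
by congr orthogonal_gauge; apply/funext => x; rewrite rho_dressed.
Qed.

Lemma dressed_nondegenerate : nondegenerate V'.
Proof. exact: nondegenerate_image (simple_factor_orthogonal dom_0) ndV. Qed.

Lemma dressed_null : null_line_subbundle L'.
Proof. exact: null_line_image (simple_factor_orthogonal dom_be) (null_line_conj nL). Qed.

(** By the twisting relation, applying [p] at [be] and then [rho V'] is applying [rho V] and then
    [p] at [- be]. So the reflection of [L'] is the reflected conjugate line, dressed at [- be]. *)
Lemma dressed_reflected x :
  bundle_image L' (rho V') x = conj_mx (L x) *m rho V x *m p (Some (- be)) x.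
Proof.
have [a1 am1 _ _ _] := off_circle a0 na; have [_ op] := simple_factor_orthogonal dom_be.
have [pu _] := orthogonal_inv (op x).
rewrite /bundle_image -!mulmxA; congr (_ *m _).
rewrite rho_dressed -(twist x rhoV ndV nL cL a1 am1 dom_be) -mulmxA mulKVmx//.
Qed.

Hypothesis cL' : complementary L' (bundle_image L' (rho V')).

Let a1 : alpha != 1. Proof. by have [] := off_circle a0 na. Qed.
Let am1 : alpha != -1. Proof. by have [] := off_circle a0 na. Qed.
Let b1 : be != 1. Proof. by have [] := off_circle a0 na. Qed.
Let bm1 : be != -1. Proof. by have [] := off_circle a0 na. Qed.
Let ba : be - alpha != 0. Proof. by have [_ _ _ _ []] := off_circle a0 na. Qed.
Let bpa : be + alpha != 0. Proof. by have [_ _ _ _ []] := off_circle a0 na. Qed.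
Let b0 : be != 0. Proof. by rewrite cstarE invr_eq0 conjc_eq0. Qed.

Local Notation q := (simple_factor V' be L').
Local Notation r := (fun l x => p l x *m q l x).

Lemma dressed_orthogonal l : simple_dom alpha l -> simple_dom be l -> orthogonal_gauge (r l).
Proof.
move=> da db; apply: orthogonal_gauge_mul; first exact: simple_factor_orthogonal.
exact: (factor_orthogonal dressed_rho_orthogonal dressed_null cL' (scalar_neq0 b1 bm1 db)).
Qed.

(** The factors are twisted in turn: the first one leaves [rho V'] in the middle, which is the
    reflection that twists the second. *)
Lemma dressed_twist l m x : simple_dom alpha l -> simple_dom be l ->
  simple_dom alpha m -> simple_dom be m ->
  invmx (r l x) *m rho V x *m r (popp l) x = invmx (r m x) *m rho V x *m r (popp m) x.
Proof.
suff h k : simple_dom alpha k -> simple_dom be k ->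
    invmx (r k x) *m rho V x *m r (popp k) x = rho V' x *m factor V' L' (kap be ^+ 2) x.
  by move=> dl dl' dm dm'; rewrite (h l dl dl') (h m dm dm').
move=> da db; have [pu _] := orthogonal_inv ((simple_factor_orthogonal da).2 x).
have c0 := scalar_neq0 b1 bm1 db.
have [qu _] := factorV dressed_rho_orthogonal dressed_null cL' x c0.
rewrite -(twist x dressed_rho_orthogonal dressed_nondegenerate dressed_null cL' b1 bm1 db).
rewrite rho_dressed -(twist x rhoV ndV nL cL a1 am1 da).
rewrite (invmx_mulmx pu qu).
by rewrite !mulmxA.
Qed.

(** Between 0 and infinity each scalar only changes sign. The composite therefore consists of two
    factors with scalar -1, one of them conjugated by [F1 ka]; they act on [V] and on [V'] as
    reflections, each of determinant -1. *)
Lemma dressed_det r0 (B : 'M[C]_(r0, N)) x : row_free B -> (B :=: V x)%MS ->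
  exists2 K, B *m (r None x *m invmx (r (Some 0) x)) = K *m B & \det K = 1.
Proof.
move=> fB BV; pose ka := kap alpha; pose kb := kap be.
have ka0 : ka != 0 by exact: kap_neq0.
have kb0 : kb != 0 by exact: kap_neq0.
have m1 : (-1 : C) != 0 by rewrite oppr_eq0 oner_eq0.
have [F1 F1E] : exists F1, forall c, F1 c = factor V L c x by exists (fun c => factor V L c x).
have [F2 F2E] : exists F2, forall c, F2 c = factor V' L' c x.
  exists (fun c => factor V' L' c x) => c; exact: erefl.
have F1M b c : b != 0 -> c != 0 -> F1 b *m F1 c = F1 (b * c).
  by rewrite !F1E; exact: (factorM rhoV nL cL).
have F2M b c : b != 0 -> c != 0 -> F2 b *m F2 c = F2 (b * c).
  by rewrite !F2E; exact: (factorM dressed_rho_orthogonal dressed_null cL').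
have F11 : F1 1 = 1%:M by rewrite F1E; exact: (factor1 rhoV nL cL).
have F21 : F2 1 = 1%:M by rewrite F2E; exact: (factor1 dressed_rho_orthogonal dressed_null cL').
have F1V c : c != 0 -> F1 c \in unitmx /\ invmx (F1 c) = F1 c^-1.
  by rewrite !F1E; exact: (factorV rhoV nL cL).
have F2V c : c != 0 -> F2 c \in unitmx /\ invmx (F2 c) = F2 c^-1.
  by rewrite !F2E; exact: (factorV dressed_rho_orthogonal dressed_null cL').
have pN : p None x = F1 ka by rewrite F1E; exact: erefl.
have p0 : p (Some 0) x = F1 (- ka) by rewrite F1E -(scalar_0 a0); exact: erefl.
have qN : q None x = F2 kb by rewrite F2E; exact: erefl.
have q0 : q (Some 0) x = F2 (- kb) by rewrite F2E -(scalar_0 b0); exact: erefl.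
have E : r None x *m invmx (r (Some 0) x) = F1 ka *m F2 (-1) *m F1 ka^-1 *m F1 (-1).
  rewrite pN p0 qN q0.
  have ka0' : - ka != 0 by rewrite oppr_eq0.
  have kb0' : - kb != 0 by rewrite oppr_eq0.
  have [u1 i1] := F1V _ ka0'.
  have [u2 i2] := F2V _ kb0'.
  have -> : invmx (F1 (- ka) *m F2 (- kb)) = F2 (- kb)^-1 *m F1 (- ka)^-1.
    by rewrite (invmx_mulmx u1 u2) i1 i2.
  rewrite !mulmxA -(mulmxA (F1 _)) F2M ?invr_eq0 ?oppr_eq0// invrN mulrN mulfV//.
  rewrite -!mulmxA; congr (_ *m (_ *m _)).
  by rewrite F1M ?invr_eq0// mulrN1 invrN.
have [l [m [lm lL rm fE]]] := factorP rhoV nL cL x.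
have [l2 [m2 [lm2 lL2 rm2 fE2]]] := factorP dressed_rho_orthogonal dressed_null cL' x.
have [np1 g1] := null_pair_refl lm rm (rhoV.2 x).
have [np2 g2] := null_pair_refl lm2 rm2 (dressed_rho_orthogonal.2 x).
have [K1 E1 d1] := det_reflection (ndV x) BV np1.
(* [F1 ka] and [p] at 0, which is [F1 (- ka)], map [V] to the same bundle: they differ by [F1 (-1)],
   which preserves [V]. *)
have VV : (B *m F1 ka :=: V' x)%MS.
  have B1 : (B *m F1 (-1) :=: B)%MS.
    apply/eqmxP; rewrite F1E fE g1 E1 submxMl /=.
    by apply/submxP; exists (invmx K1); rewrite mulKmx// unitmxE d1 unitfE oppr_eq0 oner_eq0.
  have kaE : F1 (- ka) = F1 (-1) *m F1 ka by rewrite (F1M _ _ m1 ka0) mulN1r.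
  rewrite /bundle_image p0 kaE (mulmxA (V x)).
  apply: eqmxMr; apply: eqmx_trans (eqmx_sym B1) _.
  by apply: eqmxMr.
have [K2 E2 d2] := det_reflection (dressed_nondegenerate x) VV np2.
exists (K2 *m K1); last by rewrite det_mulmx d1 d2 mulrNN mulr1.
rewrite E !mulmxA F2E fE2 g2 E2 -!mulmxA (mulmxA (F1 ka)) F1M ?invr_eq0// mulfV// F11 mul1mx.
by rewrite F1E fE g1 E1.
Qed.

Lemma cstarN (z : C) : cstar (- z) = - cstar z.
Proof.
have cN : ((- z)^*)%C = - (z^*)%C by exact: rmorphN.
by rewrite !cstarE cN invrN.
Qed.

Lemma cay_opp (a z : C) : z - a != 0 -> z + a != 0 -> cay a (- z) = (cay a z)^-1.
Proof.
move=> h1 h2; have h3 : - z + a != 0 by rewrite addrC -opprB oppr_eq0.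
by rewrite /cay; field; rewrite h1 h2 h3.
Qed.

(** As [rho V] is real, conjugation turns the null pair of [alpha] into an undressed pair for [be].
    The conjugate of [r] is then the product in the other order, the pair of [alpha] being dressed
    by the factor at [be]; [permute] identifies it with [r] at [pstar l]. *)
Lemma dressed_real l x : real_bundle V -> simple_dom alpha l -> simple_dom be l ->
  r (pstar l) x = conj_mx (r l x).
Proof.
move=> rV da db.
have [l0 [m0 [lm lL rm fE]]] := factorP rhoV nL cL x.
have [pl g1] := null_pair_refl lm rm (rhoV.2 x).
have rE : conj_mx (rho V x) = rho V x by exact: refl_conj (ndV x) (rV x).
have rK : rho V x *m rho V x = 1%:M by exact: refl_K (ndV x).
have [rh [rhE og]] : exists rh, rh = rho V x /\ rh *m eta *m rh^T = eta.
  by exists (rho V x); split=> //; exact: rhoV.2.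
rewrite -rhE in rm pl g1 rE rK.
have [l1 l1E] : exists l1 : 'rV[C]_N, l1 = l0 *m rh by exists (l0 *m rh).
have [m mE] : exists m, m = conj_mx l0 by exists (conj_mx l0).
have [m1 m1E] : exists m1, m1 = conj_mx l1 by exists (conj_mx l1).
rewrite -l1E in rm pl g1.
have mrE : m *m rh = m1 by rewrite m1E l1E conj_mxM rE mE.
have [h1 h2 h3] := pl.
have pm : null_pair m m1.
  by rewrite mE m1E; split; rewrite inner_conj ?h1 ?h2 ?conjc0// conjc_eq0.
have E1 : inner l1 m1 = inner l0 m by rewrite l1E -mrE inner_orthogonal.
have E2 : inner l1 m = inner l0 m1.
  by rewrite -(inner_orthogonal l0 m1 og) -l1E -mrE -mulmxA rK mulmx1.
pose ka := kap alpha; pose kb := kap be.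
have ka0 : ka != 0 by exact: kap_neq0.
have kb0 : kb != 0 by exact: kap_neq0.
have F1E c : factor V L c x = gam l0 l1 c by rewrite fE g1.
have cab : cay alpha be != 0 by exact: cay_eq0.
have [u uE] : exists u, u = m *m gam l0 l1 (ka * cay alpha be) by eexists.
have [u1 u1E] : exists u1, u1 = m1 *m gam l0 l1 (ka / cay alpha be) by eexists.
have mL : (m :=: conj_mx (L x))%MS.
  by rewrite mE; move: (lL) => /eqmxP /andP [q1 q2]; apply/eqmxP; rewrite /conj_mx !map_submx q1.
have pbe : p (Some be) x = gam l0 l1 (ka * cay alpha be).
  by rewrite -F1E -scalar_Some; exact: erefl.
have pnbe : p (Some (- be)) x = gam l0 l1 (ka / cay alpha be).
  by rewrite -(cay_opp ba bpa) -F1E -scalar_Some; exact: erefl.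
have uL : (u :=: L' x)%MS.
  by rewrite uE /bundle_image pbe; apply: eqmxMr.
have u1L : (u1 :=: bundle_image L' (rho V') x)%MS.
  rewrite dressed_reflected pnbe u1E -mrE -rhE.
  by apply: eqmxMr; apply: eqmxMr.
have nu : null_pair u u1.
  have c1 : ka * cay alpha be != 0 by rewrite mulf_neq0.
  have c2 : ka / cay alpha be != 0 by rewrite mulf_neq0// invr_eq0.
  have [q1 q2 q3] := pm.
  split.
  - by rewrite uE inner_orthogonal//; exact: gam_orthogonal.
  - by rewrite u1E inner_orthogonal//; exact: gam_orthogonal.
  - have /submxP[X XE] : (L' x <= u)%MS by rewrite uL.
    have /submxP[Y YE] : (bundle_image L' (rho V') x <= u1)%MS by rewrite u1L.
    have EE : L' x *m eta *m (bundle_image L' (rho V') x)^T = X *m (inner u u1)%:M *m Y^T.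
      by rewrite -innerE XE YE trmx_mul !mulmxA.
    by apply: contra (cL' x) => /eqP e; rewrite EE e raddf0 mulmx0 mul0mx.
have F2E c : factor V' L' c x = gam u u1 c by exact: Gamma_frame.
have rrE k : r k x = gam l0 l1 (simple_scalar alpha k) *m gam u u1 (simple_scalar be k).
  by rewrite -F1E -F2E; exact: erefl.
have nbE : pstar (Some be : P1) = Some alpha.
  by rewrite /pstar /Defs.pinv conjc_eq0 (negbTE b0) -cstarE cstarK.
have nnbE : pstar (Some (- be) : P1) = Some (- alpha).
  have -> : pstar (Some (- be) : P1) = Some (cstar (- be)).
    by rewrite /pstar /Defs.pinv conjc_eq0 oppr_eq0 (negbTE b0).
  by rewrite cstarN cstarK.
(* The scalar of [p] at [be] is conjugate to the scalar for [be] at [cstar be = alpha]: each pair is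
   dressed by conjugate constants. *)
have k1 : ((ka * cay alpha be)^*)%C = kb * cay be alpha.
  by rewrite /ka -scalar_Some -(scalar_star (Some be : P1) a0 a1) nbE scalar_Some.
have k2 : ((ka / cay alpha be)^*)%C = kb / cay be alpha.
  rewrite /ka -(cay_opp ba bpa) -scalar_Some -(scalar_star (Some (- be) : P1) a0 a1) nnbE.
  rewrite scalar_Some cay_opp//; first by rewrite -opprB oppr_eq0.
  by rewrite addrC.
have x1 : simple_scalar alpha (pstar l) = ((simple_scalar be l)^*)%C.
  by rewrite -(scalar_star l b0 b1) cstarK.
have y1 : simple_scalar be (pstar l) = ((simple_scalar alpha l)^*)%C by exact: scalar_star.
have da' : simple_dom alpha (pstar l) by have := simple_dom_star b0 db; rewrite cstarK.
have db' : simple_dom be (pstar l) by exact: simple_dom_star.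
have nz : inner u u1 != 0 by case: nu.
have cay1 (a : C) : a != 1 -> a != -1 -> kap a * cay a 1 = 1.
  move=> n1 n2; rewrite /kap /cay; have s1 : 1 - a != 0 by rewrite subr_eq0 eq_sym.
  have s2 : 1 + a != 0 by rewrite addrC addr_eq0.
  by field; rewrite s1 s2.
have xy : simple_scalar alpha (pstar l) = ka /\ simple_scalar be (pstar l) = kb \/
    exists la, [/\ la - alpha != 0, la + alpha != 0, la - be != 0, la + be != 0 &
      simple_scalar alpha (pstar l) = ka * cay alpha la /\
      simple_scalar be (pstar l) = kb * cay be la].
  case: (pstar l) da' db' => [w|] da' db'; last by left.
  move/simple_domP: da' => [d1 d2]; move/simple_domP: db' => [d3 d4].
  by right; exists w; split=> //; rewrite !scalar_Some.
rewrite uE u1E in nz.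
have := permute pl pm E1 E2 a0 b0 ba bpa ka0 kb0 (cay1 _ a1 am1) (cay1 _ b1 bm1) xy nz.
rewrite -uE -u1E -rrE => ->.
have l0E : conj_mx m = l0 by rewrite mE conj_mxK.
have l1E' : conj_mx m1 = l1 by rewrite m1E conj_mxK.
by rewrite rrE conj_mxM !gam_conj uE u1E !conj_mxM !gam_conj l0E l1E' -mE -m1E k1 k2 x1 y1.
Qed.

End TwoFactors.

(** * Lagrange interpolation *)

Section Lagrange.
Variables (K : fieldType) (d : nat) (w : 'I_d.+1 -> K).
Hypothesis injw : injective w.

Definition lagrange_poly (m : 'I_d.+1) : {poly K} :=
  \prod_(j | j != m) ((w m - w j)^-1 *: ('X - (w j)%:P)).

Lemma lagrange_node m j : (lagrange_poly m).[w j] = (j == m)%:R.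
Proof.
rewrite horner_prod; have [->|jm] := eqVneq j m.
  apply: big1 => i im; rewrite hornerZ hornerXsubC mulVf// subr_eq0.
  by apply: contraNneq im => /injw ->.
by rewrite (bigD1 j)//= hornerZ hornerXsubC subrr mulr0 mul0r.
Qed.

Lemma size_lagrange m : (size (lagrange_poly m) <= d.+1)%N.
Proof.
apply: leq_trans (size_prod_leq _ _) _.
have h : (\sum_(j | j != m) size ((w m - w j)^-1 *: ('X - (w j)%:P)) <= \sum_(j | j != m) 2)%N.
  by apply: leq_sum => j _; apply: leq_trans (size_scale_leq _ _) _; rewrite size_XsubC.
have cE : #|[pred j : 'I_d.+1 | j != m]| = d by rewrite cardC1 card_ord.
move: h; rewrite sum_nat_const cE => h.
by rewrite leq_subLR (leq_trans (n := (d * 2).+1))// muln2 -addnn addnS.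
Qed.

(** The difference of the two sides has size at most [d.+1] and vanishes at [d.+1] distinct
    nodes. *)
Lemma polyf_lagrange f z : polyf d f -> f z = \sum_m (lagrange_poly m).[z] * f (w m).
Proof.
move=> [p sp fp]; pose q := p - \sum_m p.[w m] *: lagrange_poly m.
have q0 : q = 0.
  apply/eqP; apply: contraT => qn0.
  have rq : all (root q) (codom w).
    apply/allP => _ /codomP[j ->]; rewrite /root hornerD hornerN horner_sum (bigD1 j)//= big1.
      by rewrite hornerZ lagrange_node eqxx mulr1 addr0 subrr.
    by move=> i ij; rewrite hornerZ lagrange_node eq_sym (negbTE ij) mulr0.
  have uw : uniq (codom w) by rewrite map_inj_uniq ?enum_uniq.
  have := max_poly_roots qn0 rq uw; rewrite size_map -cardE card_ord ltnNge => /negP; case.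
  apply: leq_trans (size_polyD _ _) _; rewrite geq_max sp size_polyN.
  apply: leq_trans (size_sum _ _ _) _; apply/bigmax_leqP => i _.
  exact: leq_trans (size_scale_leq _ _) (size_lagrange i).
have /eqP := q0; rewrite subr_eq0 => /eqP pE.
rewrite fp {1}pE horner_sum; apply: eq_bigr => m _.
by rewrite hornerZ mulrC fp.
Qed.

End Lagrange.

(** * Domains and holomorphy on the projective line *)

Section Domains.
Context {R : realType}.
Local Notation C := (R[i]).
Local Notation P1 := (one_point_compactification R[i]^o).

Lemma open_simple_dom (a : C) : open [set z : R[i]^o | simple_dom a (Some z)].
Proof.
rewrite openE => z /= /simple_domP[h1 h2].
have n1 : z != a by rewrite -subr_eq0.
have n2 : z != - a by rewrite -subr_eq0 opprK.
apply: filterS2 (nbhs_neq n1) (nbhs_neq n2) => y y1 y2.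
by apply/simple_domP; rewrite subr_eq0 addr_eq0.
Qed.

Lemma simple_dom_nbhs_infty (a : C) : nbhs (None : P1) (simple_dom a).
Proof.
(* A neighbourhood of infinity contains the complement of a closed compact set; here that set
   consists of the two excluded points. *)
exists ([set (a : R[i]^o)] `|` [set (- a : R[i]^o)]).
  split; first by apply: compactU; exact: compact_set1.
  rewrite -[X in closed X]setCK; apply: open_closedC.
  have -> : ~` ([set (a : R[i]^o)] `|` [set (- a : R[i]^o)]) = [set z : R[i]^o | simple_dom a (Some z)].
    apply/seteqP; split=> z /=.
      by move=> /not_orP[h1 h2]; split=> -[]; [move/h1|move/h2].
    by move=> [h1 h2] [e|e]; [apply: h1|apply: h2]; rewrite e.
  exact: open_simple_dom.
move=> [z|_]; last exact: simple_domN.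
move=> [[y /not_orP[h1 h2] [<-]]|//]; by split=> -[]; [move/h1|move/h2].
Qed.

Lemma simple_dom_pinv (a w : C) : a != 0 -> simple_dom a (Defs.pinv w) <->
  1 - a * w != 0 /\ 1 + a * w != 0.
Proof.
move=> a0; rewrite /Defs.pinv; have [->|w0] := eqVneq w 0.
  by split=> [_|_]; [rewrite mulr0 subr0 addr0 oner_neq0|exact: simple_domN].
have e1 : w^-1 - a = (1 - a * w) / w by field.
have e2 : w^-1 + a = (1 + a * w) / w by field.
by rewrite simple_domP e1 e2 !mulf_eq0 !invr_eq0 !(negbTE w0) !orbF.
Qed.

Lemma scalar_pinv (a w : C) : a != 0 -> simple_dom a (Defs.pinv w) ->
  simple_scalar a (Defs.pinv w) = kap a * ((1 - a * w) / (1 + a * w)).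
Proof.
move=> a0; rewrite simple_dom_pinv// => -[h1 h2].
rewrite /Defs.pinv; have [->|w0] := eqVneq w 0.
  by rewrite mulr0 subr0 addr0 divr1 mulr1.
rewrite scalar_Some /cay; congr (_ * _).
have -> : w^-1 - a = (1 - a * w) / w by field.
have -> : w^-1 + a = (1 + a * w) / w by field.
by field; rewrite h2 w0.
Qed.

End Domains.

Section HolomorphicFactors.
Context {R : realType} {S : riemannSurface R} {n : nat}.
Local Notation C := (R[i]).
Local Notation N := n.+2.
Local Notation coord := (@Defs.coord R S).

Definition node (j : nat) : C := match j with 0 => 1 | 1 => -1 | _ => 2 end.
Definition weight (j : nat) (c : C) : C := match j with
  | 0 => (c + 1) * (c - 2) / (- 2 * c)
  | 1 => (c - 1) * (c - 2) / (- 6 * c)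
  | _ => 2 * (c - 1) * (c + 1) / (3 * c) end.

Lemma sum_node (G : C -> 'M[C]_N) c : \sum_(j < 3) weight j c *: G (node j) =
  weight 0 c *: G 1 + weight 1 c *: G (-1) + weight 2 c *: G 2.
Proof. by rewrite !big_ord_recl big_ord0 addr0 addrA. Qed.

Lemma weight_derivable j c : c != 0 -> derivable (weight j : R[i]^o -> R[i]^o) c 1.
Proof.
move=> c0; have i := @cder_id R c.
have dp (t : C) := cderD i (cder_cst t c).
have dq (t : C) (t0 : t != 0) := cderV (f := fun y => t * y) (mulf_neq0 t0 c0) (cderZ t i).
have nz (k : nat) : (k.+1%:R : C) != 0 by rewrite pnatr_eq0.
have nnz (k : nat) : (- k.+1%:R : C) != 0 by rewrite oppr_eq0 pnatr_eq0.
case: j => [|[|j]].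
- exact: cder_derivable (cderM (cderM (dp 1) (dp (- 2))) (dq (- 2) (nnz 1%N))).
- exact: cder_derivable (cderM (cderM (dp (- 1)) (dp (- 2))) (dq (- 6) (nnz 5%N))).
- exact: cder_derivable (cderM (cderM (cderZ 2 (dp (- 1))) (dp 1)) (dq 3 (nz 2%N))).
Qed.

(** By interpolation each factor is a sum of three smooth matrices with scalar weights, so the
    product is a sum of nine terms of the kind treated by [holo_family_sum]. *)
Lemma holo_factor_product (V L V' L' : S -> 'M[C]_N) (U : set R[i]^o) (c1 c2 : R[i]^o -> R[i]^o)
    (r : C -> S -> 'M[C]_N) :
  orthogonal_gauge (rho V) -> null_line_subbundle L -> complementary L (bundle_image L (rho V)) ->
  orthogonal_gauge (rho V') -> null_line_subbundle L' -> complementary L' (bundle_image L' (rho V')) ->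
  open U -> (forall z, U z -> derivable c1 z 1 /\ c1 z != 0) ->
  (forall z, U z -> derivable c2 z 1 /\ c2 z != 0) ->
  (forall z x, U z -> r z x = factor V L (c1 z) x *m factor V' L' (c2 z) x) ->
  holo_mx U (fun z (_ : chart S) => r z).
Proof.
move=> rV nL cL rV' nL' cL' oU d1 d2 rE i a b.
pose f (jk : 'I_3 * 'I_3) (z : R[i]^o) : R[i]^o :=
  (factor V L (node jk.1) (chartV i z) *m factor V' L' (node jk.2) (chartV i z)) a b.
pose c (jk : 'I_3 * 'I_3) (l : R[i]^o) : R[i]^o := weight jk.1 (c1 l) * weight jk.2 (c2 l).
have n0 j : node j != 0.
  by case: j => [|[|j]] /=; rewrite ?oppr_eq0 ?oner_eq0// pnatr_eq0.
apply: (@holo_family_sum R U _ _ (index_enum _) c f) => //.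
- exact: range_open.
- move=> [j k] l Ul; have [q1 w1] := d1 l Ul; have [q2 w2] := d2 l Ul.
  have h1 := cder_comp (derivable_cder q1) (derivable_cder (@weight_derivable j (c1 l) w1)).
  have h2 := cder_comp (derivable_cder q2) (derivable_cder (@weight_derivable k (c2 l) w2)).
  exact: cder_derivable (cderM h1 h2).
- move=> [j k]; have [s1 _] := factor_orthogonal rV nL cL (n0 j).
  have [s2 _] := factor_orthogonal rV' nL' cL' (n0 k).
  have := smooth_mxM (@openT S) s1 s2 => /(_ i a b).
  by rewrite setIT.
- move=> l z Ul _; have [q1 w1] := d1 l Ul; have [q2 w2] := d2 l Ul.
  have FE (W M : S -> 'M[C]_N) e x : orthogonal_gauge (rho W) -> null_line_subbundle M ->
      complementary M (bundle_image M (rho W)) -> e != 0 ->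
      factor W M e x = \sum_(j < 3) weight j e *: factor W M (node j) x.
    move=> h1 h2 h3 e0; rewrite (factor_interpolation h1 h2 h3 x e0).
    exact/esym/(sum_node (fun e => factor W M e x)).
  rewrite rE// (FE V L)// (FE V' L')// mulmx_suml summxE.
  rewrite -(pair_bigA _ (fun j k => c (j, k) l * f (j, k) z)) /=; apply: eq_bigr => j _.
  rewrite mulmx_sumr summxE; apply: eq_bigr => k _.
  by rewrite -scalemxAl -scalemxAr scalerA mxE.
Qed.

End HolomorphicFactors.

(** * The dressed connection forms *)

Section DressedConnection.
Context {R : realType} {S : riemannSurface R} {n k : nat}.
Local Notation C := (R[i]).
Local Notation N := n.+2.
Local Notation nondegenerate := (@Defs.nondegenerate R S n).
Local Notation coord := (@Defs.coord R S).
Local Notation P1 := (one_point_compactification R[i]^o).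
Implicit Types (x : S) (i : chart S) (b : bool) (l a : C).

Variables (V L : S -> 'M[C]_N) (d : C -> connection S N) (alpha : C).
Hypothesis ph : perturbed_harmonic k V d.
Hypotheses (a0 : alpha != 0) (na : `|alpha| != 1).
Hypothesis nL : null_line_subbundle L.
Hypothesis pL : parallel (d alpha) L.
Hypothesis cL : complementary L (bundle_image L (rho V)).

Local Notation be := (cstar alpha).
Local Notation p := (simple_factor V alpha L).
Local Notation L' := (bundle_image (fun x => conj_mx (L x)) (p (Some be))).
Local Notation V' := (bundle_image V (p (Some 0))).
Hypothesis cL' : complementary L' (bundle_image L' (rho V')).

Local Notation q := (simple_factor V' be L').
Local Notation r := (fun (l : P1) x => p l x *m q l x).

Let ndV : nondegenerate V. Proof. by case: ph => -[]. Qed.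
Let rhoV : orthogonal_gauge (rho V).
Proof. by case: ph => -[sV _ nV _] _ _ _ _; exact: rho_orthogonal_gauge sV nV. Qed.
Let pole : pole10 k d. Proof. by case: ph => _ _ _ _ []. Qed.
Let dconj l : l != 0 -> is_conj_of (d l) (d (cstar l)).
Proof. by case: ph => _ _ _ _ [h _]; exact: h. Qed.
Let drho l : l != 0 -> is_gauge_of (rho V) (d l) (d (- l)).
Proof. by case: ph => _ _ _ h _; exact: h. Qed.
Let dmetric l : l != 0 -> metric (d l).
Proof. by case: ph => _ h _ _ _ /h[]. Qed.
Let b0 : be != 0. Proof. by rewrite cstarE invr_eq0 conjc_eq0. Qed.
Let a1 : alpha != 1. Proof. by have [] := off_circle a0 na. Qed.
Let am1 : alpha != -1. Proof. by have [] := off_circle a0 na. Qed.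
Let b1 : be != 1. Proof. by have [] := off_circle a0 na. Qed.
Let bm1 : be != -1. Proof. by have [] := off_circle a0 na. Qed.
Let rhoV' := dressed_rho_orthogonal rhoV ndV nL cL a0 na.
Let nL' := dressed_null rhoV nL cL a0 na.

(** In the coordinate [l^-1] the factor at [a] becomes one at [a^-1]; [cay_inv] contributes a sign,
    absorbed in this constant. *)
Definition nkap b (a : C) : C := if b then - kap a else kap a.

Lemma nkap_neq0 b a : a != 1 -> a != -1 -> nkap b a != 0.
Proof. by move=> h1 h2; case: b; rewrite /= ?oppr_eq0 kap_neq0. Qed.

Lemma scalar_nu b a l : a != 0 -> l != 0 ->
  simple_scalar a (Some l : P1) = nkap b a * cay (nu b a) (nu b l).
Proof. by move=> h1 h2; case: b; rewrite scalar_Some//= cay_inv// mulrNN. Qed.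

Lemma nuN b l : nu b (- l) = - nu b l.
Proof. by case: b => //=; rewrite invrN. Qed.

Lemma nu_neq b a l : a != 0 -> l != 0 -> l - a != 0 -> nu b l - nu b a != 0.
Proof.
move=> h1 h2; case: b => //=; rewrite !subr_eq0; apply: contra => /eqP e.
by apply/eqP; exact: invr_inj.
Qed.

Lemma nu_neqN b a l : a != 0 -> l != 0 -> l + a != 0 -> nu b l + nu b a != 0.
Proof. by move=> h1 h2 h3; rewrite -[nu b a]opprK -nuN nu_neq ?oppr_eq0 ?opprK. Qed.

(** Each factor needs its line parallel at its own parameter and the reflected line parallel at the
    opposite one. For the second factor these come from the conjugate of [L], parallel at [be], and
    from its reflection, parallel at [- be]. Both values are regular for [p], so gauging by [p]
    carries the two lines to [L'] and to its reflection in [V']. *)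
Lemma dressed_family b i x : dom i x -> exists2 B, polymx k B &
  forall l, l != 0 -> simple_dom alpha (Some l : P1) -> simple_dom be (Some l : P1) ->
    gauge_form b (r (Some l)) (d l) i x = B (nu b l).
Proof.
move=> dx; have [A pA AE] := conn_family b pole dconj dx.
have sk l : l != 0 -> skew (A (nu b l)).
  by move=> l0; rewrite -AE//; apply: cn_skew => //; exact: dmetric.
have na0 : - alpha != 0 by rewrite oppr_eq0.
have nb0 : - be != 0 by rewrite oppr_eq0.
have p1 : parallel_at b i x L (A (nu b alpha)).
  by rewrite -AE//; exact: parallel_parallel_at.
have p2 : parallel_at b i x (bundle_image L (rho V)) (A (- nu b alpha)).
  rewrite -nuN -AE//; apply: parallel_parallel_at => //.
  exact: (parallel_gauge rhoV (drho a0) pL).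
have pcL := parallel_conj (dconj a0) pL.
have p3 : parallel_at b i x (fun y => conj_mx (L y)) (A (nu b be)).
  by rewrite -AE//; exact: parallel_parallel_at.
have p4 : parallel_at b i x (bundle_image (fun y => conj_mx (L y)) (rho V)) (A (- nu b be)).
  rewrite -nuN -AE//; apply: parallel_parallel_at => //.
  exact: (parallel_gauge rhoV (drho b0) pcL).
have skna : skew (A (- nu b alpha)) by rewrite -nuN; exact: sk.
have [B1 pB1 B1E] := factor_step rhoV nL cL dx pA (nkap_neq0 b a1 am1) skna p1 p2.
have step1 l : l != 0 -> simple_dom alpha (Some l : P1) ->
    gform b i x (p (Some l)) (A (nu b l)) = B1 (nu b l) /\ skew (B1 (nu b l)).
  move=> l0 /simple_domP[h1 h2].
  have [e1 e2] := B1E _ (sk l l0) (nu_neq b a0 l0 h1) (nu_neqN b a0 l0 h2).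
  have pE : p (Some l) = factor V L (nkap b alpha * cay (nu b alpha) (nu b l)).
    rewrite -(scalar_nu b a0 l0); exact: erefl.
  by rewrite pE e1; split.
have dbe := dom_be a0 na; have dnbe := dom_nbe a0 na.
have ogp (l : P1) (dl : simple_dom alpha l) := simple_factor_orthogonal rhoV nL cL a0 na dl.
have p5 : parallel_at b i x L' (B1 (nu b be)).
  rewrite -(step1 be b0 dbe).1.
  exact: (parallel_at_gauge dx (ogp _ dbe) p3).
have p6 : parallel_at b i x (bundle_image L' (rho V')) (B1 (- nu b be)).
  rewrite -nuN -(step1 _ nb0 dnbe).1.
  have -> : bundle_image L' (rho V') =
      bundle_image (bundle_image (fun y => conj_mx (L y)) (rho V)) (p (Some (- be))).
    by apply/funext => y; exact: (dressed_reflected rhoV ndV nL cL a0 na y).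
  by apply: (parallel_at_gauge dx (ogp _ dnbe)); rewrite nuN.
have sknb : skew (B1 (- nu b be)) by rewrite -nuN; exact: (step1 _ nb0 dnbe).2.
have [B pB BE] := factor_step rhoV' nL' cL' dx pB1 (nkap_neq0 b b1 bm1) sknb p5 p6.
exists B => // l l0 da db; have [e1 s1] := step1 l l0 da.
have ogq : orthogonal_gauge (q (Some l)).
  exact: (factor_orthogonal rhoV' nL' cL' (scalar_neq0 b1 bm1 db)).
have gE := gform_mul b (cn b (d l) i x) dx (ogp _ da) ogq.
move/simple_domP: (db) => [h1 h2].
have [e2 _] := BE _ s1 (nu_neq b b0 l0 h1) (nu_neqN b b0 l0 h2).
have qE : q (Some l) = factor V' L' (nkap b be * cay (nu b be) (nu b l)).
  rewrite -(scalar_nu b b0 l0); exact: erefl.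
have E1 : gform b i x (p (Some l)) (cn b (d l) i x) = B1 (nu b l).
  rewrite (AE l l0); exact: e1.
have E2 : gform b i x (q (Some l)) (B1 (nu b l)) = B (nu b l) by rewrite qE; exact: e2.
exact: (etrans gE (etrans (congr1 (gform b i x (q (Some l))) E1) E2)).
Qed.

End DressedConnection.

Section Extension.
Context {R : realType} {S : riemannSurface R} {n : nat}.
Local Notation C := (R[i]).
Local Notation N := n.+2.
Local Notation coord := (@Defs.coord R S).
Implicit Types (x : S) (i : chart S) (b : bool).

Lemma smooth_mx_lincomb (W : set S) (I : finType) p q (c : I -> C) (F : I -> S -> 'M[C]_(p, q)) :
  open W -> (forall m, smooth_mx W (F m)) -> smooth_mx W (fun x => \sum_m c m *: F m x).
Proof.
move=> oW sF; apply/smooth_mxP => a b.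
apply: (@smooth_fun_ext _ _ W oW (fun x => \sum_(m <- index_enum I) c m * F m x a b)).
  by move=> x _; rewrite summxE; apply: eq_bigr => m _; rewrite mxE.
apply: smooth_fun_sum => // m; apply: smooth_funM => //; first exact: smooth_fun_cst.
by have /smooth_mxP := sF m; exact.
Qed.

(** The transition rule for forms is linear, so constant combinations are forms again. The two types
    have separate coefficients because their interpolation variables [nu b] differ. *)
Lemma combine_connections (I : finType) (c : bool -> I -> C)
    (F : bool -> I -> chart S -> S -> 'M[C]_N) :
  (forall b m i, smooth_mx (dom i) (F b m i)) ->
  (forall b m i j x, dom i x -> dom j x -> F b m i x = dtr b i j x *: F b m j x) ->
  exists A : connection S N, forall b i x, cn b A i x = \sum_m c b m *: F b m i x.
Proof.
move=> sF tF; pose G b i x := \sum_m c b m *: F b m i x.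
have sG b i : smooth_mx (dom i) (G b i).
  by apply: smooth_mx_lincomb => //; exact: dom_open.
have tG b i j x : dom i x -> dom j x -> G b i x = dtr b i j x *: G b j x.
  move=> di dj; rewrite /G scaler_sumr; apply: eq_bigr => m _.
  by rewrite (tF b m i j x di dj) !scalerA mulrC.
exists (Connection (sG false) (sG true) (tG false) (tG true)).
by case.
Qed.

Variables (k : nat) (D : set C) (d : C -> connection S N) (r : C -> S -> 'M[C]_N).
Variable w : 'I_k.+1 -> C.
Hypothesis og : forall z, z != 0 -> D z -> orthogonal_gauge (r z).
Hypothesis fam : forall b i x, dom i x -> exists2 B, polymx k B &
  forall z, z != 0 -> D z -> gauge_form b (r z) (d z) i x = B (nu b z).
Hypotheses (w_inj : injective w) (w_neq0 : forall m, w m != 0) (wD : forall m, D (w m)).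
Hypotheses (D1 : D 1) (r1 : forall x, r 1 x = 1%:M) (d1 : is_d (d 1)).

Let v b (m : 'I_k.+1) : C := nu b (w m).
Let v_inj b : injective (v b).
Proof. by case: b => [m1 m2 /invr_inj /w_inj //|]. Qed.

Lemma horner_derivable (P : {poly C}) (z : C) : derivable (fun y : R[i]^o => P.[y] : R[i]^o) z 1.
Proof.
suff [l h] : exists l, cder (fun y : R[i]^o => P.[y] : R[i]^o) z l by exact: cder_derivable h.
elim/poly_ind: P => [|P c [l h]].
  exists 0; have -> : (fun y : R[i]^o => (0 : {poly C}).[y] : R[i]^o) = (fun=> 0).
    by apply/funext => y; rewrite horner0.
  exact: cder_cst.
exists (l * z + P.[z] * 1 + 0).
have -> : (fun y : R[i]^o => (P * 'X + c%:P).[y] : R[i]^o) = (fun y => P.[y] * y + c).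
  by apply/funext => y; rewrite hornerD hornerMX hornerC.
exact: cderD (cderM h (cder_id z)) (cder_cst c z).
Qed.

(** [fam] gives polynomials point by point. Interpolation at the nodes [w] replaces them by
    combinations of the gauged forms there, which are smooth and transform as forms, with weights
    holomorphic off 0. *)
Lemma extend_family : exists dhat : C -> connection S N,
  [/\ holo_mx [set z : C | z != 0] (fun z => conn10 (dhat z)),
      holo_mx [set z : C | z != 0] (fun z => conn01 (dhat z)),
      is_d (dhat 1) &
      forall z, z != 0 -> D z -> is_gauge_of (r z) (d z) (dhat z)].
Proof.
pose F b m i x := gauge_form b (r (w m)) (d (w m)) i x.
have ogw m : orthogonal_gauge (r (w m)) by exact: og.
have sF b m i : smooth_mx (dom i) (F b m i) by exact: gauge_form_smooth.
have tF b m i j x : dom i x -> dom j x -> F b m i x = dtr b i j x *: F b m j x.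
  by move=> di dj; exact: gauge_form_transition.
pose c z b m := (lagrange_poly (v b) m).[nu b z].
have /choice[dhat dhatE] : forall z, exists A : connection S N,
    forall b i x, cn b A i x = \sum_m c z b m *: F b m i x.
  by move=> z; exact: combine_connections.
(* At a regular parameter the gauged form is itself polynomial of degree at most [k] in [nu b z], so
   the interpolant reproduces it. *)
have hatE b z i x : z != 0 -> D z -> dom i x -> cn b (dhat z) i x = gauge_form b (r z) (d z) i x.
  move=> z0 Dz dx; rewrite dhatE; have [B pB BE] := fam b dx; rewrite (BE z z0 Dz).
  apply/matrixP => p q; rewrite summxE (polyf_lagrange (@v_inj b) (nu b z) (pB p q)).
  by apply: eq_bigr => m _; rewrite mxE /F BE.
have oD : open [set z : R[i]^o | z != 0].
  by rewrite openE => z /= z0; exact: nbhs_neq.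
have holo b : holo_mx [set z : C | z != 0] (fun z => cn b (dhat z)).
  move=> i p q.
  apply: (@holo_family_sum R [set z : R[i]^o | z != 0] _ _ (index_enum 'I_k.+1)
    (fun m z => c z b m) (fun m z => F b m i (chartV i z) p q)) => //.
  - exact: range_open.
  - move=> m z z0; have /derivable_cder h := @horner_derivable (lagrange_poly (v b) m) (nu b z).
    rewrite /c; case: b h => h; last exact: cder_derivable h.
    have h1 : cder (fun y : R[i]^o => y^-1 : R[i]^o) z _ := cderV (f := id) z0 (cder_id z).
    exact: cder_derivable (cder_comp h1 h).
  - by move=> m; have := sF b m i i p q; rewrite setIid.
  - by move=> z y _ _; rewrite dhatE summxE; apply: eq_bigr => m _; rewrite mxE.
exists dhat; split; [exact: (holo false)|exact: (holo true)| |].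
  have z1 : (1 : C) != 0 by exact: oner_neq0.
  have h b i x : dom i x -> cn b (dhat 1) i x = 0.
    move=> dx; rewrite (hatE b 1 i x z1 D1 dx) /gauge_form.
    have -> : (fun y => invmx (r 1 y)) = (fun _ : S => 1%:M).
      by apply/funext => y; rewrite r1 invmx1.
    have [e1 e2] := d1 dx.
    have -> : cn b (d 1) i x = 0 by case: b.
    by rewrite (ddmx_cst b i x) mul0mx mulmx0 mul0mx addr0.
  by move=> i x dx; split; [exact: (h false)|exact: (h true)].
by move=> z z0 Dz; apply: gauge_formP; [exact: og|move=> b i x; exact: hatE].
Qed.

End Extension.

Section ScalarFamilies.
Context {R : realType}.
Local Notation C := (R[i]).
Local Notation P1 := (one_point_compactification R[i]^o).
Implicit Types (a z w : C).

Lemma scalar_derivable a z : simple_dom a (Some z : P1) ->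
  derivable (fun y : R[i]^o => simple_scalar a (Some y : P1) : R[i]^o) z 1.
Proof.
move=> /simple_domP[_ h2]; have i := @cder_id R z.
have -> : (fun y : R[i]^o => simple_scalar a (Some y : P1) : R[i]^o) =
    (fun y => kap a * ((y + - a) * (y + a)^-1)) by apply/funext => y; rewrite scalar_Some.
have h := cderV (f := fun y => y + a) h2 (cderD i (cder_cst a z)).
exact: cder_derivable (cderZ (kap a) (cderM (cderD i (cder_cst (- a) z)) h)).
Qed.

Lemma scalar_pinv_derivable a w : 1 + a * w != 0 ->
  derivable (fun y : R[i]^o => kap a * ((1 - a * y) / (1 + a * y)) : R[i]^o) w 1.
Proof.
move=> h2; have i := @cder_id R w.
have h := cderV (f := fun y => 1 + a * y) h2 (cderD (cder_cst 1 w) (cderZ a i)).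
have h1 := cderB (cder_cst 1 w) (cderZ a i).
exact: cder_derivable (cderZ (kap a) (cderM h1 h)).
Qed.

(** In the coordinate [w = 1 / l] the excluded points are the inverses of [a] and [- a]. *)
Lemma open_simple_dom_pinv a : a != 0 -> open [set w : R[i]^o | simple_dom a (Defs.pinv w)].
Proof.
move=> a0; have -> : [set w : R[i]^o | simple_dom a (Defs.pinv w)] =
    [set w : R[i]^o | simple_dom a^-1 (Some w)]; last exact: open_simple_dom.
apply/seteqP; split=> w /=; rewrite simple_dom_pinv// simple_domP.
  have -> : w - a^-1 = - ((1 - a * w) / a) by field.
  have -> : w + a^-1 = (1 + a * w) / a by field.
  by rewrite oppr_eq0 !mulf_eq0 !invr_eq0 !(negbTE a0) !orbF.
have -> : 1 - a * w = - (a * (w - a^-1)) by field.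
have -> : 1 + a * w = a * (w + a^-1) by field.
by rewrite oppr_eq0 !mulf_eq0 !(negbTE a0).
Qed.

Lemma scalar1 a : a != 1 -> a != -1 -> simple_scalar a (Some 1 : P1) = 1.
Proof.
move=> n1 n2; rewrite scalar_Some /kap /cay; have s1 : 1 - a != 0 by rewrite subr_eq0 eq_sym.
have s2 : 1 + a != 0 by rewrite addrC addr_eq0.
by field; rewrite s1 s2.
Qed.

(* Large natural numbers avoid the poles. *)
Lemma interpolation_nodes a b k : exists w : 'I_k.+1 -> C, [/\ injective w,
  forall m, w m != 0, forall m, simple_dom a (Some (w m) : P1) &
  forall m, simple_dom b (Some (w m) : P1)].
Proof.
pose M := Num.bound (nrm a + nrm b); pose w (m : 'I_k.+1) : C := (M + m).+1%:R.
have nw m : nrm (w m) = (M + m).+1%:R.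
  have -> : w m = ((M + m).+1%:R : R)%:C%C by rewrite rmorph_nat.
  by rewrite nrm_real ger0_norm.
have M0 : nrm a + nrm b < M%:R.
  by apply: archi_boundP; rewrite addr_ge0// nrm_ge0.
have lt m : nrm a < nrm (w m) /\ nrm b < nrm (w m).
  have : M%:R <= nrm (w m) by rewrite nw ler_nat -addnS leq_addr.
  by have := nrm_ge0 a; have := nrm_ge0 b; split; lra.
have dom_ (c : C) m : nrm c < nrm (w m) -> simple_dom c (Some (w m) : P1).
  move=> h; apply/simple_domP; split.
    by rewrite subr_eq0; apply: contraTneq h => ->; rewrite ltxx.
  by rewrite addr_eq0; apply: contraTneq h => ->; rewrite nrmN ltxx.
exists w; split.
- by move=> m1 m2 /(congr1 (@nrm R)); rewrite !nw => /eqP; rewrite eqr_nat eqSS eqn_add2l => /eqP /ord_inj.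
- by move=> m; rewrite pnatr_eq0.
- by move=> m; apply: dom_; exact: (lt m).1.
- by move=> m; apply: dom_; exact: (lt m).2.
Qed.

End ScalarFamilies.

Theorem theorem2p20 (R : realType) (S : riemannSurface R) (n k : nat)
    (V : S -> 'M[R[i]]_n.+2) (d : R[i] -> connection S n.+2)
    (alpha : R[i]) (L : S -> 'M[R[i]]_n.+2) :
  perturbed_harmonic k V d ->
  alpha != 0 -> `|alpha| != 1 ->
  null_line_subbundle L ->
  parallel (d alpha) L ->
  complementary L (bundle_image L (rho V)) ->
  let p := simple_factor V alpha L in
  let L' := bundle_image (fun x => conj_mx (L x)) (p (Some (cstar alpha))) in
  let V' := bundle_image V (p (Some 0)) in
  complementary L' (bundle_image L' (rho V')) ->
  dressing_gauge V d
    (simple_dom alpha `&` simple_dom (cstar alpha))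
    (fun l x => p l x *m simple_factor V' (cstar alpha) L' l x).
Proof.
move=> ph a0 na nL pL cL; cbv zeta => cL'.
have [[sV rV ndV _] _ d1 _ _] := ph.
have rhoV := rho_orthogonal_gauge sV ndV.
have [a1 am1 b1 bm1 _] := off_circle a0 na.
have b0 : cstar alpha != 0 by rewrite cstarE invr_eq0 conjc_eq0.
have rhoV' := dressed_rho_orthogonal rhoV ndV nL cL a0 na.
have nL' := dressed_null rhoV nL cL a0 na.
have o1 := openI (@open_simple_dom R alpha) (@open_simple_dom R (cstar alpha)).
have o2 := openI (@open_simple_dom_pinv R alpha a0) (@open_simple_dom_pinv R (cstar alpha) b0).
have d0 (c : R[i]) : c != 0 -> simple_dom c (Some 0 : one_point_compactification R[i]^o).
  by move=> c0; apply/simple_domP; rewrite sub0r add0r oppr_eq0.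
have p0 (c : R[i]) : simple_dom c (Defs.pinv (0 : R[i])).
  by rewrite /Defs.pinv eqxx; exact: simple_domN.
split.
- exact: (open_nbhs_nbhs (conj o1 (conj (d0 _ a0) (d0 _ b0)))).
- exact: (filterI (simple_dom_nbhs_infty alpha) (simple_dom_nbhs_infty (cstar alpha))).
- by move=> l [h1 h2]; split; exact: simple_dom_opp.
- move=> l [h1 h2]; have e1 := simple_dom_star a0 h1; have e2 := simple_dom_star b0 h2.
  rewrite cstarK in e2.
  by split; split=> //; exact: simple_dom_opp.
- move=> l [h1 h2]; exact: (dressed_orthogonal rhoV ndV nL cL a0 na cL' h1 h2).
- exists [set z : R[i]^o | simple_dom alpha (Some z) /\ simple_dom (cstar alpha) (Some z)].
  split; [exact: o1|exact: (conj (d0 _ a0) (d0 _ b0))|by []|].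
  apply: (holo_factor_product rhoV nL cL rhoV' nL' cL' o1
    (c1 := fun z => simple_scalar alpha (Some z)) (c2 := fun z => simple_scalar (cstar alpha) (Some z))).
  + by move=> z [h1 h2]; split; [exact: scalar_derivable|exact: scalar_neq0].
  + by move=> z [h1 h2]; split; [exact: scalar_derivable|exact: scalar_neq0].
  + move=> z x _; exact: erefl.
- exists [set w : R[i]^o | simple_dom alpha (Defs.pinv w) /\ simple_dom (cstar alpha) (Defs.pinv w)].
  split; [exact: o2|exact: (conj (p0 _) (p0 _))|by []|].
  apply: (holo_factor_product rhoV nL cL rhoV' nL' cL' o2
    (c1 := fun w => kap alpha * ((1 - alpha * w) / (1 + alpha * w)))
    (c2 := fun w => kap (cstar alpha) * ((1 - cstar alpha * w) / (1 + cstar alpha * w)))).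
  + move=> w [h1 h2]; have /(simple_dom_pinv _ a0)[_ h] := h1.
    by split; [exact: scalar_pinv_derivable|rewrite -(scalar_pinv a0 h1) scalar_neq0].
  + move=> w [h1 h2]; have /(simple_dom_pinv _ b0)[_ h] := h2.
    by split; [exact: scalar_pinv_derivable|rewrite -(scalar_pinv b0 h2) scalar_neq0].
  + move=> w x [h1 h2]; rewrite -(scalar_pinv a0 h1) -(scalar_pinv b0 h2); exact: erefl.
- move=> l m x [h1 h2] [h3 h4].
  exact: (dressed_twist rhoV ndV nL cL a0 na cL' x h1 h2 h3 h4).
- move=> l x [h1 h2]; exact: (dressed_real rhoV ndV nL cL a0 na cL' x rV h1 h2).
- have [w [winj w0 wa wb]] := interpolation_nodes alpha (cstar alpha) k.
  have dom1 (c : R[i]) : c != 1 -> c != -1 -> simple_dom c (Some 1 : one_point_compactification R[i]^o).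
    move=> n1 n2; apply/simple_domP; rewrite subr_eq0 eq_sym n1; split=> //.
    by rewrite addrC addr_eq0.
  (* Both scalars are 1 at [l = 1], so [r] is the identity there; this gives the condition at 1 for
     the extended family. *)
  have [dhat [q1 q2 q3 q4]] := @extend_family R S n k
    [set z : R[i] | simple_dom alpha (Some z : one_point_compactification R[i]^o) /\
      simple_dom (cstar alpha) (Some z : one_point_compactification R[i]^o)] d _ w
    (fun z _ Dz => dressed_orthogonal rhoV ndV nL cL a0 na cL' (proj1 Dz) (proj2 Dz))
    (fun b i x dx => let: ex_intro2 B pB BE := dressed_family ph a0 na nL pL cL cL' b dx in
      ex_intro2 _ _ B pB (fun z z0 Dz => BE z z0 (proj1 Dz) (proj2 Dz)))
    winj w0 (fun m => conj (wa m) (wb m)) (conj (dom1 _ a1 am1) (dom1 _ b1 bm1))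
    (fun x => etrans (congr2 mulmx
       (etrans (congr1 (fun c => factor V L c x) (scalar1 a1 am1)) (factor1 rhoV nL cL x))
       (etrans (congr1 (fun c => factor _ _ c x) (scalar1 b1 bm1)) (factor1 rhoV' nL' cL' x)))
       (mul1mx _)) d1.
  exists dhat; split; [exact: q1|exact: q2|exact: q3|].
  move=> z z0 Dz; exact: (q4 z z0 Dz).
(* [restrictmx] is the matrix of the endomorphism in the frame [row_base (V x)], to which
   [dressed_det] applies. *)
- move=> x; have [K KE dK] := dressed_det rhoV ndV nL cL a0 na cL' (row_base_free (V x)) (eq_row_base (V x)).
  have e : restrictmx (V x) _ = K := etrans (congr1 (fun M => M *m pinvmx (row_base (V x))) KE) (mulmxKp (row_base_free (V x)) K).
  exact: (etrans (congr1 determinant e) dK).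
Qed.
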